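(* Let $\Lambda$ be a lattice in $\mathbb{R}^2$ with $\operatorname{vol}(\Lambda)=\tfrac12$ which possesses a (necessarily unique) generator matrix in Hermite normal form $A=\begin{bmatrix} a & b\\ 0 & d\end{bmatrix}$ (so $a,d>0$, $0\le b<a$, $ad=\tfrac12$, $\Lambda=A\mathbb{Z}^2$). Define the unitary operator $U$ on $L^2(\mathbb{R})$ by $$U=\mathcal{D}_{1/d}\circ\mathcal{F}\circ\mathcal{N}_{-b/d}\circ\mathcal{F}^{-1}.$$ Let $g\in L^2(\mathbb{R})$ be such that (i) $\widehat{Ug}$ is real-valued, and (ii) $\{g_{ma+nb,\,nd}\}_{m,n\in\mathbb{Z}}$ is a tight frame for $L^2(\mathbb{R})$ with frame bound $2$. Then the Wilson system $\mathcal{W}(g,\Lambda,L^2(\mathbb{R}))$ is an orthonormal basis for $L^2(\mathbb{R})$.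
   Context: For $(x,y)\in\mathbb{R}^2$ and $g\in L^2(\mathbb{R})$, $g_{x,y}(t)=e^{2\pi i y t}g(t-x)$. The Fourier transform is $\mathcal{F}f(\omega)=\hat f(\omega)=\int_{\mathbb{R}} f(t)e^{-2\pi i t\omega}\,dt$, with inverse $\mathcal{F}^{-1}$. Dilation: $\mathcal{D}_b f(t)=|b|^{1/2}f(bt)$; chirp: $\mathcal{N}_c f(t)=e^{-\pi i c t^2}f(t)$, for $b,c\in\mathbb{R}$. The volume of $\Lambda=A\mathbb{Z}^2$ is $|\det A|$. A matrix $\begin{bmatrix} a & b\\ c & d\end{bmatrix}$ is in Hermite normal form if $c=0$, $a,d>0$, $0\le b<a$. For $\Lambda$ with Hermite-normal-form generator matrix $\begin{bmatrix} a & b\\ 0 & d\end{bmatrix}$ and $g\in L^2(\mathbb{R})$, the Wilson system $\mathcal{W}(g,\Lambda,L^2(\mathbb{R}))=\{\psi^\Lambda_{m,n}\}_{m\in\mathbb{Z},\,n\ge0}$ is defined by $\psi^\Lambda_{m,0}=g_{2ma,0}$; $\psi^\Lambda_{m,n}=\tfrac{1}{\sqrt2}e^{-\pi i bdn^2}\big(g_{ma+nb,\,nd}+g_{ma-nb,\,-nd}\big)$ if $n\ge1$ and $m+n$ is even; $\psi^\Lambda_{m,n}=\tfrac{i}{\sqrt2}e^{-\pi i bdn^2}\big(g_{ma+nb,\,nd}-g_{ma-nb,\,-nd}\big)$ if $n\ge1$ and $m+n$ is odd. *)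

(* Defs.v *)
From HB Require Import structures.
From mathcomp Require Import all_boot all_order all_algebra.
From mathcomp Require Import complex.
From mathcomp Require Import all_classical all_reals all_analysis.
Set Implicit Arguments. Unset Strict Implicit. Unset Printing Implicit Defensive.
Import Order.TTheory GRing.Theory Num.Theory.
Import numFieldNormedType.Exports.
Local Open Scope classical_set_scope.
Local Open Scope ring_scope.

Section Wilson.
Variable R : realType.
Local Notation C := (complex R).
Local Notation mu := (@lebesgue_measure R).

Definition sqmod (z : C) : R := (complex.Re z) ^+ 2 + (complex.Im z) ^+ 2.

Definition expi (s : R) : C := Complex (cos (2 * pi * s)) (sin (2 * pi * s)).

Definition L2 (f : R -> C) : Prop :=
  measurable_fun setT (fun x => complex.Re (f x)) /\
  measurable_fun setT (fun x => complex.Im (f x)) /\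
  (\int[mu]_x ((sqmod (f x))%:E) < +oo)%E.

Definition l2sq (f : R -> C) : \bar R := (\int[mu]_x ((sqmod (f x))%:E))%E.

Definition ae_eq (f h : R -> C) : Prop := {ae mu, forall x, f x = h x}.

Definition cint (D : set R) (f : R -> C) : C :=
  Complex (Rintegral mu D (fun x => complex.Re (f x)))
          (Rintegral mu D (fun x => complex.Im (f x))).

Definition ip (f h : R -> C) : C := cint setT (fun x => f x * conjc (h x)).

Definition trunc_FT (sgn : R) (f : R -> C) (N : nat) (w : R) : C :=
  cint `[(- N%:R)%R, N%:R]%classic (fun t => f t * expi (sgn * t * w)).

(* Plancherel Fourier transform on L^2(R): fh is (a representative of) F f,
   the L^2-limit of the truncated Fourier integrals *)
Definition is_FT (f fh : R -> C) : Prop :=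
  L2 fh /\
  ((fun N : nat => l2sq (fun w => trunc_FT (-1) f N w - fh w)) @ \oo --> 0%E).

Definition is_IFT (f fc : R -> C) : Prop :=
  L2 fc /\
  ((fun N : nat => l2sq (fun w => trunc_FT 1 f N w - fc w)) @ \oo --> 0%E).

Definition dil (b : R) (f : R -> C) : R -> C :=
  fun t => real_complex R (Num.sqrt `|b|) * f (b * t).

Definition chirp (c : R) (f : R -> C) : R -> C :=
  fun t => expi (- (c * t ^+ 2) / 2) * f t.

Definition is_U (b d : R) (g u : R -> C) : Prop :=
  exists h1 h2 : R -> C,
    is_IFT g h1 /\ is_FT (chirp (- b / d) h1) h2 /\ u = dil (1 / d) h2.

Definition tfs (g : R -> C) (x y : R) : R -> C :=
  fun t => expi (y * t) * g (t - x).

Definition tight_frame (I : choiceType) (e : I -> R -> C) (A : R) : Prop :=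
  (forall i, L2 (e i)) /\
  forall f, L2 f ->
    (\esum_(i in [set: I]) (sqmod (ip f (e i)))%:E)%E = (A%:E * l2sq f)%E.

Definition ONB (I : eqType) (e : I -> R -> C) : Prop :=
  (forall i, L2 (e i)) /\
  (forall i j, ip (e i) (e j) = (i == j)%:R) /\
  (forall f, L2 f -> (forall i, ip f (e i) = 0) -> ae_eq f (fun _ => 0)).

Definition gabor (a b d : R) (g : R -> C) : int * int -> R -> C :=
  fun mn => tfs g (mn.1%:~R * a + mn.2%:~R * b) (mn.2%:~R * d).

(* Wilson system W(g, Lambda, L^2(R)) = {psi_{m,n}}_{m in Z, n >= 0}
   for the lattice Lambda with Hermite normal form generator [[a, b], [0, d]] *)
Definition wilson (a b d : R) (g : R -> C) : int * nat -> R -> C :=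
  fun mn =>
    let m : R := mn.1%:~R in
    let n : R := (mn.2)%:R in
    if mn.2 == 0%N then tfs g (2 * m * a) 0
    else
      let ph := expi (- (b * d * n ^+ 2) / 2) in
      if ~~ odd (`|mn.1|%N + mn.2)%N then
        fun t => real_complex R (Num.sqrt 2)^-1 * ph *
                 (tfs g (m * a + n * b) (n * d) t + tfs g (m * a - n * b) (- (n * d)) t)
      else
        fun t => Complex 0 1 * real_complex R (Num.sqrt 2)^-1 * ph *
                 (tfs g (m * a + n * b) (n * d) t - tfs g (m * a - n * b) (- (n * d)) t).

End Wilson.

(* Main.v *)
(** In the frequency domain, after removing the chirp, [g] becomes a real function [ga], the
    Gabor system becomes [e(m a s) ga(s + n d)], and the Wilson elements become normalized sums and
    differences of [e(m a s) ga(s + n d)] and [e(m a s) ga(s - n d)].  Fix [F] bounded with bounded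
    support.  For fixed [n], summing [|<F, .>|^2] over all [m] of a given parity is Parseval's
    identity for Fourier series on [0, d[, applied to [F] times a translate of [ga] folded modulo
    [d], the fold being alternating for odd [m].  Expanding the squares, twice the Wilson sum is
    the Gabor sum plus cross terms, which carry the sign [(-1)^n] and, since [ga] is real, are
    odd under the reflections [n -> l - k - n] with [k + l] odd; so they cancel and the Wilson
    system is a Parseval system.  Testing the tight frame on indicators of cells shows that its
    elements have norm one, and a Parseval system of unit vectors is an orthonormal basis.

    Parseval's identity for Fourier series follows from Chernoff's telescoping argument for
    indicators of intervals, together with Fatou's lemma and a pi-lambda argument; integrating it
    over the translates of the sampling lattice gives Plancherel's theorem for functions of
    bounded support. *)

(* Since [a d = 1/2], the exponential e(m a s) has period [d] in s for even m and changes sign under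
   s -> s + d for odd m; this is why there are two foldings. Cross terms between cells [k] and [l]
   with k + l even are equal in both foldings and enter with opposite signs, so they drop out at
   once. In the others the substitution n -> l - k - n exchanges the two window values, which leaves
   the product unchanged exactly because no conjugation distinguishes them. Bounded test functions
   of bounded support make every folding a finite sum and every cross term absolutely summable.
   Realness of the window comes from (i): two Fourier transforms with a dilation between them amount
   to a reflection and a rescaling, so the transform of [U g] is a rescaled copy of the dechirped
   window. The same chirp turns the sheared lattice into a rectangular one, up to unimodular phases.
   The L^2 Fourier transform enters only through adjunction formulas against functions of bounded
   support, which take the place of an inversion theorem. *)
Require Import Defs.
From HB Require Import structures.
From mathcomp Require Import all_boot all_order all_algebra.
From mathcomp Require Import complex.
From mathcomp Require Import all_classical all_reals all_analysis.
From mathcomp Require Import measurable_realfun ring lra.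
Import Order.TTheory GRing.Theory Num.Theory.
Import numFieldNormedType.Exports.
Set Implicit Arguments.
Unset Strict Implicit.
Unset Printing Implicit Defensive.
Local Open Scope classical_set_scope.
Local Open Scope ring_scope.

(** * Complex numbers *)

Section ComplexFacts.
Variable R : realType.
Local Notation C := (complex R).
Local Notation Re := complex.Re.
Local Notation Im := complex.Im.
Implicit Types x y z : C.

Lemma ReD x y : Re (x + y) = Re x + Re y. Proof. by case: x; case: y. Qed.
Lemma ImD x y : Im (x + y) = Im x + Im y. Proof. by case: x; case: y. Qed.
Lemma ReN x : Re (- x) = - Re x. Proof. by case: x. Qed.
Lemma ImN x : Im (- x) = - Im x. Proof. by case: x. Qed.
Lemma ReM x y : Re (x * y) = Re x * Re y - Im x * Im y.
Proof. by case: x; case: y. Qed.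
Lemma ImM x y : Im (x * y) = Re x * Im y + Im x * Re y.
Proof. by case: x; case: y. Qed.
Lemma ReJ x : Re (conjc x) = Re x. Proof. by case: x. Qed.
Lemma ImJ x : Im (conjc x) = - Im x. Proof. by case: x. Qed.
Lemma ReC (r : R) : Re (real_complex R r) = r. Proof. by []. Qed.
Lemma ImC (r : R) : Im (real_complex R r) = 0. Proof. by []. Qed.

Definition imagi : C := Complex 0 1.
Lemma Re_imagi : Re imagi = 0. Proof. by []. Qed.
Lemma Im_imagi : Im imagi = 1. Proof. by []. Qed.

Definition ReImE := (ReD, ImD, ReN, ImN, ReM, ImM, ReJ, ImJ, ReC, ImC, Re_imagi, Im_imagi).

Lemma complexP x y : Re x = Re y -> Im x = Im y -> x = y.
Proof. by case: x => a b; case: y => c d /= -> ->. Qed.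

Lemma conjcD x y : conjc (x + y) = conjc x + conjc y. Proof. exact: rmorphD. Qed.
Lemma conjcM x y : conjc (x * y) = conjc x * conjc y. Proof. exact: rmorphM. Qed.
Lemma conjcN x : conjc (- x) = - conjc x. Proof. exact: rmorphN. Qed.
Lemma conjcC (r : R) : conjc (real_complex R r) = real_complex R r.
Proof. by apply: complexP; rewrite !ReImE ?oppr0. Qed.
Lemma conjc_sum (I : Type) (s : seq I) (F : I -> C) :
  conjc (\sum_(i <- s) F i) = \sum_(i <- s) conjc (F i).
Proof. exact: rmorph_sum. Qed.

Lemma sqmodM x y : sqmod (x * y) = sqmod x * sqmod y.
Proof. by rewrite /sqmod !ReImE; ring. Qed.
Lemma sqmodJ x : sqmod (conjc x) = sqmod x.
Proof. by rewrite /sqmod !ReImE; ring. Qed.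
Lemma sqmodC (r : R) : sqmod (real_complex R r) = r ^+ 2.
Proof. by rewrite /sqmod !ReImE; ring. Qed.
Lemma sqmodN x : sqmod (- x) = sqmod x.
Proof. by rewrite /sqmod !ReImE; ring. Qed.
Lemma sqmod_ge0 x : 0 <= sqmod x.
Proof. by rewrite addr_ge0// sqr_ge0. Qed.
Lemma sqmod0 : sqmod (0 : C) = 0.
Proof. by rewrite /sqmod/=; ring. Qed.
Lemma sqmod_eq0 x : sqmod x = 0 -> x = 0.
Proof.
move/eqP; rewrite /sqmod paddr_eq0 ?sqr_ge0// !sqrf_eq0 => /andP[/eqP h1 /eqP h2].
exact: complexP.
Qed.
Lemma sqmod_mulJ x : x * conjc x = real_complex R (sqmod x).
Proof. by apply: complexP; rewrite /sqmod !ReImE; ring. Qed.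
Lemma sqmodD_le2 x y : sqmod (x + y) <= 2 * sqmod x + 2 * sqmod y.
Proof.
rewrite /sqmod !ReImE.
have := sqr_ge0 (Re x - Re y); have := sqr_ge0 (Im x - Im y); nra.
Qed.
Lemma sqmodB_le2 x y : sqmod (x - y) <= 2 * sqmod x + 2 * sqmod y.
Proof. by rewrite -(sqmodN y); exact: sqmodD_le2. Qed.
(** Young's inequality with a weight. The factor of the first term can be brought arbitrarily close
    to 1, so that density arguments do not lose the constant in Parseval's identity. *)
Lemma sqmodD_le_eps (e : R) x y : 0 < e ->
  sqmod (x + y) <= (1 + e) * sqmod x + (1 + e^-1) * sqmod y.
Proof.
move=> e0; set k := e^-1; have k0 : 0 < k by rewrite invr_gt0.
have ek : e * k = 1 by rewrite mulfV// gt_eqF.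
have H (p q : R) : 2 * (p * q) <= e * p ^+ 2 + k * q ^+ 2.
  have : 0 <= k * (e * p - q) ^+ 2 by rewrite mulr_ge0 ?sqr_ge0// ltW.
  have -> : k * (e * p - q) ^+ 2
    = (e * k) * e * p ^+ 2 - 2 * (e * k) * (p * q) + k * q ^+ 2 by ring.
  by rewrite ek; lra.
rewrite /sqmod !ReImE.
have := H (Re x) (Re y); have := H (Im x) (Im y); lra.
Qed.
Lemma Re_le_sqmod x : Re x ^+ 2 <= sqmod x.
Proof. by rewrite /sqmod lerDl sqr_ge0. Qed.
Lemma Im_le_sqmod x : Im x ^+ 2 <= sqmod x.
Proof. by rewrite /sqmod lerDr sqr_ge0. Qed.

Lemma expi0 : expi (0 : R) = 1.
Proof. by rewrite /expi mulr0 cos0 sin0. Qed.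
Lemma expiD (s t : R) : expi (s + t) = expi s * expi t.
Proof.
by apply: complexP; rewrite !ReImE /expi/= mulrDr ?cosD ?sinD; ring.
Qed.
Lemma expiJ (s : R) : conjc (expi s) = expi (- s).
Proof. by rewrite /expi mulrN cosN sinN. Qed.
Lemma sqmod_expi (s : R) : sqmod (expi s) = 1.
Proof. by rewrite /sqmod/= cos2Dsin2. Qed.
Lemma expiNK (s : R) : expi (- s) * expi s = 1.
Proof. by rewrite -expiD addNr expi0. Qed.
Lemma expiKN (s : R) : expi s * expi (- s) = 1.
Proof. by rewrite -expiD subrr expi0. Qed.
Lemma expi_half : expi (2^-1 : R) = - 1.
Proof.
by rewrite /expi mulrAC divff ?pnatr_eq0// mul1r cospi sinpi; apply: complexP; rewrite !ReImE//= oppr0.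
Qed.
Lemma expi1 : expi (1 : R) = 1.
Proof.
have -> : (1 : R) = 2^-1 + 2^-1 by field.
by rewrite expiD expi_half mulrNN mulr1.
Qed.
Lemma expi_nat (n : nat) : expi (n%:R : R) = 1.
Proof.
elim: n => [|n IH]; first exact: expi0.
by rewrite -addn1 natrD expiD IH expi1 mulr1.
Qed.
Lemma expi_int (m : int) : expi (m%:~R : R) = 1.
Proof.
case: m => n; first exact: expi_nat.
by rewrite NegzE intrN -expiJ expi_nat; apply: complexP; rewrite !ReImE//= oppr0.
Qed.
Lemma expi_half_int (m : int) : expi (m%:~R / 2 : R) = (-1) ^+ `|m|%N.
Proof.
have H (n : nat) : expi (n%:R / 2 : R) = (-1) ^+ n.
  elim: n => [|n IH]; first by rewrite mul0r expi0.
  by rewrite -addn1 natrD mulrDl expiD IH div1r expi_half exprD expr1.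
case: m => n; first exact: H.
rewrite NegzE intrN mulNr -expiJ H abszN absz_nat.
elim: (n.+1) => [|k IH]; first by apply: complexP; rewrite !ReImE//= oppr0.
by rewrite !exprS rmorphM/= IH; congr (_ * _); apply: complexP; rewrite !ReImE//= ?oppr0.
Qed.

End ComplexFacts.
Arguments imagi {R}.

Arguments cint : simpl never.
Arguments ip : simpl never.
Arguments sqmod : simpl never.
Arguments expi : simpl never.

(** * Square-integrable functions *)

Section L2Facts.
Variable R : realType.
Local Notation C := (complex R).
Local Notation Re := complex.Re.
Local Notation Im := complex.Im.
Local Notation mu := (@lebesgue_measure R).
Implicit Types f g h k : R -> C.

Definition cmeasurable f :=
  measurable_fun setT (fun x => Re (f x)) /\ measurable_fun setT (fun x => Im (f x)).

Definition cintegrable f :=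
  mu.-integrable setT (fun x => (Re (f x))%:E) /\
  mu.-integrable setT (fun x => (Im (f x))%:E).

Lemma le_integrableR (u v : R -> R) : measurable_fun setT u ->
  (forall x, `|u x| <= v x) -> mu.-integrable setT (EFin \o v) ->
  mu.-integrable setT (EFin \o u).
Proof.
move=> mu_ uv iv; apply: le_integrable iv => //; first exact/measurable_EFinP.
by move=> x _ /=; rewrite lee_fin (le_trans (uv x))// ler_norm.
Qed.

Lemma cmeasurableD f g : cmeasurable f -> cmeasurable g ->
  cmeasurable (fun x => f x + g x).
Proof.
move=> [f1 f2] [g1 g2]; split.
- by under eq_fun do rewrite ReD; exact: measurable_funD.
- by under eq_fun do rewrite ImD; exact: measurable_funD.
Qed.

Lemma cmeasurableM f g : cmeasurable f -> cmeasurable g ->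
  cmeasurable (fun x => f x * g x).
Proof.
move=> [f1 f2] [g1 g2]; split.
- by under eq_fun do rewrite ReM; apply: measurable_funB; exact: measurable_funM.
- by under eq_fun do rewrite ImM; apply: measurable_funD; exact: measurable_funM.
Qed.

Lemma cmeasurable_cst (c : C) : cmeasurable (fun _ => c).
Proof. by split; exact: measurable_cst. Qed.

Lemma cmeasurableN f : cmeasurable f -> cmeasurable (fun x => - f x).
Proof.
move=> [f1 f2]; split.
- by under eq_fun do rewrite ReN; exact: measurable_funN.
- by under eq_fun do rewrite ImN; exact: measurable_funN.
Qed.

Lemma cmeasurableJ f : cmeasurable f -> cmeasurable (fun x => conjc (f x)).
Proof.
move=> [f1 f2]; split.
- by under eq_fun do rewrite ReJ.
- by under eq_fun do rewrite ImJ; exact: measurable_funN.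
Qed.

Lemma cmeasurable_real (u : R -> R) : measurable_fun setT u ->
  cmeasurable (fun x => real_complex R (u x)).
Proof. by move=> mu_; split => //=; exact: measurable_cst. Qed.

Lemma cmeasurable_comp f (u : R -> R) : cmeasurable f -> measurable_fun setT u ->
  cmeasurable (fun x => f (u x)).
Proof.
move=> [f1 f2] m; split.
- exact: (measurableT_comp f1 m).
- exact: (measurableT_comp f2 m).
Qed.

Lemma cmeasurable_expi (u : R -> R) : measurable_fun setT u ->
  cmeasurable (fun x => expi (u x)).
Proof.
move=> m; apply: (@cmeasurable_comp (@expi R) u) => //.
split; rewrite /expi/=.
- apply: continuous_measurable_fun => x.
  apply: (@continuous_comp _ _ _ (fun y => 2 * pi * y) cos); last exact: continuous_cos.
  exact: mulrl_continuous.
- apply: continuous_measurable_fun => x.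
  apply: (@continuous_comp _ _ _ (fun y => 2 * pi * y) sin); last exact: continuous_sin.
  exact: mulrl_continuous.
Qed.

Lemma measurable_sqmod f : cmeasurable f -> measurable_fun setT (fun x => sqmod (f x)).
Proof. by move=> [f1 f2]; apply: measurable_funD; exact: measurable_funX. Qed.

Lemma L2P f : L2 f <-> cmeasurable f /\ mu.-integrable setT (fun x => (sqmod (f x))%:E).
Proof.
split.
- move=> [f1 [f2 f3]]; split => //; apply/integrableP; split.
    by apply/measurable_EFinP; exact: measurable_sqmod.
  by under eq_integral do rewrite gee0_abs ?lee_fin ?sqmod_ge0//.
- move=> [[f1 f2] /integrableP[_ f3]]; split => //; split => //.
  by move: f3; under eq_integral do rewrite gee0_abs ?lee_fin ?sqmod_ge0//.
Qed.

Lemma L2_measurable f : L2 f -> cmeasurable f. Proof. by case/L2P. Qed.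
Lemma L2_integrable f : L2 f -> mu.-integrable setT (fun x => (sqmod (f x))%:E).
Proof. by case/L2P. Qed.

Lemma L2_le f (v : R -> R) : cmeasurable f -> (forall x, sqmod (f x) <= v x) ->
  mu.-integrable setT (EFin \o v) -> L2 f.
Proof.
move=> mf fv iv; apply/L2P; split => //.
apply: (le_integrableR (measurable_sqmod mf) _ iv) => x.
by rewrite ger0_norm ?sqmod_ge0.
Qed.

Lemma integrableRD (u v : R -> R) : mu.-integrable setT (EFin \o u) ->
  mu.-integrable setT (EFin \o v) -> mu.-integrable setT (EFin \o (fun x => u x + v x)).
Proof. by move=> iu iv; exact: (integrableD measurableT iu iv). Qed.

Lemma integrableRZ (c : R) (u : R -> R) : mu.-integrable setT (EFin \o u) ->
  mu.-integrable setT (EFin \o (fun x => c * u x)).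
Proof. by move=> iu; exact: (integrableZl measurableT c iu). Qed.

Lemma L2D f g : L2 f -> L2 g -> L2 (fun x => f x + g x).
Proof.
move=> Lf Lg.
apply: (@L2_le _ (fun x => 2 * sqmod (f x) + 2 * sqmod (g x))).
- by apply: cmeasurableD; exact: L2_measurable.
- by move=> x; exact: sqmodD_le2.
- by apply: integrableRD; apply: integrableRZ; exact: L2_integrable.
Qed.

Lemma L2_bdd_mul f k (M : R) : cmeasurable k -> (forall x, sqmod (k x) <= M) ->
  L2 f -> L2 (fun x => k x * f x).
Proof.
move=> mk kM Lf.
apply: (@L2_le _ (fun x => M * sqmod (f x))).
- by apply: cmeasurableM => //; exact: L2_measurable.
- by move=> x; rewrite sqmodM ler_wpM2r// sqmod_ge0.
- by apply: integrableRZ; exact: L2_integrable.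
Qed.

Lemma L2Z (c : C) f : L2 f -> L2 (fun x => c * f x).
Proof. by apply: (@L2_bdd_mul _ _ (sqmod c)) => //; exact: cmeasurable_cst. Qed.

Lemma L2N f : L2 f -> L2 (fun x => - f x).
Proof.
move=> /(L2Z (-1)); congr L2; apply/funext => x; by rewrite mulN1r.
Qed.

Lemma L2B f g : L2 f -> L2 g -> L2 (fun x => f x - g x).
Proof. by move=> Lf Lg; apply: L2D => //; exact: L2N. Qed.

Lemma L2_0 : L2 (fun _ => 0 : C).
Proof.
apply: (@L2_le _ (fun _ => 0)); [exact: cmeasurable_cst| by move=> x; rewrite sqmod0|].
exact: integrable0.
Qed.

Lemma L2_sum (I : Type) (s : seq I) (F : I -> R -> C) : (forall i, L2 (F i)) ->
  L2 (fun x => \sum_(i <- s) F i x).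
Proof.
move=> LF; elim: s => [|i s IH].
  by under eq_fun do rewrite big_nil; exact: L2_0.
by under eq_fun do rewrite big_cons; exact: L2D.
Qed.

Lemma cintegrable_ip f g : L2 f -> L2 g -> cintegrable (fun x => f x * conjc (g x)).
Proof.
move=> Lf Lg.
have [m1 m2] : cmeasurable (fun x => f x * conjc (g x)).
  by apply: cmeasurableM; [|apply: cmeasurableJ]; exact: L2_measurable.
have iD := integrableRD (L2_integrable Lf) (L2_integrable Lg).
split; (apply: le_integrableR iD => //) => x; rewrite !ReImE /sqmod ler_norml.
- have := sqr_ge0 (Re (f x) - Re (g x)); have := sqr_ge0 (Re (f x) + Re (g x)).
  by have := sqr_ge0 (Im (f x) - Im (g x)); have := sqr_ge0 (Im (f x) + Im (g x)); nra.
- have := sqr_ge0 (Re (f x) - Im (g x)); have := sqr_ge0 (Re (f x) + Im (g x)).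
  by have := sqr_ge0 (Im (f x) - Re (g x)); have := sqr_ge0 (Im (f x) + Re (g x)); nra.
Qed.

Lemma Re_cint D f : Re (cint D f) = Rintegral mu D (fun x => Re (f x)).
Proof. by []. Qed.

Lemma Im_cint D f : Im (cint D f) = Rintegral mu D (fun x => Im (f x)).
Proof. by []. Qed.

Lemma eq_cint f g : (forall x, f x = g x) -> cint setT f = cint setT g.
Proof. by move=> fg; congr cint; apply/funext. Qed.

Lemma cintegrableD f g : cintegrable f -> cintegrable g -> cintegrable (fun x => f x + g x).
Proof.
move=> [f1 f2] [g1 g2]; split.
- by under eq_fun do rewrite ReD; exact: integrableRD.
- by under eq_fun do rewrite ImD; exact: integrableRD.
Qed.

Lemma cintegrableZ (c : C) f : cintegrable f -> cintegrable (fun x => c * f x).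
Proof.
move=> [f1 f2]; split.
- under eq_fun do rewrite ReM -mulNr.
  by apply: (@integrableRD (fun x => Re c * Re (f x)) (fun x => - Im c * Im (f x)));
    exact: integrableRZ.
- under eq_fun do rewrite ImM.
  by apply: (@integrableRD (fun x => Re c * Im (f x)) (fun x => Im c * Re (f x)));
    exact: integrableRZ.
Qed.

Lemma cintD f g : cintegrable f -> cintegrable g ->
  cint setT (fun x => f x + g x) = cint setT f + cint setT g.
Proof.
move=> [f1 f2] [g1 g2]; apply: complexP; rewrite ?(ReD, ReM, ImD, ImM, ReJ, ImJ) !(Re_cint, Im_cint).
- by under eq_Rintegral do rewrite ReD; rewrite RintegralD.
- by under eq_Rintegral do rewrite ImD; rewrite RintegralD.
Qed.

Lemma cintZ (c : C) f : cintegrable f -> cint setT (fun x => c * f x) = c * cint setT f.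
Proof.
move=> [f1 f2]; apply: complexP; rewrite ?(ReD, ReM, ImD, ImM, ReJ, ImJ) !(Re_cint, Im_cint).
- under eq_Rintegral do rewrite ReM.
  by rewrite RintegralB ?RintegralZl//; exact: integrableRZ.
- under eq_Rintegral do rewrite ImM.
  by rewrite RintegralD ?RintegralZl//; exact: integrableRZ.
Qed.

Lemma cintJ f : cintegrable f -> cint setT (fun x => conjc (f x)) = conjc (cint setT f).
Proof.
move=> [f1 f2]; apply: complexP; rewrite ?(ReD, ReM, ImD, ImM, ReJ, ImJ) !(Re_cint, Im_cint).
- by apply: eq_Rintegral => x _; rewrite ReJ.
- under eq_Rintegral do rewrite ImJ -mulN1r.
  by rewrite RintegralZl// mulN1r.
Qed.

Lemma ipDl f g h : L2 f -> L2 g -> L2 h -> ip (fun x => f x + g x) h = ip f h + ip g h.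
Proof.
move=> Lf Lg Lh; rewrite /ip -cintD; try exact: cintegrable_ip.
by apply: eq_cint => x; rewrite mulrDl.
Qed.

Lemma ipZl (c : C) f g : L2 f -> L2 g -> ip (fun x => c * f x) g = c * ip f g.
Proof.
move=> Lf Lg; rewrite /ip -cintZ; last exact: cintegrable_ip.
by apply: eq_cint => x; rewrite mulrA.
Qed.

Lemma ipC f g : L2 f -> L2 g -> ip f g = conjc (ip g f).
Proof.
move=> Lf Lg; rewrite /ip -cintJ; last exact: cintegrable_ip.
by apply: eq_cint => x; rewrite conjcM conjcK mulrC.
Qed.

Lemma ipDr f g h : L2 f -> L2 g -> L2 h -> ip h (fun x => f x + g x) = ip h f + ip h g.
Proof.
move=> Lf Lg Lh; rewrite ipC//; last exact: L2D.
by rewrite ipDl// conjcD -!ipC.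
Qed.

Lemma ipZr (c : C) f g : L2 f -> L2 g -> ip f (fun x => c * g x) = conjc c * ip f g.
Proof.
move=> Lf Lg; rewrite ipC//; last exact: L2Z.
by rewrite ipZl// conjcM -ipC.
Qed.

Lemma ipNl f g : L2 f -> L2 g -> ip (fun x => - f x) g = - ip f g.
Proof. by move=> Lf Lg; rewrite -mulN1r -ipZl//; congr ip; apply/funext => x; rewrite mulN1r. Qed.

Lemma ipBl f g h : L2 f -> L2 g -> L2 h -> ip (fun x => f x - g x) h = ip f h - ip g h.
Proof. by move=> Lf Lg Lh; rewrite ipDl ?ipNl//; exact: L2N. Qed.

Lemma ipNr f g : L2 f -> L2 g -> ip f (fun x => - g x) = - ip f g.
Proof. by move=> Lf Lg; rewrite ipC ?ipNl ?conjcN -?ipC//; exact: L2N. Qed.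

Lemma ipBr f g h : L2 f -> L2 g -> L2 h -> ip h (fun x => f x - g x) = ip h f - ip h g.
Proof. by move=> Lf Lg Lh; rewrite ipDr ?ipNr//; exact: L2N. Qed.

Lemma ip0l f : ip (fun _ => 0) f = 0.
Proof.
rewrite /ip; apply: complexP; rewrite ?Re_cint ?Im_cint;
  by under eq_Rintegral do rewrite mul0r; rewrite /Rintegral integral0.
Qed.

Lemma ip_suml (I : Type) (s : seq I) (F : I -> R -> C) g : (forall i, L2 (F i)) -> L2 g ->
  ip (fun x => \sum_(i <- s) F i x) g = \sum_(i <- s) ip (F i) g.
Proof.
move=> LF Lg; elim: s => [|i s IH].
  by under eq_fun do rewrite big_nil; rewrite big_nil ip0l.
under eq_fun do rewrite big_cons.
by rewrite big_cons ipDl ?IH//; exact: L2_sum.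
Qed.

Lemma ip_sumr (I : Type) (s : seq I) (F : I -> R -> C) g : (forall i, L2 (F i)) -> L2 g ->
  ip g (fun x => \sum_(i <- s) F i x) = \sum_(i <- s) ip g (F i).
Proof.
move=> LF Lg; rewrite ipC//; last exact: L2_sum.
by rewrite ip_suml// conjc_sum; apply: eq_bigr => i _; rewrite -ipC.
Qed.

(** This is the square of the L^2 norm, taken as a real number. An infinite integral would be read
    as 0, so most of its properties ask for [L2]. *)
Definition nrm f : R := Rintegral mu setT (fun x => sqmod (f x)).

Lemma nrm_ge0 f : 0 <= nrm f.
Proof. by apply: Rintegral_ge0 => x _; exact: sqmod_ge0. Qed.

Lemma l2sqE f : L2 f -> l2sq f = (nrm f)%:E.
Proof.
move=> Lf; rewrite /nrm /Rintegral fineK//.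
by apply: integrable_fin_num => //; exact: L2_integrable.
Qed.

Lemma ipff f : ip f f = real_complex R (nrm f).
Proof.
rewrite /ip; apply: complexP; rewrite ?Re_cint ?Im_cint.
- by rewrite ReC; apply: eq_Rintegral => x _; rewrite sqmod_mulJ.
- by under eq_Rintegral do rewrite sqmod_mulJ ImC; rewrite /Rintegral integral0.
Qed.

Lemma nrmE f : nrm f = Re (ip f f). Proof. by rewrite ipff. Qed.

Lemma nrmD f g : L2 f -> L2 g -> nrm (fun x => f x + g x) = nrm f + nrm g + 2 * Re (ip f g).
Proof.
move=> Lf Lg; rewrite !nrmE ipDl//; last exact: L2D.
by rewrite !ipDr// (ipC Lg Lf) !ReImE; ring.
Qed.

Lemma nrmZ (c : C) f : L2 f -> nrm (fun x => c * f x) = sqmod c * nrm f.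
Proof.
move=> Lf; rewrite !nrmE ipZl//; last exact: L2Z.
by rewrite ipZr// mulrA sqmod_mulJ ReM /=; ring.
Qed.

Lemma nrmN f : nrm (fun x => - f x) = nrm f.
Proof. by apply: eq_Rintegral => x _; rewrite sqmodN. Qed.

Lemma nrmB f g : L2 f -> L2 g -> nrm (fun x => f x - g x) = nrm f + nrm g - 2 * Re (ip f g).
Proof.
by move=> Lf Lg; rewrite nrmD ?nrmN ?ipNr// ?ReN; [ring|exact: L2N].
Qed.

Lemma le_nrm f g : L2 f -> L2 g -> (forall x, sqmod (f x) <= sqmod (g x)) -> nrm f <= nrm g.
Proof. by move=> Lf Lg fg; apply: le_Rintegral => //; exact: L2_integrable. Qed.

Lemma nrmD_le2 f g : L2 f -> L2 g -> nrm (fun x => f x + g x) <= 2 * nrm f + 2 * nrm g.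
Proof.
move=> Lf Lg; rewrite nrmD//.
by have := nrm_ge0 (fun x => f x - g x); rewrite nrmB//; lra.
Qed.

Lemma cauchy_schwarz f g : L2 f -> L2 g -> sqmod (ip f g) <= nrm f * nrm g.
Proof.
move=> Lf Lg; set z := ip f g.
(* Expansion of the squared norm of f - t z g, with [t] real and z = <f, g>. *)
have H (t : R) : 0 <= nrm f - 2 * t * sqmod z + t ^+ 2 * sqmod z * nrm g.
  have L : L2 (fun x => (real_complex R t * z) * g x) by exact: L2Z.
  have := nrm_ge0 (fun x => f x - (real_complex R t * z) * g x).
  rewrite nrmB// nrmZ// ipZr// -/z sqmodM sqmodC conjcM -[conjc _ * _ * z]mulrA (mulrC (conjc z)).
  by rewrite sqmod_mulJ !ReImE /=; lra.
have z0 := sqmod_ge0 z; have f0 := nrm_ge0 f; have g0 := nrm_ge0 g.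
have [g00|gn0] := eqVneq (nrm g) 0.
  rewrite g00 mulr0; have [->//|zn0] := eqVneq (sqmod z) 0.
  (* If [nrm g = 0] the bound is affine in t, and at this t it equals - nrm f - 2, which is
     negative. *)
  have := H ((nrm f + 1) / sqmod z); rewrite g00 mulr0 addr0 -mulrA divfK//; lra.
have gp : 0 < nrm g by rewrite lt_neqAle eq_sym gn0.
have := H (nrm g)^-1.
have -> : (nrm g)^-1 ^+ 2 * sqmod z * nrm g = (nrm g)^-1 * sqmod z by field.
by move=> H'; rewrite -ler_pdivrMr// mulrC; lra.
Qed.

End L2Facts.

(** * Affine changes of variable *)

Section Affine.
Variable R : realType.
Local Notation C := (complex R).
Local Notation mu := (@lebesgue_measure R).

Lemma measurable_affine (c t : R) : measurable_fun setT (fun x : R => c * x + t).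
Proof. by apply: measurable_funD => //; exact: measurable_funM. Qed.

Section affine_measure.
Variables (c t : R).
Hypothesis c0 : c != 0.
Let T := (fun x : R => c * x + t) : measurableTypeR R -> measurableTypeR R.
Let mT : measurable_fun setT T := measurable_affine c t.

Let pT : {measure set (measurableTypeR R) -> \bar R} :=
  measure_function_pushforward__canonical__measure_function_Measure mu mT.

Let nu : {measure set (measurableTypeR R) -> \bar R} := mscale (NngNum (normr_ge0 c)) pT.

(** By uniqueness of Lebesgue measure only half-open intervals need checking; their preimages are
    intervals whose length is divided by |c|. For negative c the preimage is closed on the left,
    which does not change its length. *)
Lemma lebesgue_measure_affine (A : set (measurableTypeR R)) : measurable A ->
  mu A = nu A.
Proof.
apply: lebesgue_measure_unique => X [[a b] _ <-] /=.
rewrite /nu /mscale /= /pT /= /pushforward.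
have [cp|cn] : 0 < c \/ c < 0 by have := c0; rewrite neq_lt orbC => /orP.
- have -> : T @^-1` `]a, b] = `](a - t) / c, (b - t) / c]%classic.
    apply/seteqP; split => x; rewrite /= /T !in_itv/= ltr_pdivrMr// ler_pdivlMr//;
      by move=> /andP[h1 h2]; apply/andP; split; lra.
  rewrite !lebesgue_measure_itv/= !lte_fin ltr_pM2r ?invr_gt0// ltrD2r.
  case: ifPn => _; last by rewrite mule0.
  by rewrite -!EFinD -EFinM (gtr0_norm cp); congr EFin; field.
- have -> : T @^-1` `]a, b] = `[(b - t) / c, (a - t) / c[%classic.
    apply/seteqP; split => x; rewrite /= /T !in_itv/= ltr_ndivlMr// ler_ndivrMr//;
      by move=> /andP[h1 h2]; apply/andP; split; lra.
  rewrite !lebesgue_measure_itv/= !lte_fin ltr_nM2r ?invr_lt0// ltrD2r.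
  case: ifPn => _; last by rewrite mule0.
  by rewrite -!EFinD -EFinM (ltr0_norm cn); congr EFin; field.
Qed.

Lemma ge0_integral_affine (phi : R -> \bar R) : measurable_fun setT phi ->
  (forall x, (0 <= phi x)%E) ->
  (\int[mu]_x phi x = (`|c|)%:E * \int[mu]_x phi (c * x + t)%R)%E.
Proof.
move=> mphi phi0.
rewrite (eq_measure_integral nu); last by move=> A mA _; exact: lebesgue_measure_affine.
rewrite ge0_integral_mscale//=; congr (_ * _)%E.
by rewrite /pT ge0_integral_pushforward.
Qed.

Lemma integrable_affine (u : R -> R) : mu.-integrable setT (EFin \o u) ->
  mu.-integrable setT (EFin \o (fun x => u (c * x + t))).
Proof.
move=> /integrableP[/measurable_EFinP m fi]; apply/integrableP; split.
  by apply/measurable_EFinP; exact: (measurableT_comp m (measurable_affine c t)).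
move: fi; rewrite (@ge0_integral_affine (fun x => `|(u x)%:E|%E))//; last first.
  by apply: measurableT_comp => //; exact/measurable_EFinP.
rewrite /=; set I := integral _ _ _.
have I0 : (0 <= I)%E by exact: integral_ge0.
have cp : (0 < `|c|%:E)%E by rewrite lte_fin normr_gt0.
by move: I I0 => [r| |]// _; rewrite ?ltry// gt0_muley.
Qed.

Lemma Rintegral_affine (u : R -> R) : mu.-integrable setT (EFin \o u) ->
  Rintegral mu setT (fun x => u (c * x + t)) = `|c|^-1 * Rintegral mu setT u.
Proof.
move=> iu; have iT := integrable_affine iu.
have cn0 : `|c| != 0 by rewrite normr_eq0.
have mu_ : measurable_fun setT (EFin \o u) by case/integrableP: iu.
have f1 := integrable_pos_fin_num measurableT iT.
have f2 := integrable_neg_fin_num measurableT iT.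
rewrite (_ : EFin \o _ = (EFin \o u) \o (fun x => c * x + t))// funepos_comp in f1.
rewrite (_ : EFin \o _ = (EFin \o u) \o (fun x => c * x + t))// funeneg_comp in f2.
rewrite /Rintegral.
have -> : (\int[mu]_x (u (c * x + t))%:E
  = \int[mu]_x ((EFin \o u) \o (fun x => (c * x + t)%R)) x)%E by [].
rewrite [in LHS]integralE [in RHS]integralE funepos_comp funeneg_comp.
rewrite (@ge0_integral_affine ((EFin \o u)^\+)%E)//; last exact: measurable_funepos.
rewrite (@ge0_integral_affine ((EFin \o u)^\-)%E)//; last exact: measurable_funeneg.
rewrite /comp in f1 f2 *.
rewrite -(fineK f1) -(fineK f2) -!EFinM -!EFinB /=.
by rewrite -mulrBr mulKf.
Qed.

Lemma cintegrable_affine f : cintegrable f -> cintegrable (fun x : R => f (c * x + t)).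
Proof.
move=> [f1 f2]; split.
- exact: (@integrable_affine (fun x => complex.Re (f x))).
- exact: (@integrable_affine (fun x => complex.Im (f x))).
Qed.

Lemma cint_affine f : cintegrable f ->
  cint setT (fun x : R => f (c * x + t)) = real_complex R `|c|^-1 * cint setT f.
Proof.
move=> [f1 f2]; apply: complexP; rewrite ?(ReM, ImM) !(Re_cint, Im_cint) ReC ImC.
- by rewrite (@Rintegral_affine (fun x => complex.Re (f x)))//; ring.
- by rewrite (@Rintegral_affine (fun x => complex.Im (f x)))//; ring.
Qed.

Lemma L2_affine f : L2 f -> L2 (fun x : R => f (c * x + t)).
Proof.
move=> /L2P[m i]; apply/L2P; split.
  exact: (cmeasurable_comp m (measurable_affine c t)).
exact: (@integrable_affine (fun x => sqmod (f x))).
Qed.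

Lemma ip_affine f g : L2 f -> L2 g ->
  ip (fun x : R => f (c * x + t)) (fun x => g (c * x + t)) = real_complex R `|c|^-1 * ip f g.
Proof.
by move=> Lf Lg; rewrite /ip -(@cint_affine (fun x => f x * conjc (g x)))//; exact: cintegrable_ip.
Qed.

End affine_measure.

Lemma ge0_integral_shift (t : R) (phi : R -> \bar R) : measurable_fun setT phi ->
  (forall x, (0 <= phi x)%E) -> (\int[mu]_x phi (x + t)%R = \int[mu]_x phi x)%E.
Proof.
move=> m0 p0; rewrite [RHS](ge0_integral_affine t (oner_neq0 R))// normr1 mul1e.
by apply: eq_integral => x _; rewrite mul1r.
Qed.

Lemma cint_shift (t : R) f : cintegrable f ->
  cint setT (fun x : R => f (x + t)) = cint setT f.
Proof.
move=> i; have := cint_affine t (oner_neq0 R) i.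
rewrite normr1 invr1 mul1r => <-.
by apply: eq_cint => x; rewrite mul1r.
Qed.

Lemma L2_shift (t : R) f : L2 f -> L2 (fun x : R => f (x + t)).
Proof.
move=> /(@L2_affine 1 t (oner_neq0 _)); congr L2.
by apply/funext => x; rewrite mul1r.
Qed.

Lemma ip_shift (t : R) f g : L2 f -> L2 g ->
  ip (fun x : R => f (x + t)) (fun x => g (x + t)) = ip f g.
Proof.
by move=> Lf Lg; rewrite /ip -(@cint_shift t (fun x => f x * conjc (g x)))//; exact: cintegrable_ip.
Qed.

Lemma nrm_shift (t : R) f : L2 f -> nrm (fun x : R => f (x + t)) = nrm f.
Proof. by move=> Lf; rewrite !nrmE ip_shift. Qed.

End Affine.

(** * Sums over countable types *)

Section Esum.
Variable R : realType.

Lemma esum_pair (T1 T2 : choiceType) (a : T1 * T2 -> \bar R) : (forall k, (0 <= a k)%E) ->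
  (\esum_(k in [set: T1 * T2]) a k =
   \esum_(i in [set: T1]) \esum_(j in [set: T2]) a (i, j))%E.
Proof.
move=> a0; rewrite esum_esum//; apply: congr2.
  by apply/seteqP; split.
by apply/funext => -[].
Qed.

Lemma esum_exchange (T1 T2 : choiceType) (a : T1 -> T2 -> \bar R) :
  (forall i j, (0 <= a i j)%E) ->
  (\esum_(i in [set: T1]) \esum_(j in [set: T2]) a i j =
   \esum_(j in [set: T2]) \esum_(i in [set: T1]) a i j)%E.
Proof.
move=> a0; rewrite -(@esum_pair _ _ (fun k => a k.1 k.2))//.
rewrite -(@esum_pair _ _ (fun k => a k.2 k.1))//.
rewrite (@reindex_esum _ _ _ setT setT (fun k : T2 * T1 => (k.2, k.1)))//.
split => //; first by move=> [i j] [k l] _ _ [-> ->].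
by move=> [i j] _; exists (j, i).
Qed.

Lemma reindex_esumT (T T' : choiceType) (e : T -> T') (a : T' -> \bar R) : bijective e ->
  (\esum_(j in [set: T']) a j = \esum_(i in [set: T]) a (e i))%E.
Proof.
move=> be; apply: reindex_esum; split => //.
  by move=> i j _ _; exact: bij_inj.
by case: be => g eg ge j _; exists (g j).
Qed.

Lemma esum_int_parity (a : int -> \bar R) : (forall m, (0 <= a m)%E) ->
  (\esum_(m in [set: int]) a m =
   \esum_(j in [set: int]) a (2 * j)%R + \esum_(j in [set: int]) a (2 * j + 1)%R)%E.
Proof.
move=> a0; rewrite (esumID [set m : int | (2 %| m)%Z])// !setTI; congr (_ + _)%E.
- apply: reindex_esum; split.
  + by move=> j _ /=; rewrite dvdz_mulr.
  + by move=> i j _ _ /(mulfI _); apply.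
  + by move=> m /= /dvdzP[q ->]; exists q => //; rewrite mulrC.
- apply: reindex_esum; split.
  + by move=> j _ /=; rewrite rpredDl ?dvdz_mulr.
  + by move=> i j _ _ /addIr/(mulfI _); apply.
  + move=> m /= hm; exists (m %/ 2)%Z => //.
    rewrite [RHS](divz_eq m 2) mulrC; congr (_ + _).
    have := modz_ge0 m (isT : (2 : int) != 0); have := ltz_pmod m (isT : (0 : int) < 2).
    have {hm} : (m %% 2)%Z <> 0 by move=> h; apply: hm; exact/dvdz_mod0P.
    by case: (m %% 2)%Z => [[|[|]]|].
Qed.

Lemma esum_int_nat (a : int -> \bar R) : (forall m, (0 <= a m)%E) ->
  (\esum_(m in [set: int]) a m =
   a (Posz 0) + \esum_(n in [set: nat]) (a (Posz n.+1) + a (- Posz n.+1)%R))%E.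
Proof.
move=> a0; rewrite (esumID [set m : int | m = 0])// setTI; congr (_ + _)%E.
  by rewrite (_ : [set m | m = 0] = [set 0]) ?esum_set1//; apply/seteqP; split.
rewrite (esumID [set m : int | 0 < m])// esumD//.
congr (_ + _)%E.
- apply: reindex_esum; split.
  + by move=> n _; split => /=.
  + by move=> i j _ _ [].
  + by move=> [[|n]|n] [//= [_ h1] h2]; exists n.
- apply: reindex_esum; split.
  + by move=> n _; split => /=.
  + by move=> i j _ _ /oppr_inj[].
  + by move=> [[|n]|n] [/= [_ h1] h2]; [case: h1|case: h2|exists n].
Qed.

Lemma esumZ (T : choiceType) (c : R) (a : T -> \bar R) : 0 < c -> (forall i, (0 <= a i)%E) ->
  (\esum_(i in [set: T]) (c%:E * a i) = c%:E * \esum_(i in [set: T]) a i)%E.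
Proof.
(* One inequality for every positive scalar; the converse is the same inequality for [c^-1]. *)
have H (c' : R) (b : T -> \bar R) : 0 < c' -> (forall i, (0 <= b i)%E) ->
    (\esum_(i in [set: T]) (c'%:E * b i) <= c'%:E * \esum_(i in [set: T]) b i)%E.
  move=> c0 b0; apply: ub_ereal_sup => _ [X [fX XT] <-].
  rewrite -ge0_mule_fsumr//.
  rewrite lee_pmul2l ?lte_fin//.
  by apply: esum_ge; exists X.
move=> c0 a0; apply/eqP; rewrite eq_le H//=.
have := H c^-1 (fun i => (c%:E * a i)%E); rewrite invr_gt0 => /(_ c0).
have E (x : \bar R) : (c^-1%:E * (c%:E * x) = x)%E.
  by rewrite muleA -EFinM mulVf ?mul1e// gt_eqF.
have ca0 i : (0 <= c%:E * a i)%E by rewrite mule_ge0// lee_fin ltW.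
move=> /(_ ca0); under eq_esum do rewrite E.
move=> h; rewrite -(@lee_pmul2l _ c^-1%:E) ?lte_fin ?invr_gt0//.
by rewrite E.
Qed.

End Esum.

(** Enumerates the integers as 0, -1, 1, -2, ..., so that sums over them become series to which
    monotone convergence applies. *)
Definition int_of_nat (n : nat) : int := if odd n then Negz n./2 else Posz n./2.

Lemma int_of_nat_bij : bijective int_of_nat.
Proof.
exists (fun m : int => match m with Posz k => k.*2 | Negz k => k.*2.+1 end).
- by move=> n; rewrite /int_of_nat -[RHS]odd_double_half; case: odd.
- by case=> n; rewrite /int_of_nat /= odd_double/= ?doubleK// uphalf_double.
Qed.

(** * Restriction to sets, truncation and dominated convergence *)

Section Cut.
Variable R : realType.
Local Notation C := (complex R).
Local Notation Re := complex.Re.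
Local Notation Im := complex.Im.
Local Notation mu := (@lebesgue_measure R).
Implicit Types f g h k : R -> C.

Lemma ge0_integral_esum_int (D : set R) (F : int -> R -> \bar R) : measurable D ->
  (forall m, measurable_fun D (F m)) -> (forall m x, (0 <= F m x)%E) ->
  (\int[mu]_(x in D) (\esum_(m in [set: int]) F m x) =
   \esum_(m in [set: int]) \int[mu]_(x in D) F m x)%E.
Proof.
move=> mD mF F0; rewrite (reindex_esumT _ int_of_nat_bij).
rewrite -nneseries_esumT; last by move=> n; exact: integral_ge0.
rewrite -(@integral_nneseries _ _ _ mu D mD (fun n => F (int_of_nat n)))//; last first.
  by move=> n; exact: mF.
apply: eq_integral => x _.
by rewrite (reindex_esumT _ int_of_nat_bij) -nneseries_esumT.
Qed.

Definition cut (A : set R) f : R -> C := fun x => real_complex R (\1_A x) * f x.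

Lemma cut_in A f x : A x -> cut A f x = f x.
Proof. by move=> Ax; rewrite /cut indicE mem_set// mul1r. Qed.

Lemma cut_out A f x : ~ A x -> cut A f x = 0.
Proof. by move=> Ax; rewrite /cut indicE memNset// mul0r. Qed.

Lemma cut_eq0 A f x : f x = 0 -> cut A f x = 0.
Proof. by move=> f0; rewrite /cut f0 mulr0. Qed.

Lemma sqmod_cut A f x : sqmod (cut A f x) = \1_A x * sqmod (f x).
Proof. by rewrite sqmodM sqmodC indicE; case: (x \in A); rewrite ?expr0n ?expr1n. Qed.

Lemma sqmod_cut_le A f x : sqmod (cut A f x) <= sqmod (f x).
Proof.
by rewrite sqmod_cut ler_piMl ?sqmod_ge0// indicE; case: (x \in A).
Qed.

Lemma cmeasurable_cut A f : measurable A -> cmeasurable f -> cmeasurable (cut A f).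
Proof.
move=> mA mf; apply: cmeasurableM => //; apply: cmeasurable_real.
exact: measurable_indic.
Qed.

Lemma L2_cut A f : measurable A -> L2 f -> L2 (cut A f).
Proof.
move=> mA Lf; apply: (@L2_le _ _ (fun x => sqmod (f x))).
- by apply: cmeasurable_cut => //; exact: L2_measurable.
- by move=> x; exact: sqmod_cut_le.
- exact: L2_integrable.
Qed.

Lemma ip_cut A f g : ip (cut A f) g = ip f (cut A g).
Proof.
by apply: eq_cint => x; rewrite /cut conjcM conjcC; ring.
Qed.

Lemma ip_cut2 A f g : ip (cut A f) (cut A g) = ip (cut A f) g.
Proof.
apply: eq_cint => x; have [Ax|Ax] := pselect (A x); first by rewrite !cut_in.
by rewrite !cut_out// !mul0r.
Qed.

Lemma cint_cut A f : cint A f = cint setT (cut A f).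
Proof.
apply: complexP; rewrite !(Re_cint, Im_cint) Rintegral_mkcond; apply: eq_Rintegral => x _;
  by rewrite patch_indic /= /cut ?(ReM, ImM) ReC ImC mulrC; ring.
Qed.

Definition csupp (M : R) f := forall x, M < `|x| -> f x = 0.

Lemma L2_csupp_bdd f (M B : R) : cmeasurable f -> csupp M f ->
  (forall x, sqmod (f x) <= B) -> L2 f.
Proof.
move=> mf fM fB; apply: (@L2_le _ _ (fun x => B * \1_(`[- M, M]%classic) x)) => //.
- move=> x; rewrite indicE; case: (boolP (x \in _)) => xM; first by rewrite mulr1.
  rewrite fM ?sqmod0 ?mulr0//; move: xM; rewrite mem_setE/= in_itv/=.
  by rewrite -ler_norml -ltNge.
- by apply: integrableRZ; exact: integrable_indic_itv.
Qed.

Lemma csupp_itv f M x : csupp M f -> f x != 0 -> `[- M, M]%classic x.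
Proof.
move=> fM fx; rewrite /= in_itv/= -ler_norml leNgt.
by apply/negP => /fM f0; rewrite f0 eqxx in fx.
Qed.

Lemma cintegrable_csupp f k M B : L2 f -> csupp M f -> cmeasurable k ->
  (forall x, sqmod (k x) <= B) -> cintegrable (fun x => f x * k x).
Proof.
move=> Lf fM mk kB.
have Lk : L2 (cut `[- M, M]%classic (fun x => conjc (k x))).
  apply: (@L2_csupp_bdd _ M B).
  - by apply: cmeasurable_cut => //; exact: cmeasurableJ.
  - by move=> x Mx; rewrite cut_out//= in_itv/= -ler_norml leNgt Mx.
  - by move=> x; rewrite (le_trans (sqmod_cut_le _ _ _))// sqmodJ.
have := cintegrable_ip Lf Lk; congr cintegrable; apply/funext => x.
have [->|fx] := eqVneq (f x) 0; first by rewrite !mul0r.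
by rewrite cut_in ?conjcK//; exact: csupp_itv fM fx.
Qed.

Lemma csupp_cut_itv f (M : R) : csupp M (cut `[- M, M]%classic f).
Proof. by move=> x Mx; rewrite cut_out//= in_itv/= -ler_norml leNgt Mx. Qed.

Lemma nrm_cvg0 (F : nat -> R -> C) (v : R -> R) : (forall n, cmeasurable (F n)) ->
  mu.-integrable setT (EFin \o v) -> (forall n x, sqmod (F n x) <= v x) ->
  (forall x, sqmod (F n x) @[n --> \oo] --> 0) ->
  nrm (F n) @[n --> \oo] --> 0.
Proof.
move=> mF iv Fv F0.
have H : (\int[mu]_x (sqmod (F n x))%:E)%E @[n --> \oo] --> (\int[mu]_x (cst 0%E x : \bar R))%E.
  apply: (@dominated_cvg _ _ _ mu setT measurableT _ _ (EFin \o v)) => //.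
  - by move=> n; apply/measurable_EFinP; exact: measurable_sqmod.
  - by move=> x _; apply: cvg_EFin; [exact: nearW|exact: F0].
  - by move=> n x _ /=; rewrite lee_fin ger0_norm ?sqmod_ge0.
move: H; rewrite integral0 => /fine_cvg; exact.
Qed.

(** On this set both the variable and [f] are bounded. The sets exhaust the line, so the cuts of [f]
    are bounded functions of bounded support that converge to [f] in L^2. *)
Definition trunc_set f (n : nat) : set R := [set x | `|x| <= n%:R /\ sqmod (f x) <= n%:R].

Lemma measurable_trunc_set f n : cmeasurable f -> measurable (trunc_set f n).
Proof.
move=> mf.
rewrite (_ : trunc_set f n = `[- n%:R, n%:R]%classic `&` [set x | sqmod (f x) <= n%:R]); last first.
  by apply/seteqP; split => x [h1 h2]; split => //; move: h1; rewrite /= in_itv/= ler_norml.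
apply: measurableI => //.
rewrite (_ : [set _ | _] = (fun x => sqmod (f x)) @^-1` `]-oo, n%:R]%classic); last first.
  by apply/seteqP; split => x /=; rewrite in_itv.
by rewrite -[X in measurable X]setTI; exact: measurable_sqmod.
Qed.

Lemma nrm_sub_cut_cvg0 f (A : nat -> set R) : (forall n, measurable (A n)) -> L2 f ->
  (forall x, \forall n \near \oo, A n x) ->
  nrm (fun x => f x - cut (A n) f x) @[n --> \oo] --> 0.
Proof.
move=> mA Lf nA; apply: (@nrm_cvg0 _ (fun x => sqmod (f x))).
- move=> n; apply: cmeasurableD; first exact: L2_measurable.
  by apply: cmeasurableN; apply: cmeasurable_cut => //; exact: L2_measurable.
- exact: L2_integrable.
- move=> n x; have [Ax|Ax] := pselect (A n x).
    by rewrite cut_in// subrr sqmod0 sqmod_ge0.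
  by rewrite cut_out// subr0.
- move=> x; apply: cvg_near_cst; near=> n.
  rewrite cut_in ?subrr ?sqmod0//; by near: n.
Unshelve. all: by end_near. Qed.

Lemma near_norm_le (r : R) : \forall n \near \oo, r <= n%:R.
Proof. exact: nbhs_infty_ger. Qed.

Lemma nrm_sub_trunc_set_cvg0 f : L2 f -> nrm (fun x => f x - cut (trunc_set f n) f x) @[n --> \oo] --> 0.
Proof.
move=> Lf; apply: nrm_sub_cut_cvg0 => //.
  by move=> n; apply: measurable_trunc_set; exact: L2_measurable.
by move=> x; near=> n; split; near: n; exact: near_norm_le.
Unshelve. all: by end_near. Qed.

Lemma nrm_sub_itv_cvg0 f : L2 f ->
  nrm (fun x => f x - cut `[- n%:R, n%:R]%classic f x) @[n --> \oo] --> 0.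
Proof.
move=> Lf; apply: nrm_sub_cut_cvg0 => //.
by move=> x; near=> n; rewrite /= in_itv/= -ler_norml; near: n; exact: near_norm_le.
Unshelve. all: by end_near. Qed.

End Cut.

(** * Fourier series *)

Section Orthogonal.
Variable R : realType.
Local Notation C := (complex R).
Local Notation Re := complex.Re.
Local Notation Im := complex.Im.
Variables (I : choiceType) (e : I -> R -> C) (P : R).
Hypothesis P0 : 0 < P.
Hypothesis Le : forall i, L2 (e i).
Hypothesis oe : forall i j, ip (e i) (e j) = if i == j then real_complex R P else 0.
Implicit Types f g h : R -> C.

Definition proj_seq (s : seq I) f : R -> C :=
  fun x => \sum_(i <- s) real_complex R P^-1 * ip f (e i) * e i x.

Lemma L2_proj_seq s f : L2 (proj_seq s f).
Proof. by apply: L2_sum => i; exact: L2Z. Qed.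

Lemma ip_proj_seq s f j : uniq s -> j \in s -> ip (proj_seq s f) (e j) = ip f (e j).
Proof.
move=> us js; rewrite ip_suml//; last by move=> i; exact: L2Z.
rewrite (bigD1_seq j)//= big1 ?addr0.
  rewrite ipZl// oe eqxx mulrAC -rmorphM mulVf ?gt_eqF// rmorph1 mul1r//.
by move=> i ij; rewrite ipZl// oe (negbTE ij) mulr0.
Qed.

Lemma ip_f_proj_seq s f g : L2 g ->
  ip g (proj_seq s f) = \sum_(i <- s) real_complex R P^-1 * conjc (ip f (e i)) * ip g (e i).
Proof.
move=> Lg; rewrite ip_sumr//; last by move=> i; exact: L2Z.
by apply: eq_bigr => i _; rewrite ipZr// conjcM conjcC.
Qed.

Lemma Re_sum (s : seq I) (F : I -> C) : Re (\sum_(i <- s) F i) = \sum_(i <- s) Re (F i).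
Proof.
elim: s => [|i s IH]; first by rewrite !big_nil.
by rewrite !big_cons ReD IH.
Qed.

Lemma Re_ip_proj s f : L2 f ->
  Re (ip f (proj_seq s f)) = P^-1 * \sum_(i <- s) sqmod (ip f (e i)).
Proof.
move=> Lf; rewrite ip_f_proj_seq// Re_sum mulr_sumr; apply: eq_bigr => i _.
by rewrite -mulrA (mulrC (conjc _)) sqmod_mulJ -rmorphM.
Qed.

Lemma nrm_proj_seq s f : uniq s -> L2 f ->
  nrm (proj_seq s f) = P^-1 * \sum_(i <- s) sqmod (ip f (e i)).
Proof.
move=> us Lf; rewrite nrmE ip_f_proj_seq; last exact: L2_proj_seq.
rewrite Re_sum mulr_sumr big_seq [RHS]big_seq; apply: eq_bigr => i si.
by rewrite ip_proj_seq// -mulrA (mulrC (conjc _)) sqmod_mulJ -rmorphM.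
Qed.

(** The squared distance from [f] to the span of the [e i] with [i] in [s], written through Bessel's
    inequality. *)
Definition defect s f := nrm f - P^-1 * \sum_(i <- s) sqmod (ip f (e i)).

Lemma defectE s f : uniq s -> L2 f -> defect s f = nrm (fun x => f x - proj_seq s f x).
Proof.
move=> us Lf; rewrite nrmB//; last exact: L2_proj_seq.
by rewrite nrm_proj_seq// Re_ip_proj// /defect; ring.
Qed.

Lemma defect_ge0 s f : uniq s -> L2 f -> 0 <= defect s f.
Proof. by move=> us Lf; rewrite defectE// nrm_ge0. Qed.

Lemma defect_le s f : defect s f <= nrm f.
Proof.
rewrite /defect lerBlDr lerDl mulr_ge0//; first by rewrite invr_ge0 ltW.
by apply: sumr_ge0 => i _; exact: sqmod_ge0.
Qed.

Lemma bessel_seq s f : uniq s -> L2 f -> \sum_(i <- s) sqmod (ip f (e i)) <= P * nrm f.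
Proof.
move=> us Lf; have := defect_ge0 us Lf.
by rewrite /defect subr_ge0 ler_pdivrMl.
Qed.

Lemma proj_seqD s f g : L2 f -> L2 g ->
  proj_seq s (fun x => f x + g x) = fun x => proj_seq s f x + proj_seq s g x.
Proof.
move=> Lf Lg; apply/funext => x; rewrite /proj_seq -big_split /=; apply: eq_bigr => i _.
by rewrite ipDl// mulrDr mulrDl.
Qed.

Lemma defectD s f g : uniq s -> L2 f -> L2 g ->
  defect s (fun x => f x + g x) <= 2 * defect s f + 2 * defect s g.
Proof.
move=> us Lf Lg; rewrite !defectE//; last exact: L2D.
rewrite proj_seqD//.
have := nrmD_le2 (L2B Lf (L2_proj_seq s f)) (L2B Lg (L2_proj_seq s g)).
congr (_ <= _); congr nrm; apply/funext => x.
by ring.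
Qed.

Lemma defectZ s c f : L2 f -> defect s (fun x => c * f x) = sqmod c * defect s f.
Proof.
move=> Lf; rewrite /defect nrmZ// mulrBr; congr (_ - _).
rewrite mulrCA; congr (_ * _); rewrite mulr_sumr; apply: eq_bigr => i _.
by rewrite ipZl// sqmodM.
Qed.

Lemma esum_bessel f : L2 f ->
  (\esum_(i in [set: I]) (sqmod (ip f (e i)))%:E <= (P * nrm f)%:E)%E.
Proof.
move=> Lf; apply: ub_ereal_sup => _ [X [fX _] <-].
rewrite fsbig_finite//= sumEFin lee_fin.
by apply: bessel_seq.
Qed.

End Orthogonal.

Lemma le_sum_esum (R : realType) (I : choiceType) (a : I -> R) (s : seq I) : uniq s ->
  (forall i, 0 <= a i) ->
  ((\sum_(i <- s) a i)%:E <= \esum_(i in [set: I]) (a i)%:E)%E.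
Proof.
move=> us a0; apply: esum_ge; exists [set` s].
  by split => //; exact: finite_seq.
by rewrite -fsbig_seq// sumEFin.
Qed.

(** The integers from -N to N, extended by one opposite pair at a time, so that symmetric partial
    sums can be treated by induction. *)
Fixpoint sym_range (N : nat) : seq int :=
  if N is k.+1 then [:: Posz k.+1, - Posz k.+1 & sym_range k] else [:: 0].

Lemma sym_range_le N m : m \in sym_range N -> (`|m|%N <= N)%N.
Proof.
elim: N => [|N IH] /=; first by rewrite inE => /eqP ->.
rewrite !inE => /or3P[/eqP->|/eqP->|/IH h]; [exact: leqnn|by rewrite abszN|].
exact: leqW.
Qed.

Lemma sym_range_uniq N : uniq (sym_range N).
Proof.
elim: N => [//|N IH]; rewrite [uniq _]/= inE negb_or IH andbT.
apply/andP; split; [apply/andP; split => //|]; apply/negP => /sym_range_le;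
  by rewrite ?abszN absz_nat ltnn.
Qed.

Section Telescope.
Variable V : zmodType.
Lemma sym_range_telescope (u : int -> V) N :
  \sum_(m <- sym_range N) (u m - u (m + 1)) = u (- Posz N) - u (Posz N.+1).
Proof.
elim: N => [|N IH]; first by rewrite /= big_seq1 oppr0 add0r.
rewrite [sym_range _]/= !big_cons IH.
have -> : - Posz N.+1 + 1 = - Posz N by rewrite -addn1 PoszD opprD addrK.
have -> : Posz N.+1 + 1 = Posz N.+2 by rewrite -PoszD addn1.
by rewrite subrKA addrC subrKA.
Qed.
End Telescope.

(** * Integrals of sines and cosines *)

Section TrigIntegrals.
Variable R : realType.
Local Notation mu := (@lebesgue_measure R).

Lemma Rintegral_oo_FTC (f F : R -> R) (a b : R) : a < b -> continuous f ->
  (forall x : R, is_derive x 1 F (f x)) ->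
  Rintegral mu `]a, b[%classic f = F b - F a.
Proof.
move=> ab cf dF.
have cF : continuous F.
  move=> x; apply: differentiable_continuous; apply/derivable1_diffP.
  by case: (dF x).
have mf : measurable_fun setT f by exact: continuous_measurable_fun.
have ic : mu.-integrable `[a, b]%classic (EFin \o f).
  by apply: continuous_compact_integrable; [exact: segment_compact|exact: continuous_subspaceT].
rewrite Rintegral_itv_bndo_bndc; last first.
  by apply: integrableS ic => //; move=> x; rewrite /= !in_itv/= => /andP[/ltW -> /ltW ->].
rewrite Rintegral_itv_obnd_cbnd; last first.
  by apply: integrableS ic => //; move=> x; rewrite /= !in_itv/= => /andP[/ltW -> ->].
rewrite /Rintegral (@continuous_FTC2 _ f F)//.
- exact: continuous_subspaceT.
- split.
  + by move=> x _; case: (dF x).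
  + by apply: cvg_at_right_filter; exact: cF.
  + by apply: cvg_at_left_filter; exact: cF.
- by move=> x _; rewrite derive1E; apply: derive_val.
Qed.

Lemma Rintegral_cosM (w a b : R) : w != 0 -> a < b ->
  Rintegral mu `]a, b[%classic (fun t => cos (w * t)) = w^-1 * (sin (w * b) - sin (w * a)).
Proof.
move=> w0 ab.
have cc : continuous (fun t : R => cos (w * t)).
  by move=> x; apply: continuous_comp; [exact: mulrl_continuous|exact: continuous_cos].
suff dF (x : R) : is_derive x 1 (fun t => w^-1 * sin (w * t)) (cos (w * x)).
  by rewrite (Rintegral_oo_FTC ab cc dF); ring.
have d1 : is_derive x 1 (fun t : R => w * t) w.
  by rewrite -[X in is_derive _ _ _ X]mulr1; apply: is_deriveZ.
have d2 := is_derive1_comp (is_derive_sin (w * x)) d1.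
have H := is_deriveZ w^-1 d2.
by apply: (is_derive_eq H); rewrite /GRing.scale/=; field.
Qed.

Lemma Rintegral_sinM (w a b : R) : w != 0 -> a < b ->
  Rintegral mu `]a, b[%classic (fun t => sin (w * t)) = w^-1 * (cos (w * a) - cos (w * b)).
Proof.
move=> w0 ab.
have cc : continuous (fun t : R => sin (w * t)).
  by move=> x; apply: continuous_comp; [exact: mulrl_continuous|exact: continuous_sin].
suff dF (x : R) : is_derive x 1 (fun t => - w^-1 * cos (w * t)) (sin (w * x)).
  by rewrite (Rintegral_oo_FTC ab cc dF); ring.
have d1 : is_derive x 1 (fun t : R => w * t) w.
  by rewrite -[X in is_derive _ _ _ X]mulr1; apply: is_deriveZ.
have d2 := is_derive1_comp (is_derive_cos (w * x)) d1.
have H := is_deriveZ (- w^-1) d2.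
by apply: (is_derive_eq H); rewrite /GRing.scale/=; field.
Qed.

End TrigIntegrals.

(** * Orthogonality of the exponentials on an interval *)

Section FourierBasis.
Variable R : realType.
Local Notation C := (complex R).
Local Notation Re := complex.Re.
Local Notation Im := complex.Im.
Local Notation mu := (@lebesgue_measure R).
Variables (al P : R).
Hypothesis P0 : 0 < P.
Implicit Types f g h : R -> C.

Local Notation I := (`]al, al + P[%classic : set R).

Definition fexp (m : int) : R -> C := fun t => expi (m%:~R * t / P).
Definition fbasis (m : int) : R -> C := cut I (fexp m).

Lemma csupp_cutI f : csupp (`|al| + P) (cut I f).
Proof.
move=> x hx; rewrite cut_out//= in_itv/= => /andP[h1 h2].
move: hx; rewrite ltNge => /negP; apply; rewrite ler_norml.
have := ler_norm al; have := ler_norm (- al); rewrite normrN => n1 n2.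
by apply/andP; split; lra.
Qed.

Lemma cmeasurable_fe m : cmeasurable (fexp m).
Proof.
apply: cmeasurable_expi; apply: measurable_funM => //; exact: measurable_funM.
Qed.

Lemma L2_fE m : L2 (fbasis m).
Proof.
apply: (@L2_csupp_bdd _ _ (`|al| + P) 1); [|exact: csupp_cutI|].
- by apply: cmeasurable_cut => //; exact: cmeasurable_fe.
- by move=> x; rewrite (le_trans (sqmod_cut_le _ _ _))// sqmod_expi.
Qed.

Lemma cint_fe (k : int) : cint I (fexp k) = if k == 0 then real_complex R P else 0.
Proof.
have aP : al < al + P by rewrite ltrDl.
case: eqP => [->|/eqP k0].
  have -> : fexp 0 = fun _ => 1 by apply/funext => t; rewrite /fexp !mul0r expi0.
  apply: complexP; rewrite !(Re_cint, Im_cint) Rintegral_cst//= lebesgue_measure_itv/= lte_fin aP.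
    by rewrite mul1r /= addrAC subrr add0r.
  by rewrite mul0r.
set w := 2 * pi * k%:~R / P.
have wE t : 2 * pi * (k%:~R * t / P) = w * t by rewrite /w; field; rewrite gt_eqF.
have w0 : w != 0.
  have pn : (pi : R) != 0 by rewrite gt_eqF// pi_gt0.
  have Pn : P != 0 by rewrite gt_eqF.
  by rewrite /w !mulf_neq0// ?invr_eq0 ?pnatr_eq0 ?intr_eq0.
(* Periodicity: the primitives take equal values at both ends, so both integrals vanish. *)
have ew : fexp k (al + P) = fexp k al.
  rewrite /fexp mulrDr mulrDl mulfK ?gt_eqF// expiD expi_int mulr1//.
have [ec es] : cos (w * (al + P)) = cos (w * al) /\ sin (w * (al + P)) = sin (w * al).
  by rewrite -!wE; case: ew.
apply: complexP; rewrite !(Re_cint, Im_cint).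
- rewrite (_ : (fun x => _) = fun t => cos (w * t)).
    by rewrite Rintegral_cosM// es subrr mulr0.
  by apply/funext => t; rewrite /fexp /expi /= wE.
- rewrite (_ : (fun x => _) = fun t => sin (w * t)).
    by rewrite Rintegral_sinM// ec subrr mulr0.
  by apply/funext => t; rewrite /fexp /expi /= wE.
Qed.

Lemma fe_mul i j t : fexp i t * fexp j t = fexp (i + j) t.
Proof. by rewrite /fexp -expiD -!mulrDl intrD. Qed.

Lemma fe_J i t : conjc (fexp i t) = fexp (- i) t.
Proof. by rewrite /fexp expiJ -!mulNr intrN. Qed.

Lemma ip_fE f m : ip f (fbasis m) = cint I (fun t => f t * fexp (- m) t).
Proof.
rewrite cint_cut /ip; apply: eq_cint => t.
have [It|It] := pselect (I t); first by rewrite /fbasis !cut_in// fe_J.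
by rewrite /fbasis !cut_out// /conjc /= oppr0 mulr0.
Qed.

Lemma fE_orth i j : ip (fbasis i) (fbasis j) = if i == j then real_complex R P else 0.
Proof.
rewrite /fbasis ip_cut2 ip_cut -/(fbasis j) ip_fE.
rewrite -subr_eq0 -cint_fe; congr cint; apply/funext => t.
by rewrite fe_mul.
Qed.

End FourierBasis.

(** * Pointwise convergence of the Fourier series of the indicator of a half-line (Chernoff) *)

Section Chernoff.
Variable R : realType.
Local Notation C := (complex R).
Local Notation Re := complex.Re.
Local Notation Im := complex.Im.
Local Notation mu := (@lebesgue_measure R).

Lemma sqmod_expiB (s t : R) : sqmod (expi s - expi t) = 4 * sin (pi * (s - t)) ^+ 2.
Proof.
have -> : 4 * sin (pi * (s - t)) ^+ 2 = 2 - 2 * cos (2 * pi * s - 2 * pi * t).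
  have -> : 2 * pi * s - 2 * pi * t = (pi * (s - t)) *+ 2 by rewrite -mulr_natr; ring.
  by rewrite cos_mulr2n -mulr_natr sin2cos2; ring.
rewrite cosB /sqmod !ReImE /expi/=.
have := cos2Dsin2 (2 * pi * s); have := cos2Dsin2 (2 * pi * t); lra.
Qed.

(** As cos decreases on [0, pi], cos(x)^2 is at most cos(a)^2 when cos x is nonnegative and at most
    cos(b)^2 when it is negative. *)
Lemma sin_sqr_ge (a b x : R) : 0 < a -> b < pi -> a <= x <= b ->
  Num.min (sin a ^+ 2) (sin b ^+ 2) <= sin x ^+ 2.
Proof.
move=> a0 bp /andP[ax xb]; rewrite ge_min !sin2cos2.
have p y : a <= y <= b -> y \in `[0, pi] by move=> /andP[h1 h2]; rewrite in_itv/=; lra.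
have ab : a <= b by lra.
have cx : cos x <= cos a by rewrite leNgt ltr_cos ?p ?lexx ?ax ?ab// -leNgt.
have cx' : cos b <= cos x by rewrite leNgt ltr_cos ?p ?lexx ?ax ?ab ?andbT// -leNgt.
have [c0|c0] := leP 0 (cos x).
- by apply/orP; left; nra.
- by apply/orP; right; nra.
Qed.

Variables (al P : R).
Hypothesis P0 : 0 < P.
Implicit Types f g h : R -> C.
Local Notation I := (`]al, al + P[%classic : set R).
Local Notation fe := (fexp P).
Local Notation fE := (fbasis al P).
Local Notation L2_fE := (L2_fE al P).
Local Notation fE_orth := (fE_orth al P0).

Lemma sum_sym_range_mono (a : int -> R) N M : (forall m, 0 <= a m) -> (N <= M)%N ->
  \sum_(m <- sym_range N) a m <= \sum_(m <- sym_range M) a m.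
Proof.
move=> a0; elim: M => [|M IH]; first by rewrite leqn0 => /eqP ->.
rewrite leq_eqVlt => /orP[/eqP->//|]; rewrite ltnS => /IH h.
rewrite [sym_range M.+1]/= !big_cons addrA.
by apply: (le_trans h); rewrite lerDr addr_ge0.
Qed.

(** A Riemann-Lebesgue lemma drawn from Bessel's inequality: the partial sums of the squared
    coefficients are monotone and bounded. The two indices are those of the boundary terms of the
    telescoping sum. *)
Lemma fourier_coef_cvg0 f : L2 f ->
  (sqmod (ip f (fE (Posz N))) + sqmod (ip f (fE (- Posz N.+1)))) @[N --> \oo] --> (0 : R).
Proof.
move=> Lf; pose a m := sqmod (ip f (fE m)).
have a0 m : 0 <= a m by exact: sqmod_ge0.
pose b i := a (Posz i.+1) + a (- Posz i.+1).
have sb N : series b N + a 0 = \sum_(m <- sym_range N) a m.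
  elim: N => [|N IH]; first by rewrite /series/= big_geq// big_seq1 add0r.
  rewrite [sym_range _]/= !big_cons -IH /series/= big_nat_recr//= /b.
  by ring.
have b0 : b N @[N --> \oo] --> (0 : R).
  apply: cvg_series_cvg_0; apply: nondecreasing_is_cvgn.
    move=> N M NM; rewrite -(lerD2r (a 0)) !sb; exact: sum_sym_range_mono.
  exists (P * nrm f) => _ [N _ <-].
  have : series b N + a 0 <= P * nrm f.
    by rewrite sb; exact: (bessel_seq P0 L2_fE fE_orth (sym_range_uniq N) Lf).
  by apply: le_trans; rewrite lerDl.
(* After the shift, the coefficient at N + 1 is bounded by [b N] and the one at -(N + 2) by
   [b N.+1]. *)
rewrite -(cvg_shiftS (fun N => a (Posz N) + a (- Posz N.+1))).
apply: (@squeeze_cvgr _ _ _ _ (fun=> 0) (fun N => b N + b N.+1)).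
- by near=> N; rewrite addr_ge0//= lerD// /b ?lerDl// lerDr.
- exact: cvg_cst.
- rewrite -[X in _ --> X]addr0; apply: cvgD => //.
  by rewrite (cvg_shiftS b).
Unshelve. all: by end_near. Qed.

Section pointwise.
Variables (p x : R).
Hypothesis px : p < x.
Hypothesis Ix : I x.
Local Notation J := (I `&` `]p, +oo[%classic : set R).
Let f : R -> C := cut J (fun _ => 1).
Let q := Num.max p al.
(** A lower bound for |D|^2 on [K]: there x - t runs between x - q and x - al, inside ]0, P[, and
    the chord |D| is 2 sin(pi (x - t) / P). *)
Let m := Num.min (sin (pi / P * (x - q)) ^+ 2) (sin (pi / P * (x - al)) ^+ 2).
Let D : R -> C := fun t => fe 1 t - fe 1 x.
Let K : set R := I `&` `]-oo, p]%classic.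
(** Chernoff's quotient (f - 1) / D: it vanishes where f = 1, and on [K] it is -1 / D. The maximum
    with [m] leaves its values on [K] unchanged and makes boundedness and measurability
    immediate. *)
Let h : R -> C :=
  cut K (fun t => - conjc (D t) * real_complex R (Num.max m (sqmod (D t)))^-1).

Let mJ : measurable (J : set R). Proof. exact: measurableI. Qed.

Let Lf : L2 f.
Proof.
apply: (@L2_csupp_bdd _ _ (`|al| + P) 1).
- by apply: cmeasurable_cut => //; exact: cmeasurable_cst.
- move=> t ht; rewrite /f cut_out// => -[It _].
  have := csupp_cutI (fun=> 1) ht; rewrite cut_in// => /eqP.
  by rewrite oner_eq0.
- move=> t; rewrite (le_trans (sqmod_cut_le _ _ _))// -[1]/(real_complex R 1) sqmodC expr1n//.
Qed.

Let pP : 0 < (pi : R) / P. Proof. by rewrite divr_gt0// pi_gt0. Qed.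
Let pPP : (pi : R) / P * P = pi. Proof. by rewrite divfK// gt_eqF. Qed.
Let qx : q < x.
Proof. by rewrite gt_max px; move: Ix; rewrite /= in_itv/= => /andP[]. Qed.
Let alq : al <= q. Proof. by rewrite le_max lexx orbT. Qed.
Let xP : x < al + P. Proof. by move: Ix; rewrite /= in_itv/= => /andP[]. Qed.

Let m0 : 0 < m.
Proof.
have sp y : 0 < y < P -> 0 < sin (pi / P * y) ^+ 2.
  move=> /andP[y0 yP]; rewrite exprn_gt0//; apply: sin_gt0_pi.
  by rewrite mulr_gt0//= -[ltRHS]pPP ltr_pM2l.
have := qx; have := alq; have := xP => h1 h2 h3.
by rewrite lt_min !sp//; lra.
Qed.

Let m_le t : K t -> m <= sqmod (D t).
Proof.
move=> [/=]; rewrite !in_itv/= => /andP[t1 t2] tp.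
have tq : t <= q by rewrite le_max tp.
rewrite /D sqmod_expiB.
have -> : pi * (1%:~R * t / P - 1%:~R * x / P) = - (pi / P * (x - t)).
  by rewrite mulr1z; ring.
rewrite sinN sqrrN.
have : m <= sin (pi / P * (x - t)) ^+ 2.
  have := qx; have := alq; have := xP => h1 h2 h3.
  apply: sin_sqr_ge.
  - by rewrite mulr_gt0//; lra.
  - by rewrite -[ltRHS]pPP ltr_pM2l//; lra.
  - by rewrite !ler_pM2l//; lra.
by have := sqr_ge0 (sin (pi / P * (x - t))); lra.
Qed.

Let maxm0 y : 0 < Num.max m y. Proof. by rewrite lt_max m0. Qed.

Let sqmod_h t : sqmod (h t) <= m^-1.
Proof.
rewrite (le_trans (sqmod_cut_le _ _ _))// sqmodM sqmodN sqmodJ sqmodC.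
set y := sqmod (D t); have M0 := maxm0 y; set M := Num.max m y in M0 *.
have yM : y <= M by rewrite le_max lexx orbT.
have mM : m <= M by rewrite le_max lexx.
apply: (@le_trans _ _ M^-1); last by rewrite lef_pV2// posrE.
have V0 : 0 < M^-1 by rewrite invr_gt0.
rewrite expr2 mulrA; apply: ler_piMl; first exact: ltW.
by rewrite ler_pdivrMr// mul1r.
Qed.

Let hE t : I t -> f t - 1 = D t * h t.
Proof.
move=> It; have [tp|tp] := ltP p t.
  rewrite /f cut_in; last by split => //=; rewrite in_itv/= tp.
  by rewrite /h cut_out ?subrr ?mulr0// => -[_] /=; rewrite in_itv/= leNgt tp.
have Kt : K t by split => //=; rewrite in_itv/= tp.
rewrite /f cut_out; last by move=> [_] /=; rewrite in_itv/= andbT ltNge tp.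
rewrite /h cut_in// mulrA mulrN sqmod_mulJ mulNr -rmorphM/= max_r ?m_le//.
rewrite mulfV ?rmorph1 ?sub0r// gt_eqF//.
exact: lt_le_trans (m_le Kt).
Qed.

Let mD : cmeasurable D.
Proof.
apply: cmeasurableD; first exact: cmeasurable_fe.
exact: cmeasurable_cst.
Qed.

Let Lh : L2 h.
Proof.
apply: (@L2_csupp_bdd _ _ (`|al| + P) m^-1) => //.
- apply: cmeasurable_cut; first exact: measurableI.
  apply: cmeasurableM; first by apply: cmeasurableN; exact: cmeasurableJ.
  apply: cmeasurable_real.
  have : measurable_fun setT (fun y : R => (Num.max m y)^-1).
    apply: continuous_measurable_fun => y; apply: cvgV; first by rewrite gt_eqF.
    by apply: (@continuous_max _ _ (fun=> m) id y); [exact: cvg_cst|exact: cvg_id].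
  move=> mm; exact: (measurableT_comp mm (measurable_sqmod mD)).
- move=> t ht; rewrite /h cut_out// => -[It _].
  have := csupp_cutI (fun=> 1) ht; rewrite cut_in// => /eqP.
  by rewrite oner_eq0.
Qed.

Let u (k : int) := ip h (fE (k - 1)) * fe k x.

(** Multiplying [h] by [fe 1] shifts its Fourier coefficients by one. Hence f - 1 = (fe 1 - fe 1 x)
    h turns each term of the series of f - 1 at x into a difference of consecutive [u]. *)
Let coefE k : ip f (fE k) * fe k x = ip (fE 0) (fE k) * fe k x + (u k - u (k + 1)).
Proof.
have L1 : L2 (fun t => fe 1 t * h t).
  apply: (@L2_bdd_mul _ _ _ 1) => //; first exact: cmeasurable_fe.
  by move=> t; rewrite sqmod_expi.
have E1 : ip f (fE k) - ip (fE 0) (fE k) = ip h (fE (k - 1)) - fe 1 x * ip h (fE k).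
  have -> : ip h (fE (k - 1)) = ip (fun t => fe 1 t * h t) (fE k).
    rewrite !ip_fE; congr cint; apply/funext => t.
    by rewrite [RHS]mulrAC fe_mul opprB mulrC.
  rewrite -(ipZl _ Lh (L2_fE k)) -(ipBl Lf (L2_fE 0) (L2_fE k)) -(ipBl L1 (L2Z _ Lh) (L2_fE k)).
  rewrite [LHS]ip_fE [RHS]ip_fE [LHS]cint_cut [RHS]cint_cut; apply: eq_cint => t.
  have [It|It] := pselect (I t); last by rewrite !cut_out.
  rewrite !cut_in// -mulrBl -/(D t) -hE// /fbasis cut_in//.
  by rewrite /fexp !mul0r expi0.
have -> : ip f (fE k) = ip (fE 0) (fE k) + (ip f (fE k) - ip (fE 0) (fE k)) by ring.
rewrite E1 mulrDl; congr (_ + _); rewrite /u addrK mulrBl; congr (_ - _).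
by rewrite -fe_mul; ring.
Qed.

Let projE N : proj_seq fE P (sym_range N) f x - 1
  = real_complex R P^-1 * (u (- Posz N) - u (Posz N.+1)).
Proof.
have PC : real_complex R P^-1 * real_complex R P = 1.
  by rewrite -rmorphM mulVf ?gt_eqF.
rewrite -sym_range_telescope mulr_sumr /proj_seq.
rewrite -[X in _ - X]PC.
have -> : real_complex R P = \sum_(k <- sym_range N) ip (fE 0) (fE k) * fe k x.
  rewrite (bigD1_seq 0)/=; [|by elim: N => //= N IH; rewrite !inE IH !orbT|exact: sym_range_uniq].
  rewrite fE_orth eqxx /fexp !mul0r expi0 mulr1 big1 ?addr0// => k k0.
  by rewrite fE_orth eq_sym (negbTE k0) mul0r.
rewrite mulr_sumr -sumrB; apply: eq_bigr => k _.
rewrite -mulrA -mulrBr; congr (_ * _).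
by rewrite /fbasis cut_in// coefE addrAC subrr add0r.
Qed.

(** The boundary terms [u (- N)] and [u (N + 1)] are, up to unimodular factors, coefficients of [h]
    at -N - 1 and N, so they tend to 0. The squared modulus is the form in which Fatou's lemma takes
    the limit. *)
Lemma chernoff_pointwise :
  sqmod (proj_seq fE P (sym_range N) f x) @[N --> \oo] --> (1 : R).
Proof.
pose z N := proj_seq fE P (sym_range N) f x - 1.
have z0 : sqmod (z N) @[N --> \oo] --> (0 : R).
  have H := fourier_coef_cvg0 Lh.
  apply: (@squeeze_cvgr _ _ _ _ (fun=> 0) (fun N => P^-1 ^+ 2 * 2 *
    (sqmod (ip h (fE (Posz N))) + sqmod (ip h (fE (- Posz N.+1)))))).
  - near=> N; rewrite sqmod_ge0/= /z projE sqmodM sqmodC -mulrA.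
    rewrite ler_wpM2l ?sqr_ge0//.
    apply: (le_trans (sqmodB_le2 _ _)).
    rewrite /u !sqmodM !sqmod_expi !mulr1.
    have -> : - Posz N - 1 = - Posz N.+1 by rewrite -opprD -PoszD addn1.
    have -> : Posz N.+1 - 1 = Posz N by rewrite -addn1 PoszD addrK.
    by rewrite -mulrDr [leLHS]mulrC [leRHS]mulrC addrC.
  - exact: cvg_cst.
  - by rewrite -[X in _ --> X](mulr0 (P^-1 ^+ 2 * 2)); apply: cvgM => //; exact: cvg_cst.
have r0 : Re (z N) @[N --> \oo] --> (0 : R).
  apply/cvgr0Pnorm_lt => e e0.
  have e20 : 0 < e ^+ 2 by rewrite exprn_gt0.
  near=> N.
  have H : `|sqmod (z N)| < e ^+ 2 by near: N; move/cvgr0Pnorm_lt: z0; exact.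
  have := Re_le_sqmod (z N); move: H; rewrite ger0_norm ?sqmod_ge0// => h1 h2.
  rewrite ltNge; apply/negP => h3.
  have : e ^+ 2 <= `|Re (z N)| ^+ 2 by rewrite lerXn2r ?nnegrE// ltW.
  by rewrite real_normK ?num_real//; lra.
have -> : (fun N => sqmod (proj_seq fE P (sym_range N) f x))
    = (fun N => 1 + 2 * Re (z N) + sqmod (z N)).
  apply/funext => N; rewrite -[proj_seq _ _ _ _ _](subrK 1) -/(z N) /sqmod !ReImE /=; ring.
rewrite -[X in _ --> X]addr0; apply: cvgD => //.
rewrite -[X in _ --> X]addr0; apply: cvgD; first exact: cvg_cst.
by rewrite -[X in _ --> X](mulr0 2); apply: cvgM => //; exact: cvg_cst.
Unshelve. all: by end_near. Qed.

End pointwise.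
End Chernoff.

Import HBSimple HBNNSimple.

(** * Completeness of the exponentials and Parseval's identity *)

Section FourierSeries.
Variable R : realType.
Local Notation C := (complex R).
Local Notation Re := complex.Re.
Local Notation Im := complex.Im.
Local Notation mu := (@lebesgue_measure R).
Variables (al P : R).
Hypothesis P0 : 0 < P.
Implicit Types f g h : R -> C.
Local Notation I := (`]al, al + P[%classic : set R).
Local Notation fE := (fbasis al P).
Local Notation L2_fE := (L2_fE al P).
Local Notation fE_orth := (fE_orth al P0).
Local Notation defectN N f := (defect fE P (sym_range N) f).

(** Membership in the closed linear span of the exponentials, expressed by symmetric partial
    sums. *)
Definition spanned f := L2 f /\ forall eps : R, 0 < eps -> exists N, defectN N f <= eps.

Lemma defectN_mono N M f : (N <= M)%N -> defectN M f <= defectN N f.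
Proof.
move=> NM; rewrite /defect lerD2l lerN2 ler_wpM2l ?invr_ge0 ?(ltW P0)//.
by apply: sum_sym_range_mono => // m; exact: sqmod_ge0.
Qed.

Lemma spannedD f g : spanned f -> spanned g -> spanned (fun x => f x + g x).
Proof.
move=> [Lf Gf] [Lg Gg]; split; first exact: L2D.
move=> e e0; have e4 : 0 < e / 4 by rewrite divr_gt0.
have [N1 h1] := Gf _ e4; have [N2 h2] := Gg _ e4.
exists (maxn N1 N2).
have := defectD P0 L2_fE fE_orth (sym_range_uniq (maxn N1 N2)) Lf Lg.
have := defectN_mono f (leq_maxl N1 N2); have := defectN_mono g (leq_maxr N1 N2).
lra.
Qed.

Lemma spannedZ c f : spanned f -> spanned (fun x => c * f x).
Proof.
move=> [Lf Gf]; split; first exact: L2Z.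
move=> e e0; have c0 := sqmod_ge0 c.
have k0 : 0 < e / (sqmod c + 1) by rewrite divr_gt0//; lra.
have [N h] := Gf _ k0; exists N; rewrite defectZ//; last exact: L2_fE.
apply: (@le_trans _ _ (sqmod c * (e / (sqmod c + 1)))); first by rewrite ler_wpM2l.
by rewrite mulrA ler_pdivrMr; [nra|lra].
Qed.

Lemma spanned_lim f (F : nat -> R -> C) : L2 f -> (forall n, spanned (F n)) ->
  nrm (fun x => f x - F n x) @[n --> \oo] --> 0 -> spanned f.
Proof.
move=> Lf GF cF; split => // e e0; have e4 : 0 < e / 4 by rewrite divr_gt0.
have [n hn] : exists n, nrm (fun x => f x - F n x) < e / 4.
  have [n _ /(_ n (leqnn n))] := (cvgr0Pnorm_lt _).1 cF _ e4.
  by rewrite /= ger0_norm ?nrm_ge0// => h; exists n.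
have [LF /(_ _ e4)[N hN]] := GF n; exists N.
have := defectD P0 L2_fE fE_orth (sym_range_uniq N) LF (L2B Lf LF).
rewrite (_ : (fun x => _) = f); last by apply/funext => x; rewrite addrC subrK.
have := defect_le fE P0 (sym_range N) (fun x => f x - F n x); lra.
Qed.

Lemma spanned_sum (J : Type) (s : seq J) (F : J -> R -> C) : (forall j, spanned (F j)) ->
  spanned (fun x => \sum_(j <- s) F j x).
Proof.
move=> GF; elim: s => [|j s [L G]].
  under eq_fun do rewrite big_nil; split; first exact: L2_0.
  move=> e e0; exists 0%N; apply: (le_trans (defect_le _ P0 _ _)).
  by rewrite /nrm; under eq_Rintegral do rewrite sqmod0; rewrite /Rintegral integral0/= ltW.
by under eq_fun do rewrite big_cons; apply: spannedD.
Qed.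

Lemma L2_cut1 A : measurable A -> L2 (cut (I `&` A) (fun _ => 1)).
Proof.
move=> mA; apply: (@L2_csupp_bdd _ _ (`|al| + P) 1).
- by apply: cmeasurable_cut; [exact: measurableI|exact: cmeasurable_cst].
- move=> t ht; rewrite cut_out// => -[It _].
  have := csupp_cutI (fun=> 1) ht; rewrite cut_in// => /eqP.
  by rewrite oner_eq0.
- move=> t; rewrite (le_trans (sqmod_cut_le _ _ _))//.
  by rewrite -[X in sqmod X]/(real_complex R 1) sqmodC expr1n.
Qed.

(** If the defect stayed above some e > 0, every partial sum would have squared norm at most nrm f -
    e. The partial sums have modulus tending to 1 wherever f = 1, so Fatou's lemma would bound nrm f
    by nrm f - e. *)
Lemma spanned_ray (p : R) : spanned (cut (I `&` `]p, +oo[%classic) (fun _ => 1)).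
Proof.
set f := cut _ _; have Lf : L2 f by exact: L2_cut1.
split => // e e0; apply: contrapT => nN.
have H N : nrm (proj_seq fE P (sym_range N) f) <= nrm f - e.
  rewrite (nrm_proj_seq P0 L2_fE fE_orth (sym_range_uniq N) Lf).
  have : e < defectN N f by rewrite ltNge; apply/negP => h; apply: nN; exists N.
  by rewrite /defect; lra.
pose u N := fun x => (sqmod (proj_seq fE P (sym_range N) f x))%:E.
have Lp N : L2 (proj_seq fE P (sym_range N) f) by exact: (L2_proj_seq P L2_fE).
have mu_ N : measurable_fun setT (u N).
  by apply/measurable_EFinP; apply: measurable_sqmod; exact: L2_measurable.
have u0 N x : (0 <= u N x)%E by rewrite lee_fin sqmod_ge0.
have F := @fatou _ _ _ mu setT measurableT u mu_ (fun N x _ => u0 N x).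
have E1 : (\int[mu]_x (sqmod (f x))%:E <= \int[mu]_x limn_einf (u^~ x))%E.
  apply: ge0_le_integral => //.
  - by move=> x _; rewrite lee_fin sqmod_ge0.
  - by apply/measurable_EFinP; apply: measurable_sqmod; exact: L2_measurable.
  - apply: measurableT_comp => //; apply: measurable_fun_limn_esup => N.
    by apply: (@measurableT_comp _ _ _ _ _ _ -%E _ (u N)).
  - move=> x _; have [[Ix /= px]|nJ] := pselect ((I `&` `]p, +oo[%classic) x).
      have px' : p < x by move: px; rewrite in_itv/= andbT.
      have c1 := chernoff_pointwise P0 px' Ix.
      have -> : limn_einf (u^~ x) = 1%:E.
        by apply: (cvg_limn_einf_sup _).1; apply: cvg_EFin; [exact: nearW|exact: c1].
      rewrite lee_fin (le_trans (sqmod_cut_le _ _ _))//.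
      by rewrite -[X in sqmod X]/(real_complex R 1) sqmodC expr1n.
    rewrite /f cut_out// sqmod0 limn_einf_lim; apply: lime_ge; first exact: is_cvg_einfs.
    by near=> N; apply: le_ereal_inf_tmp => _ [k _ <-].
have E2 : (limn_einf (fun N => \int[mu]_x u N x) <= (nrm f - e)%:E)%E.
  rewrite limn_einf_lim; apply: lime_le; first exact: is_cvg_einfs.
  near=> N; apply: (@le_trans _ _ (\int[mu]_x u N x)%E).
    by apply: ereal_inf_lbound; exists N => /=.
  by have := l2sqE (Lp N); rewrite /l2sq /u => ->; rewrite lee_fin.
have := le_trans E1 (le_trans F E2).
by have := l2sqE Lf; rewrite /l2sq => ->; rewrite lee_fin; lra.
Unshelve. all: by end_near. Qed.

(** Open half-lines generate the Borel sets and are stable under intersection. The sets with spanned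
    indicator form a lambda-system: complements use linearity, disjoint unions use closedness. *)
Lemma spanned_indic A : measurable A -> spanned (cut (I `&` A) (fun _ => 1)).
Proof.
have spannedT : spanned (cut (I `&` setT) (fun _ => 1)).
  rewrite (_ : I `&` setT = I `&` `]al, +oo[%classic); first exact: spanned_ray.
  apply/seteqP; split => x [Ix _]; split => //.
  by move: Ix; rewrite /= !in_itv/= andbT => /andP[].
rewrite [measurable]RGenOInfty.measurableE.
apply: (@dynkin_induction _ (measurableTypeR R) (@RGenOInfty.G R)
  (fun A => spanned (cut (I `&` A) (fun _ => 1)))).
- exact: RGenOInfty.measurableE.
- move=> _ _ [x ->] [y ->]; exists (Num.max x y).
  by apply/seteqP; split => t; rewrite /= !in_itv/= !andbT gt_max => /andP.
- exact: spannedT.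
- by move=> _ [x ->]; exact: spanned_ray.
- move=> S _ GS; have := spannedD spannedT (spannedZ (-1) GS); congr spanned; apply/funext => x.
  have [Ix|Ix] := pselect (I x); last by rewrite !cut_out ?mulr0 ?addr0// => -[].
  have [Sx|Sx] := pselect (S x).
    by rewrite [RHS]cut_out ?cut_in ?mulr1 ?subrr//; case.
  by rewrite [X in _ + _ * X]cut_out ?cut_in ?mulr0 ?addr0// => -[].
- move=> F mF tF GF.
  set U := \bigcup_k F k.
  have mU : measurable U by exact: bigcup_measurable.
  (* The complement of [U] is added so that the sets exhaust the line, as [nrm_sub_cut_cvg0]
     requires; it does not affect the indicator of [U]. *)
  pose An n : set R := (\big[setU/set0]_(k < n) F k) `|` ~` U.
  apply: (@spanned_lim _ (fun n x => \sum_(k < n) cut (I `&` F k) (fun _ => 1) x)).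
  + exact: L2_cut1.
  + by move=> n; exact: spanned_sum.
  rewrite (_ : (fun n => nrm _) =
    fun n => nrm (fun x => cut (I `&` U) (fun _ => 1) x - cut (An n) (cut (I `&` U) (fun _ => 1)) x)).
    apply: nrm_sub_cut_cvg0.
    * move=> n; apply: measurableU; last exact: measurableC.
      apply: bigsetU_measurable => k _; exact: mF.
    * exact: L2_cut1.
    * move=> x; have [[k _ Fk]|Ux] := pselect (U x); last by near=> n; right.
      near=> n; left; rewrite -bigcup_mkord; exists k => //=.
      by near: n; exists k.+1.
  apply/funext => n; congr nrm; apply/funext => x; congr (_ - _).
  have [Ix|Ix] := pselect (I x); last first.
    rewrite big1; last by move=> k _; rewrite cut_out// => -[].
    by rewrite [RHS]cut_eq0// cut_out// => -[].
  have [[k kn Fk]|nF] := pselect ((\bigcup_(k in `I_n) F k) x).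
    rewrite [RHS]cut_in; last by left; rewrite -bigcup_mkord; exists k.
    rewrite [RHS]cut_in; last by split => //; exists k.
    rewrite (bigD1 (Ordinal kn))//= cut_in//= big1 ?addr0// => j jk.
    rewrite cut_out// => -[_ Fj].
    have jk' : (j : nat) != k by apply: contra jk => /eqP h; apply/eqP/val_inj.
    have : (F j `&` F k) x by split.
    by rewrite ((trivIsetP.1 tF) j k Logic.I Logic.I jk').
  rewrite big1; last first.
    by move=> k _; rewrite cut_out// => -[_ Fk]; apply: nF; exists k => /=.
  have [Ux|Ux] := pselect (U x).
    by rewrite cut_out// => -[|//]; rewrite -bigcup_mkord.
  by rewrite cut_in; [rewrite cut_out// => -[]|right].
Unshelve. all: by end_near. Qed.

Lemma spanned_nonneg (v : R -> R) : measurable_fun setT v -> (forall x, 0 <= v x) ->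
  L2 (fun x => real_complex R (v x)) -> spanned (cut I (fun x => real_complex R (v x))).
Proof.
move=> mv v0 Lv.
have mE : measurable_fun setT (EFin \o v) by exact/measurable_EFinP.
have [g [gnd gcv]] := approximation measurableT mE (fun t _ => v0 t).
have gle n x : g n x <= v x.
  have ndx : {homo (fun n => g n x) : a b / (a <= b)%N >-> a <= b}.
    by move=> a b ab; move/lefP: (gnd _ _ ab).
  have cx : (fun n => g n x) @ \oo --> v x by have := gcv x Logic.I => /fine_cvg.
  rewrite -(cvg_lim _ cx)//.
  by apply: nondecreasing_cvgn_le => //; apply/cvg_ex; exists (v x).
apply: (@spanned_lim _ (fun n => cut I (fun x => real_complex R (g n x)))).
- exact: L2_cut.
- move=> n.
  suff -> : cut I (fun x => real_complex R (g n x)) = (fun x =>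
      \sum_(y <- finmap.enum_fset (fset_set (range (g n))))
        real_complex R y * cut (I `&` (g n @^-1` [set y])) (fun _ => 1) x).
    by apply: spanned_sum => y; apply: spannedZ; exact: spanned_indic.
  apply/funext => x; rewrite /cut.
  have -> : g n x = \sum_(y <- finmap.enum_fset (fset_set (range (g n))))
      y * \1_(g n @^-1` [set y]) x by rewrite [LHS]fimfunE fsbig_finite.
  rewrite rmorph_sum mulr_sumr.
  apply: eq_bigr => y _; rewrite mulr1 rmorphM/= mulrCA; congr (_ * _).
  by rewrite -rmorphM/= indicI.
- apply: (@nrm_cvg0 _ _ (fun x => sqmod (real_complex R (v x)))).
  + move=> n; apply: cmeasurableD; last apply: cmeasurableN.
      by apply: L2_measurable; exact: L2_cut.
    by apply: cmeasurable_cut => //; exact: cmeasurable_real.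
  + exact: L2_integrable.
  + move=> n x; have [Ix|Ix] := pselect (I x); last first.
      by rewrite !cut_out// subrr sqmod0 sqmod_ge0.
    rewrite !cut_in// -rmorphB/= !sqmodC.
    have g0 : 0 <= g n x by [].
    by have := gle n x; have := v0 x; nra.
  + move=> x; have [Ix|Ix] := pselect (I x); last first.
      by under eq_fun do rewrite !cut_out// subrr sqmod0; exact: cvg_cst.
    under eq_fun do rewrite !cut_in// -rmorphB/= !sqmodC.
    have cx : (fun n => g n x) @ \oo --> v x by have := gcv x Logic.I => /fine_cvg.
    have c0 : (v x - g n x) @[n --> \oo] --> (0 : R).
      by rewrite -(subrr (v x)); apply: cvgB => //; exact: cvg_cst.
    rewrite -(mulr0 (0 : R)); under eq_fun do rewrite expr2.
    exact: cvgM.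
Qed.

Lemma spanned_L2 f : L2 f -> spanned (cut I f).
Proof.
move=> Lf; have [m1 m2] := L2_measurable Lf.
pose pp (v : R -> R) x := (`|v x| + v x) / 2.
pose pn (v : R -> R) x := (`|v x| - v x) / 2.
have H (v : R -> R) : measurable_fun setT v -> (forall x, v x ^+ 2 <= sqmod (f x)) ->
    spanned (cut I (fun x => real_complex R (v x))).
  move=> mv vle.
  have mn : measurable_fun setT (fun x => `|v x|) by exact: measurableT_comp.
  have b x : `|v x| ^+ 2 <= sqmod (f x) by rewrite real_normK ?num_real.
  have n1 x := ler_norm (v x).
  have n2 x : - v x <= `|v x| by rewrite -normrN ler_norm.
  have G1 : spanned (cut I (fun x => real_complex R (pp v x))).
    have mp : measurable_fun setT (pp v) by apply: measurable_funM => //; exact: measurable_funD.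
    apply: spanned_nonneg => //.
      by move=> x; rewrite /pp; have := n1 x; have := n2 x; lra.
    apply: (L2_le (cmeasurable_real mp) _ (L2_integrable Lf)) => x.
    by rewrite sqmodC /pp; have := b x; have := vle x; have := n1 x; have := n2 x; nra.
  have G2 : spanned (cut I (fun x => real_complex R (pn v x))).
    have mp : measurable_fun setT (pn v) by apply: measurable_funM => //; exact: measurable_funB.
    apply: spanned_nonneg => //.
      by move=> x; rewrite /pn; have := n1 x; have := n2 x; lra.
    apply: (L2_le (cmeasurable_real mp) _ (L2_integrable Lf)) => x.
    by rewrite sqmodC /pn; have := b x; have := vle x; have := n1 x; have := n2 x; nra.
  have := spannedD G1 (spannedZ (-1) G2); congr spanned; apply/funext => x.
  rewrite /cut mulN1r -mulrBr; congr (_ * _).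
  by rewrite -rmorphB; congr (real_complex R _); rewrite /pp /pn; field.
have G1 := H _ m1 (fun x => Re_le_sqmod (f x)).
have G2 := H _ m2 (fun x => Im_le_sqmod (f x)).
have := spannedD G1 (spannedZ imagi G2); congr spanned; apply/funext => x.
rewrite /cut mulrCA -mulrDr; congr (_ * _).
by apply: complexP; rewrite !ReImE; ring.
Qed.

(** Bessel's inequality is one half; the other says that the defect can be made as small as
    desired. *)
Theorem fourier_parseval f : L2 f -> (forall x, ~ I x -> f x = 0) ->
  (\esum_(m in [set: int]) (sqmod (ip f (fE m)))%:E = (P * nrm f)%:E)%E.
Proof.
move=> Lf fI; apply/eqP; rewrite eq_le (esum_bessel P0 L2_fE fE_orth)//=.
have -> : f = cut I f.
  apply/funext => x; have [Ix|Ix] := pselect (I x); first by rewrite cut_in.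
  by rewrite cut_out// fI.
have [_ G] := spanned_L2 Lf.
apply/lee_addgt0Pr => e e0.
have [N hN] := G (e / P) (divr_gt0 e0 P0).
apply: le_trans (leeD2r _ (le_sum_esum (sym_range_uniq N) (fun m => sqmod_ge0 _))).
rewrite -EFinD lee_fin.
have := ler_wpM2l (ltW P0) hN; rewrite /defect mulrBr mulVKf ?gt_eqF//.
by rewrite mulrCA divff ?gt_eqF// mulr1; lra.
Qed.

End FourierSeries.

(** * Plancherel for functions of bounded support *)

Section Tile.
Variable R : realType.
Local Notation mu := (@lebesgue_measure R).

Lemma esum_single (T : choiceType) (a : T -> \bar R) (t : T) : (0 <= a t)%E ->
  (forall i, i != t -> a i = 0%E) -> (\esum_(i in [set: T]) a i = a t)%E.
Proof.
move=> a0 az.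
have ag i : (0 <= a i)%E by have [->//|/az->] := eqVneq i t.
rewrite (esumID [set t])// setTI esum_set1// esum1 ?adde0//.
by move=> i [_ /= it]; apply: az; apply/eqP.
Qed.

(** The translates of [0, p[ by multiples of p partition the line, and x lies in the one numbered
    floor(x / p). So the integrand is a sum with a single nonzero term, and summation commutes with
    the integral. *)
Lemma ge0_integral_tile (p : R) (phi : R -> \bar R) : 0 < p -> measurable_fun setT phi ->
  (forall x, (0 <= phi x)%E) ->
  (\int[mu]_x phi x =
   \esum_(m in [set: int]) \int[mu]_(x in `[0%R, p[%classic) phi (x + m%:~R * p)%R)%E.
Proof.
move=> p0 mphi phi0.
pose T : set R := `[0%R, p[%classic.
pose F (m : int) (x : R) := ((\1_T (x - m%:~R * p) : R)%:E * phi x)%E.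
have F0 m x : (0 <= F m x)%E.
  apply: mule_ge0; last exact: phi0.
  by rewrite lee_fin indicE ler0n.
have m1 (m : int) : measurable_fun setT (fun x : R => (\1_T (x - m%:~R * p) : R)%:E).
  apply/measurable_EFinP.
  have mT : measurable_fun setT (\1_T : R -> R).
    by apply: measurable_indic; exact: measurable_itv.
  have mB : measurable_fun setT (fun x : R => x - m%:~R * p) by exact: measurable_funB.
  exact: (measurableT_comp mT mB).
have mF m : measurable_fun setT (F m) by exact: emeasurable_funM.
transitivity (\int[mu]_x (\esum_(m in [set: int]) F m x))%E.
  apply: eq_integral => x _; pose m0 := Num.floor (x / p).
  rewrite (@esum_single _ _ m0)// /F.
    have h1 := ge_floor (x / p); have h2 := lt_succ_floor (x / p).
    rewrite indicE mem_set ?mul1e// /T /= in_itv/= subr_ge0 ltrBlDr.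
    rewrite ler_pdivlMr// in h1; rewrite ltr_pdivrMr// -/m0 in h2.
    by rewrite h1 (lt_le_trans h2)// intrD mulrDl mul1r addrC.
  move=> m; apply: contraNeq; rewrite indicE.
  have [|_] := boolP (_ \in T); last by rewrite mul0e eqxx.
  rewrite /T mem_setE/= in_itv/= subr_ge0 ltrBlDr => /andP[h1 h2] _.
  apply/eqP; rewrite /m0; apply/esym/floor_def.
  by rewrite ler_pdivlMr// h1 ltr_pdivrMr// intrD mulrDl mul1r addrC.
rewrite ge0_integral_esum_int//; apply: eq_esum => m _.
rewrite -(@ge0_integral_shift _ (m%:~R * p) (F m))// [RHS]integral_mkcond.
apply: eq_integral => x _; rewrite /F addrK patchE indicE.
by rewrite -/T; case: (x \in T); rewrite ?mul1e ?mul0e.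
Qed.

End Tile.

Section FourierTransform.
Variable R : realType.
Local Notation C := (complex R).
Local Notation Re := complex.Re.
Local Notation Im := complex.Im.
Local Notation mu := (@lebesgue_measure R).
Implicit Types f g h : R -> C.

(** [s = -1] gives the Fourier transform and [s = 1] its inverse, as plain integrals, meant for
    functions of bounded support. *)
Definition ft (s : R) f : R -> C := fun w => cint setT (fun t => f t * expi (s * t * w)).

Lemma trunc_FTE s f N : trunc_FT s f N = ft s (cut `[- N%:R, N%:R]%classic f).
Proof.
apply/funext => w; rewrite /trunc_FT cint_cut /ft; apply: eq_cint => t.
by rewrite /cut mulrA.
Qed.

Lemma measurable_phase (s w : R) : measurable_fun setT (fun t : R => s * t * w).
Proof. by apply: measurable_funM => //; exact: measurable_funM. Qed.

Lemma cintegrable_ft s f M w : L2 f -> csupp M f ->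
  cintegrable (fun t => f t * expi (s * t * w)).
Proof.
move=> Lf fM; apply: (cintegrable_csupp Lf fM (B := 1)).
  by apply: cmeasurable_expi; exact: measurable_phase.
by move=> x; rewrite sqmod_expi.
Qed.

Lemma cintegrable_L2csupp f M : L2 f -> csupp M f -> cintegrable f.
Proof.
move=> Lf fM; have := cintegrable_ft 0 0 Lf fM; congr cintegrable; apply/funext => x.
by rewrite mulr0 expi0 mulr1.
Qed.

(** A submultiplicative size for complex numbers that needs no square root; it serves to dominate
    integrands. *)
Definition abs1 (z : C) : R := `|Re z| + `|Im z|.

Lemma abs1_ge0 z : 0 <= abs1 z. Proof. by rewrite addr_ge0. Qed.

Lemma abs1M z w : abs1 (z * w) <= abs1 z * abs1 w.
Proof.
rewrite /abs1 !ReImE mulrDl !mulrDr -!normrM.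
have := ler_normB (Re z * Re w) (Im z * Im w).
have := ler_normD (Re z * Im w) (Im z * Re w); lra.
Qed.

Lemma Re_le_abs1 z : `|Re z| <= abs1 z. Proof. by rewrite lerDl. Qed.
Lemma Im_le_abs1 z : `|Im z| <= abs1 z. Proof. by rewrite lerDr. Qed.

Lemma abs1_expi s : abs1 (expi s) <= 2.
Proof.
rewrite /abs1 /expi/= -[2]/(1 + 1); apply: lerD; rewrite ler_norml.
  by rewrite cos_geN1 cos_le1.
by rewrite sin_geN1 sin_le1.
Qed.

Lemma integrable_abs1 f : cintegrable f -> mu.-integrable setT (EFin \o (fun x => abs1 (f x))).
Proof.
move=> [f1 f2]; apply: integrableRD; exact: integrable_norm.
Qed.

Lemma continuous_expiM (z : C) (k : R) :
  continuous (fun w => Re (z * expi (k * w))) /\ continuous (fun w => Im (z * expi (k * w))).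
Proof.
have cc : continuous (fun w : R => cos (2 * pi * (k * w))).
  move=> w; apply: continuous_comp; last exact: continuous_cos.
  by apply: cvgM; [exact: cvg_cst|exact: mulrl_continuous].
have cs : continuous (fun w : R => sin (2 * pi * (k * w))).
  move=> w; apply: continuous_comp; last exact: continuous_sin.
  by apply: cvgM; [exact: cvg_cst|exact: mulrl_continuous].
have E1 : (fun w => Re (z * expi (k * w))) =
    fun w => Re z * cos (2 * pi * (k * w)) - Im z * sin (2 * pi * (k * w)).
  by apply/funext => w; rewrite ReM.
have E2 : (fun w => Im (z * expi (k * w))) =
    fun w => Re z * sin (2 * pi * (k * w)) + Im z * cos (2 * pi * (k * w)).
  by apply/funext => w; rewrite ImM.
rewrite E1 E2; split => w.
- by apply: cvgB; (apply: cvgM; [exact: cvg_cst|]); [exact: cc|exact: cs].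
- by apply: cvgD; (apply: cvgM; [exact: cvg_cst|]); [exact: cs|exact: cc].
Qed.

(** The transform is in fact continuous, the integrand being dominated independently of the
    frequency. *)
Lemma cmeasurable_ft s f M : L2 f -> csupp M f -> cmeasurable (ft s f).
Proof.
move=> Lf fM.
have ia := integrableRZ 2 (integrable_abs1 (cintegrable_L2csupp Lf fM)).
have b t w : abs1 (f t * expi (s * t * w)) <= 2 * abs1 (f t).
  by rewrite (le_trans (abs1M _ _))// mulrC ler_wpM2r ?abs1_ge0 ?abs1_expi.
have xin (w : R) : w \in `]w - 1, w + 1[%classic.
  by rewrite mem_setE/= in_itv/= ltrDl ltrBlDr ltrDl ltr01.
split; apply: continuous_measurable_fun => w; rewrite /ft.
- apply: (@continuity_under_integral _ _ _ mu (fun w t => Re (f t * expi (s * t * w))) setT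
    measurableT (w - 1) (w + 1) _ _ _ ia _ w (xin w)).
  + by move=> v _; have [] := cintegrable_ft s v Lf fM.
  + apply: aeW => t _ v _.
    have [c _] := continuous_expiM (f t) (s * t); exact: c.
  + by move=> v _; apply: aeW => t _; exact: le_trans (Re_le_abs1 _) (b t v).
- apply: (@continuity_under_integral _ _ _ mu (fun w t => Im (f t * expi (s * t * w))) setT
    measurableT (w - 1) (w + 1) _ _ _ ia _ w (xin w)).
  + by move=> v _; have [] := cintegrable_ft s v Lf fM.
  + apply: aeW => t _ v _.
    have [_ c] := continuous_expiM (f t) (s * t); exact: c.
  + by move=> v _; apply: aeW => t _; exact: le_trans (Im_le_abs1 _) (b t v).
Qed.

(** Samples of the transform at spacing 1 / P are the Fourier coefficients of a modulation of [f] on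
    an interval of length P = 2 (M + 1). The extra 1 keeps the support inside the open interval and
    P positive when M = 0. *)
Lemma ft_sampled s f M th : s ^+ 2 = 1 -> 0 <= M -> L2 f -> csupp M f ->
  (\esum_(m in [set: int])
     (sqmod (ft s f (th - s * m%:~R / (2 * (M + 1)))%R))%:E = (2 * (M + 1) * nrm f)%:E)%E.
Proof.
move=> s1 M0 Lf fM; set P := 2 * (M + 1).
have P0 : 0 < P by rewrite /P; lra.
pose ft_ t := expi (s * t * th) * f t.
have Lft : L2 ft_.
  apply: (@L2_bdd_mul _ _ _ 1) => //; last by move=> x; rewrite sqmod_expi.
  by apply: cmeasurable_expi; exact: measurable_phase.
have alP : - (M + 1) + P = M + 1 by rewrite /P; ring.
have out x : ~ (`]- (M + 1), - (M + 1) + P[%classic : set R) x -> f x = 0.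
  rewrite alP /= in_itv/= -ltr_norml => h; apply: fM.
  by move/negP: h; rewrite -leNgt; lra.
have := @fourier_parseval R (- (M + 1)) P P0 ft_ Lft.
have -> : nrm ft_ = nrm f.
  by apply: eq_Rintegral => x _; rewrite sqmodM sqmod_expi mul1r.
move=> <-; last by move=> x /out fx; rewrite /ft_ fx mulr0.
apply: eq_esum => m _; congr (_%:E); congr sqmod; rewrite ip_fE cint_cut /ft.
apply: eq_cint => t; have [It|It] := pselect ((`]- (M + 1), - (M + 1) + P[%classic : set R) t).
  rewrite cut_in// /ft_ /fexp [RHS]mulrAC -expiD [LHS]mulrC; congr (expi _ * _).
  rewrite intrN mulrBr; congr (_ + _).
  have -> : s * t * (s * m%:~R / P) = s ^+ 2 * (t * m%:~R / P) by ring.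
  by rewrite s1; ring.
by rewrite cut_out// out// mul0r.
Qed.

(** Plancherel: cutting the frequency line into cells of length 1 / P and exchanging sum and
    integral leaves the constant P nrm f of [ft_sampled], integrated over one cell. *)
Lemma l2sq_ft s f M : s ^+ 2 = 1 -> 0 <= M -> L2 f -> csupp M f ->
  l2sq (ft s f) = (nrm f)%:E.
Proof.
move=> s1 M0 Lf fM; set P := 2 * (M + 1).
have P0 : 0 < P by rewrite /P; lra.
have V0 : 0 < P^-1 by rewrite invr_gt0.
have mft := cmeasurable_ft s Lf fM.
have mphi : measurable_fun setT (fun w => (sqmod (ft s f w))%:E).
  by apply/measurable_EFinP; exact: measurable_sqmod.
rewrite /l2sq (ge0_integral_tile V0)//; last by move=> x; rewrite lee_fin sqmod_ge0.
have ms (m : int) : measurable_fun `[0, P^-1[%classic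
    (fun x : R => (sqmod (ft s f (x + m%:~R * P^-1)))%:E).
  apply: measurable_funTS; apply/measurable_EFinP.
  have mB : measurable_fun setT (fun x : R => x + m%:~R * P^-1) by exact: measurable_funD.
  exact: (measurableT_comp (measurable_sqmod mft) mB).
rewrite -(@ge0_integral_esum_int _ _ (fun m x => (sqmod (ft s f (x + m%:~R * P^-1)))%:E))//; last first.
  by move=> m x; rewrite lee_fin sqmod_ge0.
transitivity (\int[mu]_(x in `[0%R, (P^-1)%R[%classic) (P * nrm f)%R%:E)%E.
  apply: eq_integral => x _; rewrite -(ft_sampled x s1 M0 Lf fM) -/P.
  (* For [s = 1] the samples run in the opposite direction, so m is negated. *)
  have /orP[/eqP sE|/eqP sE] : (s == 1) || (s == -1) by rewrite -sqrf_eq1 s1.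
    rewrite (@reindex_esumT _ _ _ (fun m : int => - m)); last first.
      by exists (fun m : int => - m) => m; rewrite opprK.
    by apply: eq_esum => m _; rewrite sE intrN mul1r mulNr.
  by apply: eq_esum => m _; rewrite sE mulN1r mulNr opprK.
rewrite integral_cst//= lebesgue_measure_itv/= lte_fin V0 sube0 -EFinM.
by congr EFin; field; rewrite gt_eqF.
Qed.

Lemma L2_ft s f M : s ^+ 2 = 1 -> 0 <= M -> L2 f -> csupp M f -> L2 (ft s f).
Proof.
move=> s1 M0 Lf fM; have [m1 m2] := cmeasurable_ft s Lf fM.
by split => //; split => //; have := l2sq_ft s1 M0 Lf fM; rewrite /l2sq => ->; rewrite ltry.
Qed.

Lemma nrm_ft s f M : s ^+ 2 = 1 -> 0 <= M -> L2 f -> csupp M f -> nrm (ft s f) = nrm f.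
Proof.
move=> s1 M0 Lf fM; have := l2sq_ft s1 M0 Lf fM.
by rewrite l2sqE; [case|exact: (L2_ft s1 M0 Lf fM)].
Qed.

Lemma ftD s f g M : L2 f -> csupp M f -> L2 g -> csupp M g ->
  ft s (fun x => f x + g x) = fun w => ft s f w + ft s g w.
Proof.
move=> Lf fM Lg gM; apply/funext => w; rewrite /ft -cintD.
- by apply: eq_cint => t; rewrite mulrDl.
- exact: cintegrable_ft fM.
- exact: cintegrable_ft gM.
Qed.

Lemma ftZ s c f M : L2 f -> csupp M f -> ft s (fun x => c * f x) = fun w => c * ft s f w.
Proof.
move=> Lf fM; apply/funext => w; rewrite /ft -cintZ; last exact: cintegrable_ft fM.
by apply: eq_cint => t; rewrite mulrA.
Qed.

Lemma csuppD M f g : csupp M f -> csupp M g -> csupp M (fun x => f x + g x).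
Proof. by move=> fM gM x hx; rewrite fM// gM// addr0. Qed.

Lemma csuppZ M c f : csupp M f -> csupp M (fun x => c * f x).
Proof. by move=> fM x hx; rewrite fM// mulr0. Qed.

(** Polarization: the norm of f + g gives the real part of the inner product, and replacing g by i g
    gives the imaginary part. *)
Lemma ip_ft s f g M : s ^+ 2 = 1 -> 0 <= M -> L2 f -> csupp M f -> L2 g -> csupp M g ->
  ip (ft s f) (ft s g) = ip f g.
Proof.
move=> s1 M0 Lf fM Lg gM.
have LF := L2_ft s1 M0 Lf fM.
have H h : L2 h -> csupp M h -> Re (ip (ft s f) (ft s h)) = Re (ip f h).
  move=> Lh hM; have LH := L2_ft s1 M0 Lh hM.
  have := nrm_ft s1 M0 (L2D Lf Lh) (csuppD fM hM).
  rewrite (ftD s Lf fM Lh hM) !nrmD// (nrm_ft s1 M0 Lf fM) (nrm_ft s1 M0 Lh hM); lra.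
have LG := L2_ft s1 M0 Lg gM.
apply: complexP; first exact: H.
have := H _ (L2Z imagi Lg) (csuppZ imagi gM).
rewrite (ftZ s imagi Lg gM) !ipZr// !ReImE; lra.
Qed.

End FourierTransform.

(** * Fubini's theorem and the duality of the two transforms *)

Section FubiniC.
Variable R : realType.
Local Notation C := (complex R).
Local Notation Re := complex.Re.
Local Notation Im := complex.Im.
Local Notation T := (measurableTypeR R).
Local Notation mu := (@lebesgue_measure R).
Implicit Types f g h : R -> C.

Lemma Rintegral_fubini (h : T * T -> R) (F G : R -> R) : measurable_fun setT h ->
  mu.-integrable setT (EFin \o F) -> mu.-integrable setT (EFin \o G) ->
  (forall t, 0 <= F t) -> (forall w, 0 <= G w) ->
  (forall t w, `|h (t, w)| <= F t * G w) ->
  Rintegral mu setT (fun w => Rintegral mu setT (fun t => h (t, w))) =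
  Rintegral mu setT (fun t => Rintegral mu setT (fun w => h (t, w))).
Proof.
move=> mh iF iG F0 G0 hb.
have mG : measurable_fun setT (EFin \o G) by case/integrableP: iG.
have mF : measurable_fun setT (EFin \o F) by case/integrableP: iF.
have sl t : mu.-integrable setT (EFin \o (fun w => h (t, w))).
  apply: (le_integrableR _ (hb t)); last exact: integrableRZ.
  exact: (measurableT_comp mh (pair1_measurable t)).
have sr w : mu.-integrable setT (EFin \o (fun t => h (t, w))).
  apply: (@le_integrableR _ _ (fun t => G w * F t)).
  - exact: (measurableT_comp mh (pair2_measurable w)).
  - by move=> t; rewrite mulrC.
  - exact: integrableRZ.
have Fc : (\int[mu]_t (F t)%:E)%E = (Rintegral mu setT F)%:E.
  by rewrite fineK//; exact: integrable_fin_num.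
have Gc : (\int[mu]_t (G t)%:E)%E = (Rintegral mu setT G)%:E.
  by rewrite fineK//; exact: integrable_fin_num.
have i12 : (mu \x mu)%E.-integrable setT (EFin \o h).
  have mE : measurable_fun setT (EFin \o h) by exact/measurable_EFinP.
  apply: (proj2 (@integrable12ltyP _ _ T T R mu mu (EFin \o h) mE)).
  have mA : measurable_fun setT (abse \o (EFin \o h)) by exact: measurableT_comp.
  apply: (@le_lt_trans _ _ (\int[mu]_t ((Rintegral mu setT G * F t)%R%:E))%E); last first.
    under eq_integral do rewrite EFinM.
    rewrite ge0_integralZl//; first by rewrite Fc -EFinM ltry.
      by move=> t _; rewrite lee_fin.
    by rewrite lee_fin; apply: Rintegral_ge0.
  apply: ge0_le_integral => //.
  - by move=> t _; exact: integral_ge0.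
  - by apply: (@measurable_fun_fubini_tonelli_F _ _ T T R mu (abse \o (EFin \o h))) => // p; exact: abse_ge0.
  - by apply/measurable_EFinP; apply: measurable_funM => //; exact/measurable_EFinP.
  - move=> t _; rewrite EFinM -Gc -ge0_integralZr//; last 2 first.
    + by move=> w _; rewrite lee_fin.
    + by rewrite lee_fin.
    apply: ge0_le_integral => //.
    + apply: (measurableT_comp mA); exact: pair1_measurable.
    + by apply: emeasurable_funM.
    + by move=> w _ /=; rewrite -EFinM lee_fin mulrC hb.
rewrite /Rintegral; apply: (congr1 fine).
rewrite (eq_integral (fun w => \int[mu]_t (h (t, w))%:E)%E); last first.
  by move=> w _; rewrite fineK//; exact: (integrable_fin_num _ (sr w)).
rewrite [RHS](eq_integral (fun t => \int[mu]_w (h (t, w))%:E)%E); last first.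
  by move=> t _; rewrite fineK//; exact: (integrable_fin_num _ (sl t)).
by have := Fubini i12 => /= ->.
Qed.

Lemma measurable_prod_funs (f g : R -> C) (s : R) :
  cmeasurable f -> cmeasurable g ->
  let H := fun p : T * T => conjc (g p.2) * (f p.1 * expi (s * p.1 * p.2)) in
  measurable_fun setT (fun p => Re (H p)) /\ measurable_fun setT (fun p => Im (H p)).
Proof.
move=> [f1 f2] [g1 g2] H.
have m1 : measurable_fun setT (fun p : T * T => p.1) by exact: measurable_fst.
have m2 : measurable_fun setT (fun p : T * T => p.2) by exact: measurable_snd.
have a1 := measurableT_comp f1 m1; have a2 := measurableT_comp f2 m1.
have b1 := measurableT_comp g1 m2; have b2 := measurableT_comp g2 m2.
have ph : measurable_fun setT (fun p : T * T => s * p.1 * p.2 : R).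
  by apply: measurable_funM => //; exact: measurable_funM.
have [x1 x2] : cmeasurable (fun t : R => expi t) by apply: cmeasurable_expi.
have e1 := measurableT_comp x1 ph; have e2 := measurableT_comp x2 ph.
rewrite /H; split.
- under eq_fun do rewrite !(ReM, ImM, ReJ, ImJ).
  apply: measurable_funB; apply: measurable_funM => //.
  + by apply: measurable_funB; apply: measurable_funM.
  + exact: measurable_funN.
  + by apply: measurable_funD; apply: measurable_funM.
- under eq_fun do rewrite !(ReM, ImM, ReJ, ImJ).
  apply: measurable_funD; apply: measurable_funM => //.
  + by apply: measurable_funD; apply: measurable_funM.
  + exact: measurable_funN.
  + by apply: measurable_funB; apply: measurable_funM.
Qed.

(** Both sides are double integrals of f(t) conj(g(w)) e(s t w), which is dominated by a product of
    integrable functions. Together with [ip_ft] this replaces Fourier inversion. *)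
Lemma ip_ft_dual s f g M : s ^+ 2 = 1 -> 0 <= M -> L2 f -> csupp M f -> L2 g -> csupp M g ->
  ip (ft s f) g = ip f (ft (- s) g).
Proof.
move=> s1 M0 Lf fM Lg gM.
pose H (p : T * T) := conjc (g p.2) * (f p.1 * expi (s * p.1 * p.2)).
have [mR mI] := measurable_prod_funs s (L2_measurable Lf) (L2_measurable Lg).
have iF := integrable_abs1 (cintegrable_L2csupp Lf fM).
have iG := integrableRZ 2 (integrable_abs1 (cintegrable_L2csupp Lg gM)).
have F0 t := abs1_ge0 (f t).
have G0 w : 0 <= 2 * abs1 (g w) by rewrite mulr_ge0 ?abs1_ge0.
have hb t w : abs1 (H (t, w)) <= abs1 (f t) * (2 * abs1 (g w)).
  rewrite /H/=; apply: (le_trans (abs1M _ _)).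
  have -> : abs1 (conjc (g w)) = abs1 (g w) by rewrite /abs1 ReJ ImJ normrN.
  rewrite [leRHS]mulrCA [leRHS]mulrA mulrC; apply: ler_wpM2r; first exact: abs1_ge0.
  apply: (le_trans (abs1M _ _)); rewrite mulrC.
  by apply: ler_wpM2r; [exact: abs1_ge0|exact: abs1_expi].
transitivity (cint setT (fun w => cint setT (fun t => H (t, w)))).
  rewrite /ip; apply: eq_cint => w; rewrite /H /= cintZ; last exact: cintegrable_ft fM.
  by rewrite mulrC.
transitivity (cint setT (fun t => cint setT (fun w => H (t, w)))); last first.
  rewrite /ip; apply: eq_cint => t; rewrite /ft -cintJ; last exact: cintegrable_ft gM.
  rewrite -cintZ; last first.
    have := cintegrable_ft (- s) t Lg gM => -[i1 i2]; split.
      by under eq_fun do rewrite ReJ.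
    under eq_fun do rewrite ImJ -mulN1r; exact: integrableRZ.
  apply: eq_cint => w; rewrite /H /= conjcM expiJ mulrCA; congr (_ * (_ * expi _)).
  by ring.
apply: complexP.
- exact: (Rintegral_fubini mR iF iG F0 G0 (fun t w => le_trans (Re_le_abs1 _) (hb t w))).
- exact: (Rintegral_fubini mI iF iG F0 G0 (fun t w => le_trans (Im_le_abs1 _) (hb t w))).
Qed.

End FubiniC.

(** * The Fourier transform on L^2 *)

Section FourierPair.
Variable R : realType.
Local Notation C := (complex R).
Local Notation Re := complex.Re.
Local Notation Im := complex.Im.
Local Notation mu := (@lebesgue_measure R).
Implicit Types f g h u U : R -> C.

(* [U] is the L^2 Fourier transform of [u] (with sign [s]), expressed by its two adjunction
   formulas against compactly supported functions. *)
Definition ftpair (s : R) u U := [/\ L2 u, L2 U,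
  (forall f M, 0 <= M -> L2 f -> csupp M f -> ip f u = ip (ft s f) U) &
  (forall f M, 0 <= M -> L2 f -> csupp M f -> ip (ft (- s) f) u = ip f U)].

Lemma csuppW M M' f : M <= M' -> csupp M f -> csupp M' f.
Proof. by move=> MM fM x h; apply: fM; exact: le_lt_trans h. Qed.

Lemma le_of_cvg0 (a b : R) (e : nat -> R) : e n @[n --> \oo] --> (0 : R) ->
  (forall n, a <= b + e n) -> a <= b.
Proof.
move=> e0 H; apply/ler_addgt0Pr => d d0.
have [n _ /(_ n (leqnn n))] := (cvgr0Pnorm_lt _).1 e0 _ d0.
move=> /= hn; apply: (le_trans (H n)); rewrite lerD2l.
by apply: ltW; apply: le_lt_trans hn; exact: ler_norm.
Qed.

Lemma cvg0Z (c : R) (e : nat -> R) : e n @[n --> \oo] --> (0 : R) ->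
  (c * e n) @[n --> \oo] --> (0 : R).
Proof.
by move=> e0; rewrite -[X in _ --> X](mulr0 c); apply: cvgM => //; exact: cvg_cst.
Qed.

Lemma cvg0D (a b : nat -> R) : a n @[n --> \oo] --> (0 : R) ->
  b n @[n --> \oo] --> (0 : R) -> (a n + b n) @[n --> \oo] --> (0 : R).
Proof. by move=> a0 b0; rewrite -[X in _ --> X](addr0 0); apply: cvgD. Qed.

Lemma ip_limit_eq h k u U (u_ U_ : nat -> R -> C) : L2 h -> L2 k -> L2 u -> L2 U ->
  (forall n, L2 (u_ n)) -> (forall n, L2 (U_ n)) ->
  nrm (fun x => u x - u_ n x) @[n --> \oo] --> 0 ->
  nrm (fun x => U_ n x - U x) @[n --> \oo] --> 0 ->
  (forall n, ip h (u_ n) = ip k (U_ n)) -> ip h u = ip k U.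
Proof.
move=> Lh Lk Lu LU Lu_ LU_ cu cU E; apply/eqP; rewrite -subr_eq0; apply/eqP.
apply: sqmod_eq0; apply/eqP; rewrite eq_le sqmod_ge0 andbT.
pose e n := 2 * nrm h * nrm (fun x => u x - u_ n x) + 2 * nrm k * nrm (fun x => U_ n x - U x).
apply: (@le_of_cvg0 _ _ e).
  by apply: cvg0D; apply: cvg0Z.
move=> n; rewrite add0r.
have -> : ip h u - ip k U = ip h (fun x => u x - u_ n x) + ip k (fun x => U_ n x - U x).
  by rewrite !ipBr// E; ring.
apply: (le_trans (sqmodD_le2 _ _)); rewrite /e -!mulrA.
by apply: lerD; rewrite ler_wpM2l//; apply: cauchy_schwarz => //; exact: L2B.
Qed.

(** For the truncations of [u] the two adjunction formulas are [ip_ft] and [ip_ft_dual]; both pass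
    to the L^2 limit by the Cauchy-Schwarz inequality. *)
Lemma ftpair_trunc s u U : s ^+ 2 = 1 -> L2 u -> L2 U ->
  ((fun N : nat => l2sq (fun w => trunc_FT s u N w - U w)) @ \oo --> 0%E) -> ftpair s u U.
Proof.
move=> s1 Lu LU cU.
pose u_ (N : nat) := cut `[- N%:R, N%:R]%classic u.
have Lu_ N : L2 (u_ N) by exact: L2_cut.
have uM N : csupp N%:R (u_ N) by exact: csupp_cut_itv.
have LU_ N : L2 (ft s (u_ N)) by apply: (L2_ft s1 _ (Lu_ N) (uM N)).
have cu := nrm_sub_itv_cvg0 Lu.
have {}cU : nrm (fun w => ft s (u_ N) w - U w) @[N --> \oo] --> 0.
  move: cU; have -> : (fun N : nat => l2sq (fun w => trunc_FT s u N w - U w)) =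
      (fun N => (nrm (fun w => ft s (u_ N) w - U w))%:E).
    by apply/funext => N; rewrite trunc_FTE; exact: (l2sqE (L2B (LU_ N) LU)).
  by move/fine_cvg.
split => // f M M0 Lf fM.
- apply: (ip_limit_eq Lf (L2_ft s1 M0 Lf fM) Lu LU Lu_ LU_ cu cU) => N.
  have h1 := csuppW (ler_wpDr (ler0n R N) (lexx M)) fM.
  have h2 := csuppW (ler_wpDl M0 (lexx N%:R)) (uM N).
  by rewrite (ip_ft s1 _ Lf h1 (Lu_ N) h2)// addr_ge0.
- have s1' : (- s) ^+ 2 = 1 by rewrite sqrrN.
  apply: (ip_limit_eq (L2_ft s1' M0 Lf fM) Lf Lu LU Lu_ LU_ cu cU) => N.
  have h1 := csuppW (ler_wpDr (ler0n R N) (lexx M)) fM.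
  have h2 := csuppW (ler_wpDl M0 (lexx N%:R)) (uM N).
  by rewrite (ip_ft_dual s1' _ Lf h1 (Lu_ N) h2) ?opprK// addr_ge0.
Qed.

Lemma ftpairD s u U v V : s ^+ 2 = 1 -> ftpair s u U -> ftpair s v V ->
  ftpair s (fun x => u x + v x) (fun x => U x + V x).
Proof.
move=> s1 [Lu LU u1 u2] [Lv LV v1 v2]; split; [exact: L2D|exact: L2D| |] => f M M0 Lf fM.
- have LF := L2_ft s1 M0 Lf fM.
  by rewrite !ipDr// (u1 f M)// (v1 f M).
- have s1' : (- s) ^+ 2 = 1 by rewrite sqrrN.
  have LF := L2_ft s1' M0 Lf fM.
  by rewrite !ipDr// (u2 f M)// (v2 f M).
Qed.

Lemma ftpairZ s c u U : s ^+ 2 = 1 -> ftpair s u U ->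
  ftpair s (fun x => c * u x) (fun x => c * U x).
Proof.
move=> s1 [Lu LU u1 u2]; split; [exact: L2Z|exact: L2Z| |] => f M M0 Lf fM.
- have LF := L2_ft s1 M0 Lf fM.
  by rewrite !ipZr// (u1 f M).
- have s1' : (- s) ^+ 2 = 1 by rewrite sqrrN.
  have LF := L2_ft s1' M0 Lf fM.
  by rewrite !ipZr// (u2 f M).
Qed.

Lemma nrm_cut_split A u : measurable A -> L2 u ->
  nrm u = nrm (cut A u) + nrm (fun x => u x - cut A u x).
Proof.
move=> mA Lu; have Lc := L2_cut mA Lu.
by rewrite nrmB// -ip_cut -ip_cut2 ipff ReC; ring.
Qed.

Lemma nrm_le_cut u (B : R) : L2 u ->
  (forall n : nat, nrm (cut `[- n%:R, n%:R]%classic u) <= B) -> nrm u <= B.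
Proof.
move=> Lu H; apply: (le_of_cvg0 (nrm_sub_itv_cvg0 Lu)) => n.
by rewrite (@nrm_cut_split `[- n%:R, n%:R]%classic)// lerD2r.
Qed.

(** Testing with f, a cut of [u], gives nrm(f)^2 = |<ft f, U>|^2 <= nrm(f) nrm(U). The second
    adjunction formula gives the reverse inequality in the same way. *)
Lemma ftpair_nrm s u U : s ^+ 2 = 1 -> ftpair s u U -> nrm u = nrm U.
Proof.
move=> s1 [Lu LU u1 u2]; have s1' : (- s) ^+ 2 = 1 by rewrite sqrrN.
have key (a b : R) : 0 <= a -> a ^+ 2 <= a * b -> 0 <= b -> a <= b.
  move=> a0 h b0; have [->//|an] := eqVneq a 0.
  have ap : 0 < a by rewrite lt_neqAle eq_sym an.
  by rewrite -(ler_pM2l ap) -expr2.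
apply/eqP; rewrite eq_le; apply/andP; split; apply: nrm_le_cut => // n.
- set f := cut _ u; have Lf : L2 f by exact: L2_cut.
  have fM : csupp n%:R f by exact: csupp_cut_itv.
  apply: key; [exact: nrm_ge0| |exact: nrm_ge0].
  have : ip f f = ip (ft s f) U by rewrite -(u1 f n%:R)//; exact: ip_cut2.
  rewrite ipff => E; rewrite -sqmodC E -(nrm_ft s1 (ler0n R n) Lf fM).
  by apply: cauchy_schwarz => //; apply: (L2_ft s1 _ Lf fM).
- set f := cut _ U; have Lf : L2 f by exact: L2_cut.
  have fM : csupp n%:R f by exact: csupp_cut_itv.
  apply: key; [exact: nrm_ge0| |exact: nrm_ge0].
  have : ip f f = ip (ft (- s) f) u by rewrite (u2 f n%:R)//; exact: ip_cut2.
  rewrite ipff => E; rewrite -sqmodC E -(nrm_ft s1' (ler0n R n) Lf fM).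
  by apply: cauchy_schwarz => //; apply: (L2_ft s1' _ Lf fM).
Qed.

Lemma ip_expir (a : R -> R) f g :
  ip f (fun t => expi (a t) * g t) = ip (fun t => expi (- a t) * f t) g.
Proof. by apply: eq_cint => t; rewrite conjcM expiJ; ring. Qed.

Lemma L2_expi (a : R -> R) f : measurable_fun setT a -> L2 f -> L2 (fun t => expi (a t) * f t).
Proof.
move=> ma; apply: (@L2_bdd_mul _ _ _ 1); first exact: cmeasurable_expi.
by move=> x; rewrite sqmod_expi.
Qed.

Lemma L2_tfs g x y : L2 g -> L2 (tfs g x y).
Proof. by move=> Lg; apply: L2_expi; [exact: measurable_funM|exact: L2_shift]. Qed.

Lemma csupp_shift M f x : csupp M f -> csupp (M + `|x|) (fun t => f (t + x)).
Proof.
move=> fM t h; apply: fM; have := ler_normB (t + x) x; rewrite addrK; lra.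
Qed.

Lemma ip_tfs f g x y : L2 f -> L2 g ->
  ip f (tfs g x y) = ip (fun t => expi (- (y * (t + x))) * f (t + x)) g.
Proof.
move=> Lf Lg; rewrite /tfs ip_expir.
have L1 : L2 (fun t => expi (- (y * t)) * f t).
  by apply: L2_expi => //; apply: measurable_funN; exact: measurable_funM.
rewrite -(ip_shift x L1 (L2_shift (- x) Lg)); congr ip; apply/funext => t.
by rewrite addrK.
Qed.

(** The time-frequency shift is moved onto the test function, whose support stays bounded; only the
    integral transform of a test function has to be computed. *)
Lemma ftpair_tfs g h x y : ftpair 1 g h ->
  ftpair 1 (tfs g x y) (fun w => expi ((w + y) * x) * h (w + y)).
Proof.
move=> [Lg Lh g1 g2]; have s1 : (1 : R) ^+ 2 = 1 by rewrite expr1n.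
have s1' : (-1 : R) ^+ 2 = 1 by rewrite sqrrN expr1n.
have m2 : measurable_fun setT (fun w : R => (w + y) * x).
  by apply: measurable_funM => //; exact: measurable_funD.
have m3 : measurable_fun setT (fun w : R => - (y * (w + x))).
  by apply: measurable_funN; apply: measurable_funM => //; exact: measurable_funD.
split.
- exact: L2_tfs.
- by apply: L2_expi => //; exact: L2_shift.
- move=> f M M0 Lf fM; rewrite ip_tfs//.
  set f' := fun t => _.
  have Lf' : L2 f' by apply: L2_expi => //; exact: L2_shift.
  have fM' : csupp (M + `|x|) f'.
    by move=> t ht; rewrite /f' (csupp_shift fM)// mulr0.
  rewrite (g1 f' (M + `|x|))// ?addr_ge0//.
  have ftE w : ft 1 f' w = expi (- (x * w)) * ft 1 f (w - y).
    rewrite /ft -cintZ; last exact: cintegrable_ft fM.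
    rewrite -[RHS](cint_shift x); last by apply: cintegrableZ; exact: cintegrable_ft fM.
    apply: eq_cint => t; rewrite /f' [LHS]mulrAC -expiD [LHS]mulrC [RHS]mulrCA -expiD.
    by congr (_ * expi _); ring.
  have LF := L2_ft s1 M0 Lf fM.
  rewrite (_ : ft 1 f' = fun w => expi (- (x * w)) * ft 1 f (w - y)); last exact/funext.
  rewrite -(ip_shift y); last 2 first.
  + apply: L2_expi; first by apply: measurable_funN; exact: measurable_funM.
    exact: (L2_shift (- y) LF).
  + exact: Lh.
  have E2 : (fun w => expi (- (x * (w + y))) * ft 1 f (w + y - y)) =
      (fun w => expi (- ((w + y) * x)) * ft 1 f w).
    by apply/funext => w; rewrite addrK [x * _]mulrC.
  rewrite E2; exact: (esym (ip_expir (fun w => (w + y) * x) (ft 1 f) (fun w => h (w + y)))).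
- move=> f M M0 Lf fM; rewrite ip_tfs//; last exact: (L2_ft s1' M0 Lf fM).
  pose f' (v : R) := expi (- (v * x)) * f (v - y).
  have m4 : measurable_fun setT (fun v : R => - (v * x)).
    by apply: measurable_funN; exact: measurable_funM.
  have Lf' : L2 f' by apply: L2_expi => //; exact: (L2_shift (- y)).
  have fM' : csupp (M + `|y|) f'.
    move=> t ht; rewrite /f' (csupp_shift (x := - y) fM) ?mulr0//.
    by rewrite normrN.
  have ftE t : expi (- (y * (t + x))) * ft (-1) f (t + x) = ft (-1) f' t.
    rewrite /ft -cintZ; last exact: cintegrable_ft fM.
    rewrite -[LHS](cint_shift (- y)); last by apply: cintegrableZ; exact: cintegrable_ft fM.
    apply: eq_cint => v; rewrite /f' [LHS]mulrCA -expiD [RHS]mulrAC -expiD [RHS]mulrC.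
    by congr (_ * expi _); ring.
  rewrite (_ : (fun t => _) = ft (-1) f'); last exact/funext.
  rewrite (g2 f' (M + `|y|))// ?addr_ge0// -(ip_shift y Lf' Lh).
  have E2 : (fun w => f' (w + y)) = (fun w => expi (- ((w + y) * x)) * f w).
    by apply/funext => w; rewrite /f' addrK.
  rewrite E2; exact: (esym (ip_expir (fun w => (w + y) * x) f (fun w => h (w + y)))).
Qed.

End FourierPair.

(** * Parseval systems *)

Section Parseval.
Variable R : realType.
Local Notation C := (complex R).
Local Notation Re := complex.Re.
Local Notation Im := complex.Im.
Local Notation mu := (@lebesgue_measure R).
Implicit Types f g h u U : R -> C.

(** The dense class on which the Wilson identities are proved: bounded support makes foldings
    finite, boundedness keeps products with the window in L^2. *)
Definition bcsupp f := [/\ cmeasurable f, (exists2 M, 0 <= M & csupp M f) &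
  exists B, forall x, sqmod (f x) <= B].

Lemma L2_bcsupp f : bcsupp f -> L2 f.
Proof. by move=> [mf [M M0 fM] [B fB]]; exact: (L2_csupp_bdd mf fM fB). Qed.

Lemma bcsupp_cut_trunc_set f n : cmeasurable f -> bcsupp (cut (trunc_set f n) f).
Proof.
move=> mf; split.
- by apply: cmeasurable_cut => //; exact: measurable_trunc_set.
- by exists n%:R => // x hx; rewrite cut_out// => -[]; rewrite leNgt hx.
- exists n%:R => x; have [tx|tx] := pselect (trunc_set f n x); first by rewrite cut_in//; case: tx.
  by rewrite cut_out// sqmod0.
Qed.

Lemma le_of_1eps (a b : R) : 0 <= b -> (forall e, 0 < e -> a <= (1 + e) * b) -> a <= b.
Proof.
move=> b0 H; apply/ler_addgt0Pr => d d0.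
have b1 : 0 < b + 1 by lra.
apply: (le_trans (H (d / (b + 1)) (divr_gt0 d0 b1))).
rewrite mulrDl mul1r lerD2l mulrAC ler_pdivrMr//; nra.
Qed.

Variables (I : choiceType) (e : I -> R -> C).
Hypothesis Le : forall i, L2 (e i).

Definition parseval f :=
  (\esum_(i in [set: I]) (sqmod (ip f (e i)))%:E = (nrm f)%:E)%E.

Hypothesis Hbc : forall f, bcsupp f -> parseval f.

(** For a finite family the truncation error is controlled by Cauchy-Schwarz with a constant [K]
    depending on the family. It vanishes in the limit before the supremum over families is taken. *)
Lemma parseval_bessel f : L2 f ->
  (\esum_(i in [set: I]) (sqmod (ip f (e i)))%:E <= (nrm f)%:E)%E.
Proof.
move=> Lf; apply: ub_ereal_sup => _ [X [fX _] <-].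
rewrite fsbig_finite//= sumEFin lee_fin; set s := finmap.enum_fset _.
have us : uniq s by exact: finmap.fset_uniq.
apply: le_of_1eps; first exact: nrm_ge0.
move=> d d0.
pose fn n := cut (trunc_set f n) f.
have mt n : measurable (trunc_set f n) by apply: measurable_trunc_set; exact: L2_measurable.
have Lfn n : L2 (fn n) by exact: L2_cut.
set K := \sum_(i <- s) nrm (e i).
have c0 := cvg0Z ((1 + d^-1) * K) (nrm_sub_trunc_set_cvg0 Lf).
apply: (le_of_cvg0 c0) => n; rewrite -/(fn n).
have dv : 0 < d^-1 by rewrite invr_gt0.
apply: (@le_trans _ _ (\sum_(i <- s) ((1 + d) * sqmod (ip (fn n) (e i)) +
    (1 + d^-1) * (nrm (e i) * nrm (fun x => f x - fn n x))))).
  apply: ler_sum => i _.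
  have -> : ip f (e i) = ip (fn n) (e i) + ip (fun x => f x - fn n x) (e i).
    by rewrite ipBl//; ring.
  apply: (le_trans (sqmodD_le_eps _ _ d0)); rewrite lerD2l ler_wpM2l//; first by lra.
  by rewrite mulrC; apply: cauchy_schwarz => //; exact: L2B.
rewrite big_split/= -!mulr_sumr -mulr_suml -/K mulrA lerD2r ler_wpM2l//; first by lra.
apply: (@le_trans _ _ (nrm (fn n))).
  rewrite -lee_fin -(Hbc (bcsupp_cut_trunc_set n (L2_measurable Lf))).
  by apply: le_sum_esum => // i; exact: sqmod_ge0.
by rewrite (nrm_cut_split (mt n) Lf) lerDl nrm_ge0.
Qed.

(** For the missing inequality the error has to be summed over all indices at once;
    [parseval_bessel], applied to the remainder, bounds that sum. *)
Lemma parseval_L2 f : L2 f -> parseval f.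
Proof.
move=> Lf; have B := parseval_bessel Lf.
set S := (\esum_(i in _) _)%E in B; rewrite /parseval -/S.
have S0 : (0 <= S)%E by apply: esum_ge0 => i _; rewrite lee_fin sqmod_ge0.
have [s Ss] : exists s, S = s%:E by case: S S0 B => [s _ _|//|//]; exists s.
rewrite Ss in S0 B *; rewrite lee_fin in S0; rewrite lee_fin in B.
congr EFin; apply/eqP; rewrite eq_le B/=.
apply: le_of_1eps => // d d0.
pose fn n := cut (trunc_set f n) f.
have mt n : measurable (trunc_set f n) by apply: measurable_trunc_set; exact: L2_measurable.
have Lfn n : L2 (fn n) by exact: L2_cut.
have dv : 0 < d^-1 by rewrite invr_gt0.
(* One remainder comes from splitting [nrm f], and 1 + d^-1 of them from the weighted inequality. *)
have c0 := cvg0Z (2 + d^-1) (nrm_sub_trunc_set_cvg0 Lf).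
apply: (le_of_cvg0 c0) => n; rewrite -/(fn n).
set r := nrm (fun x => f x - fn n x).
have Lr : L2 (fun x => f x - fn n x) by exact: L2B.
rewrite (nrm_cut_split (mt n) Lf) -/(fn n) -/r.
suff : nrm (fn n) <= (1 + d) * s + (1 + d^-1) * r by lra.
rewrite -lee_fin -(Hbc (bcsupp_cut_trunc_set n (L2_measurable Lf))) -/(fn n).
apply: (@le_trans _ _ (\esum_(i in [set: I]) ((1 + d)%:E * (sqmod (ip f (e i)))%:E +
    (1 + d^-1)%:E * (sqmod (ip (fun x => f x - fn n x) (e i)))%:E))%E).
  apply: le_esum => i _; rewrite -!EFinM -EFinD lee_fin.
  have -> : ip (fn n) (e i) = ip f (e i) + - ip (fun x => f x - fn n x) (e i).
    by rewrite ipBl//; ring.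
  by apply: (le_trans (sqmodD_le_eps _ _ d0)); rewrite sqmodN.
have p1 : 0 < 1 + d by lra.
have p2 : 0 < 1 + d^-1 by lra.
rewrite esumD; last 2 first.
- by move=> i _; rewrite mule_ge0 ?lee_fin ?sqmod_ge0 ?ltW.
- by move=> i _; rewrite mule_ge0 ?lee_fin ?sqmod_ge0 ?ltW.
rewrite !esumZ//; [|by move=> i; rewrite lee_fin sqmod_ge0|by move=> i; rewrite lee_fin sqmod_ge0].
rewrite -/S Ss [leRHS]EFinD [X in (_ <= X + _)%E]EFinM [X in (_ <= _ + X)%E]EFinM.
apply: leeD2l.
by rewrite lee_pmul2l ?lte_fin//; exact: parseval_bessel.
Qed.

End Parseval.

Section ONBcriterion.
Variable R : realType.
Local Notation C := (complex R).
Local Notation mu := (@lebesgue_measure R).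
Variables (I : choiceType) (e : I -> R -> C).
Hypothesis Le : forall i, L2 (e i).
Hypothesis ne : forall i, nrm (e i) = 1.
Hypothesis Pe : forall f, L2 f -> parseval e f.

(** Parseval for [e i] reads 1 = 1 + the sum of |<e i, e j>|^2 over the other indices j, which
    forces orthogonality. *)
Lemma ONB_parseval : ONB e.
Proof.
split => //; split.
- move=> i j; have [<-|ij] := eqVneq i j; first by rewrite ipff ne.
  apply: sqmod_eq0; apply/eqP; rewrite eq_le sqmod_ge0 andbT.
  have us : uniq [:: i; j] by rewrite /= inE ij.
  have := le_sum_esum us (fun k => sqmod_ge0 (ip (e i) (e k))).
  rewrite (Pe (Le i)) ne lee_fin !big_cons big_nil ipff ne sqmodC expr1n addr0.
  by rewrite gerDl.
- move=> f Lf f0.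
  have n0 : nrm f = 0.
    have := Pe Lf; rewrite /parseval esum1; first by case.
    by move=> i _; rewrite f0 sqmod0.
  have mf : measurable_fun setT (fun x => (sqmod (f x))%:E).
    by apply/measurable_EFinP; apply: measurable_sqmod; exact: L2_measurable.
  have : (\int[mu]_x `|(sqmod (f x))%:E| = 0)%E.
    under eq_integral do rewrite gee0_abs ?lee_fin ?sqmod_ge0//.
    by have := l2sqE Lf; rewrite /l2sq => ->; rewrite n0.
  move/(proj1 (ae_eq_integral_abs mu measurableT mf)).
  apply: filterS => x /= /(_ Logic.I) [] h.
  exact: sqmod_eq0.
Qed.

End ONBcriterion.

(** * Realness of the dechirped window *)

Section Realness.
Variable R : realType.
Local Notation C := (complex R).
Local Notation Re := complex.Re.
Local Notation Im := complex.Im.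
Local Notation mu := (@lebesgue_measure R).
Implicit Types f g h u U : R -> C.

Lemma ip_nrm0 f u v : L2 f -> L2 u -> L2 v -> nrm (fun x => u x - v x) = 0 -> ip f u = ip f v.
Proof.
move=> Lf Lu Lv n0; apply/eqP; rewrite -subr_eq0 -ipBr//; apply/eqP.
apply: sqmod_eq0; apply/eqP; rewrite eq_le sqmod_ge0 andbT.
by have := cauchy_schwarz Lf (L2B Lu Lv); rewrite n0 mulr0.
Qed.

Lemma ftpair_nrm0 s u U V : s ^+ 2 = 1 -> ftpair s u U -> L2 V ->
  nrm (fun x => U x - V x) = 0 -> ftpair s u V.
Proof.
move=> s1 [Lu LU u1 u2] LV n0; split => // f M M0 Lf fM.
- by rewrite (u1 f M M0 Lf fM); apply: ip_nrm0 => //; exact: (L2_ft s1 M0 Lf fM).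
- by rewrite (u2 f M M0 Lf fM); exact: ip_nrm0.
Qed.

(** Formally uh(x) is a positive multiple of chi(-d x). The adjunction formulas express this weakly,
    and the test function is the cut of i Im(chi): it is purely imaginary, so its pairing with real
    [uh] has zero real part, while its pairing with [chi] has its own squared norm as real part. *)
Lemma real_after_transforms (d : R) (chi h2 uh : R -> C) : 0 < d ->
  ftpair (-1) chi h2 -> ftpair (-1) (dil (1 / d) h2) uh ->
  {ae mu, forall x, Im (uh x) = 0} ->
  nrm (fun x => imagi * real_complex R (Im (chi x))) = 0.
Proof.
move=> d0 [Lc L2h c1 c2] [Lu Luh u1 u2] re.
have dn : d != 0 by rewrite gt_eqF.
have s1 : (-1 : R) ^+ 2 = 1 by rewrite sqrrN expr1n.
have [mR mI] := L2_measurable Lc.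
have LI : L2 (fun x => imagi * real_complex R (Im (chi x))).
  apply: L2Z; apply: (L2_le (cmeasurable_real mI) _ (L2_integrable Lc)) => x.
  by rewrite sqmodC; exact: Im_le_sqmod.
apply/eqP; rewrite eq_le nrm_ge0 andbT; apply: nrm_le_cut => // N.
set rho := cut _ _; have Lr : L2 rho by exact: L2_cut.
have rM : csupp N%:R rho by exact: csupp_cut_itv.
have nd0 : - d != 0 by rewrite oppr_eq0.
(* The reflection accounts for the two successive transforms, the factor d for the dilation between
   them. *)
pose phi (w : R) := rho (- d * w + 0).
have Lphi : L2 phi by exact: (L2_affine 0 nd0 Lr).
have pM : csupp (N%:R / d) phi.
  move=> x; rewrite ltr_pdivrMr// => hx; apply: rM.
  by rewrite addr0 normrM normrN (gtr0_norm d0) mulrC.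
have M0 : 0 <= N%:R / d by rewrite divr_ge0// ltW.
have ftE t : ft 1 phi t = real_complex R d^-1 * ft (-1) rho (d^-1 * t + 0).
  rewrite /ft addr0.
  have := cint_affine 0 nd0 (cintegrable_ft (-1) (d^-1 * t) Lr rM).
  rewrite normrN (gtr0_norm d0) => <-; apply: eq_cint => w; rewrite /phi; congr (_ * expi _).
  by rewrite addr0; field.
have Lfr := L2_ft s1 (ler0n R N) Lr rM.
have dv0 : d^-1 != 0 by rewrite invr_eq0.
(* The factors come from the transform of the rescaled [rho], from the normalization of [dil], and
   from the change of variable in the inner product. *)
pose K : R := d^-1 * Num.sqrt `|1 / d| * d.
have K0 : 0 < K.
  by rewrite /K mulr_gt0// mulr_gt0 ?invr_gt0// sqrtr_gt0 normr_gt0 div1r invr_eq0.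
have E : ip phi uh = real_complex R K * ip rho chi.
  have := u2 phi _ M0 Lphi pM; rewrite opprK => <-.
  rewrite (c1 rho N%:R)//.
  rewrite (_ : ft 1 phi = fun t => real_complex R d^-1 * ft (-1) rho (d^-1 * t + 0));
    last exact/funext.
  rewrite (_ : dil (1 / d) h2 = fun t =>
      real_complex R (Num.sqrt `|1 / d|) * h2 (d^-1 * t + 0)); last first.
    by apply/funext => t; rewrite /dil div1r addr0.
  have LA := L2_affine 0 dv0 Lfr; have LB := L2_affine 0 dv0 L2h.
  rewrite (ipZl _ LA (L2Z _ LB)) (ipZr _ LA LB) conjcC.
  have -> := ip_affine 0 dv0 Lfr L2h.
  by rewrite normfV (gtr0_norm d0) invrK !mulrA -!rmorphM.
have R0 : Re (ip phi uh) = 0.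
  rewrite /ip Re_cint /Rintegral.
  have mz : measurable_fun setT (fun x => (Re (phi x * conjc (uh x)))%:E).
    have [i1 _] := cintegrable_ip Lphi Luh.
    by case/integrableP: i1.
  rewrite (@ae_eq_integral _ _ _ mu setT (fun=> 0%E))//; first by rewrite integral0.
  move: re; apply: (@filterS _ (almost_everywhere mu) (ae_filter_ringOfSetsType mu)) => x hx _ /=; congr EFin.
  have p0 : Re (phi x) = 0 by rewrite /phi /rho /cut !ReImE; ring.
  by rewrite ReM ReJ ImJ p0 hx; ring.
have R1 : Re (ip rho chi) = nrm rho.
  rewrite /ip Re_cint; apply: eq_Rintegral => x _.
  rewrite sqmod_cut sqmodM sqmodC.
  have -> : sqmod (imagi : C) = 1 by rewrite /sqmod Re_imagi Im_imagi; ring.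
  by rewrite /rho /cut !ReImE; ring.
move: R0; rewrite E ReM ReC ImC R1 mul0r subr0 => /eqP.
by rewrite mulf_eq0 (gt_eqF K0)/= => /eqP ->.
Qed.

End Realness.

(** * Folding onto a cell *)

Section Folding.
Variable R : realType.
Local Notation C := (complex R).
Local Notation Re := complex.Re.
Local Notation Im := complex.Im.
Local Notation mu := (@lebesgue_measure R).
Implicit Types f g h H Q : R -> C.

Lemma cintegrable_cut A f : measurable A -> cintegrable f -> cintegrable (cut A f).
Proof.
move=> mA [f1 f2].
have mi : measurable_fun setT (\1_A : R -> R) by exact: measurable_indic.
have i1 x : `|(\1_A x : R)| <= 1 by rewrite indicE; case: (x \in A); rewrite ?normr1 ?normr0.
split.
- apply: (@le_integrableR _ _ (fun x => `|Re (f x)|)); last exact: integrable_norm.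
    under eq_fun do rewrite /cut ReM ReC ImC mul0r subr0.
    by apply: measurable_funM => //; apply/measurable_EFinP; case/integrableP: f1.
  by move=> x; rewrite /cut ReM ReC ImC mul0r subr0 normrM ler_piMl.
- apply: (@le_integrableR _ _ (fun x => `|Im (f x)|)); last exact: integrable_norm.
    under eq_fun do rewrite /cut ImM ReC ImC mul0r addr0.
    by apply: measurable_funM => //; apply/measurable_EFinP; case/integrableP: f2.
  by move=> x; rewrite /cut ImM ReC ImC mul0r addr0 normrM ler_piMl.
Qed.

Lemma cintegrable_sum (I : Type) (s : seq I) (F : I -> R -> C) :
  (forall i, cintegrable (F i)) -> cintegrable (fun x => \sum_(i <- s) F i x).
Proof.
move=> iF; elim: s => [|i s IH].
  by under eq_fun do rewrite big_nil; split; exact: integrable0.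
by under eq_fun do rewrite big_cons; exact: cintegrableD.
Qed.

Lemma cint0 : cint setT (fun _ : R => 0 : C) = 0.
Proof. by apply: complexP; rewrite !(Re_cint, Im_cint) /Rintegral integral0. Qed.

Lemma cint_sum (I : Type) (s : seq I) (F : I -> R -> C) : (forall i, cintegrable (F i)) ->
  cint setT (fun x => \sum_(i <- s) F i x) = \sum_(i <- s) cint setT (F i).
Proof.
move=> iF; elim: s => [|i s IH].
  by under eq_fun do rewrite big_nil; rewrite big_nil cint0.
under eq_fun do rewrite big_cons.
by rewrite big_cons cintD ?IH//; exact: cintegrable_sum.
Qed.

Variable d : R.
Hypothesis d0 : 0 < d.
Local Notation D := (`[0, d[%classic : set R).
Local Notation Do := (`]0, d[%classic : set R).

(** Bridges the half-open cells of the tiling and the open interval of the Fourier series; they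
    differ by a null set. *)
Lemma Rintegral_cut_oo (u : R -> R) : mu.-integrable setT (EFin \o u) ->
  (forall x, ~ D x -> u x = 0) ->
  Rintegral mu setT u = Rintegral mu setT (fun x => \1_Do x * u x).
Proof.
move=> iu u0.
have -> : Rintegral mu setT u = Rintegral mu D u.
  rewrite [RHS]Rintegral_mkcond; apply: eq_Rintegral => x _; rewrite patchE.
  by have [//|/negP xD] := boolP (x \in D); rewrite u0// => h; apply: xD; rewrite inE.
rewrite -Rintegral_itv_obnd_cbnd; last exact: integrableS iu.
rewrite Rintegral_mkcond; apply: eq_Rintegral => x _.
by rewrite patch_indic /= mulrC.
Qed.

Lemma parseval_co f : L2 f -> (forall x, ~ D x -> f x = 0) ->
  (\esum_(j in [set: int])
    (sqmod (cint setT (fun x => f x * expi (- (j%:~R * x / d))))%R)%:E = (d * nrm f)%:E)%E.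
Proof.
move=> Lf f0.
have Lo : L2 (cut Do f) by exact: L2_cut.
have fd : csupp d f.
  move=> x hx; apply: f0 => /=; rewrite in_itv/= => /andP[x0 xd].
  by move: hx; rewrite ger0_norm// ltNge (ltW xd).
have -> : nrm f = nrm (cut Do f).
  rewrite /nrm (Rintegral_cut_oo (L2_integrable Lf)).
    by apply: eq_Rintegral => x _; rewrite sqmod_cut.
  by move=> x /f0 ->; rewrite sqmod0.
have alP : 0 + d = d by rewrite add0r.
have := @fourier_parseval R 0 d d0 (cut Do f) Lo.
rewrite alP => <-; last by move=> x h; rewrite cut_out.
apply: eq_esum => j _; congr (_%:E); congr sqmod.
have ic : cintegrable (fun x => f x * expi (- (j%:~R * x / d))).
  apply: (cintegrable_csupp Lf fd (B := 1)); last by move=> x; rewrite sqmod_expi.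
  apply: cmeasurable_expi.
  rewrite (_ : (fun x => _) = (fun x => (- (j%:~R / d)) * x + 0)); first exact: measurable_affine.
  by apply/funext => x; ring.
have [i1 i2] := ic.
rewrite ip_fE alP [RHS]cint_cut.
have E x : cut Do (fun t => cut Do f t * fexp d (- j) t) x
    = real_complex R (\1_Do x) * (f x * expi (- (j%:~R * x / d))).
  have [Dx|Dx] := pselect (Do x); last by rewrite cut_out// indicE memNset// mul0r.
  by rewrite !cut_in// indicE mem_set// mul1r /fexp intrN !mulNr.
rewrite (eq_cint E); apply: complexP; rewrite [LHS](Re_cint, Im_cint) [RHS](Re_cint, Im_cint).
- rewrite (@Rintegral_cut_oo (fun x => Re (f x * expi (- (j%:~R * x / d)))) i1); last by move=> x /f0 ->; rewrite mul0r.
  by apply: eq_Rintegral => x _; rewrite [RHS]ReM ReC ImC mul0r subr0.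
- rewrite (@Rintegral_cut_oo (fun x => Im (f x * expi (- (j%:~R * x / d)))) i2); last by move=> x /f0 ->; rewrite mul0r.
  by apply: eq_Rintegral => x _; rewrite [RHS]ImM ReC ImC mul0r addr0.
Qed.

Variable K : nat.
(** Left ends of cells of length d; the indices k < 2 K cover [- K d, K d[, and cell [K] starts at
    0. *)
Definition cell_origin (k : nat) : R := (k%:R - K%:R) * d.

(** The cell containing x has index floor(x / d) + K, and the bound on |x| puts this index in
    range. *)
Lemma indic_tile (x : R) : `|x| < K%:R * d ->
  \sum_(k < 2 * K) real_complex R (\1_D (x - cell_origin k)) = 1.
Proof.
rewrite ltr_norml => /andP[x1 x2].
pose m := Num.floor (x / d).
have h1 := ge_floor (x / d); have h2 := lt_succ_floor (x / d).
rewrite -/m ler_pdivlMr// in h1; rewrite -/m ltr_pdivrMr// in h2.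
have mK : 0 <= m + K%:Z.
  rewrite -ltzD1 -(ltr0z R) !intrD -(ltr_pM2r d0) mul0r.
  by move: h2; rewrite intrD mulrDl => h2; rewrite !mulrDl -[K%:~R]/(K%:R); lra.
have [k0 k0E] : exists k0 : nat, m + K%:Z = k0%:Z by case: (m + K%:Z) mK => // k _; exists k.
have mE : m%:~R = k0%:R - K%:R :> R.
  have := congr1 (fun z : int => z%:~R : R) k0E; rewrite intrD -[k0%:~R]/(k0%:R) -[K%:~R]/(K%:R).
  by move=> <-; rewrite addrK.
have kk : cell_origin k0 = m%:~R * d by rewrite /cell_origin mE.
have kb : (k0 < 2 * K)%N.
  rewrite -(ltr_nat R) -(ltr_pM2r d0) natrM; move: h1; rewrite mE mulrBl => h1.
  by lra.
rewrite (bigD1 (Ordinal kb))//= kk indicE mem_set; last first.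
  rewrite /= in_itv/= subr_ge0 h1/= ltrBlDr.
  by move: h2; rewrite intrD mulrDl mul1r addrC.
rewrite big1 ?addr0// => k kk0; rewrite indicE memNset// => /=.
rewrite in_itv/= => /andP[y1 y2].
move/eqP: kk0; apply; apply/val_inj => /=; apply/eqP.
have q1 : k%:R < k0%:R + 1 :> R.
  rewrite -(ltr_pM2r d0) mulrDl mul1r.
  by move: h2 y1 kk; rewrite /cell_origin intrD; lra.
have q2 : k0%:R < k%:R + 1 :> R.
  rewrite -(ltr_pM2r d0) mulrDl mul1r.
  by move: h1 y2 kk; rewrite /cell_origin; lra.
rewrite natr1 ltr_nat in q1; rewrite natr1 ltr_nat in q2.
by rewrite eqn_leq -ltnS q1 -ltnS q2.
Qed.

Lemma cint_tile Q M : cintegrable Q -> csupp M Q -> M < K%:R * d ->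
  cint setT Q = \sum_(k < 2 * K) cint setT (cut D (fun s => Q (s + cell_origin k))).
Proof.
move=> iQ QM MK.
have iS (k : nat) : cintegrable (cut D (fun s => Q (s + cell_origin k))).
  apply: cintegrable_cut => //.
  have := cintegrable_affine (cell_origin k) (oner_neq0 R) iQ; congr cintegrable.
  by apply/funext => x; rewrite mul1r.
have iS' (k : nat) : cintegrable (fun s => cut D (fun s => Q (s + cell_origin k)) (s - cell_origin k)).
  have := cintegrable_affine (- cell_origin k) (oner_neq0 R) (iS k); congr cintegrable.
  by apply/funext => x; rewrite mul1r.
transitivity (cint setT (fun s => \sum_(k < 2 * K) cut D (fun s => Q (s + cell_origin k)) (s - cell_origin k))).
  apply: eq_cint => s.
  have [Qs|Qs] := eqVneq (Q s) 0.
    by rewrite Qs big1// => k _; rewrite cut_eq0// subrK.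
  have sK : `|s| < K%:R * d.
    by apply: le_lt_trans MK; rewrite leNgt; apply/negP => /QM h; rewrite h eqxx in Qs.
  rewrite -[LHS]mul1r -(indic_tile sK) mulr_suml; apply: eq_bigr => k _.
  by rewrite /cut subrK.
rewrite cint_sum//; apply: eq_bigr => k _.
by rewrite (cint_shift _ (iS k)).
Qed.

(** The sign of e(- m a s) at the origin of cell [k], with [b] the parity of m. The exponent k + K
    has the parity of k - K and stays a natural number. *)
Definition eps (b : bool) (k : nat) : R := if b then (-1) ^+ (k + K) else 1.

Definition piece (k : nat) H : R -> C := cut D (fun s => H (s + cell_origin k)).

Definition fold (b : bool) H : R -> C :=
  fun s => \sum_(k < 2 * K) real_complex R (eps b k) * piece k H s.

Lemma L2_piece k H : L2 H -> L2 (piece k H).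
Proof. by move=> LH; apply: L2_cut => //; exact: L2_shift. Qed.

Lemma L2_fold b H : L2 H -> L2 (fold b H).
Proof. by move=> LH; apply: L2_sum => k; apply: L2Z; exact: L2_piece. Qed.

Lemma fold_out b H x : ~ D x -> fold b H x = 0.
Proof. by move=> Dx; rewrite /fold big1// => k _; rewrite /piece cut_out// mulr0. Qed.

Lemma foldD b H H' : fold b (fun s => H s + H' s) = fun s => fold b H s + fold b H' s.
Proof.
apply/funext => s; rewrite /fold -big_split; apply: eq_bigr => k _ /=.
by rewrite /piece /cut !mulrDr.
Qed.

Lemma foldZ b c H : fold b (fun s => c * H s) = fun s => c * fold b H s.
Proof.
apply/funext => s; rewrite /fold mulr_sumr; apply: eq_bigr => k _ /=.
by rewrite /piece /cut; ring.
Qed.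

Variable a : R.
Hypothesis ad : a * d = 2^-1.

(** As [a d = 1/2], the phase is m (k - K) / 2 up to sign: an integer for even m, a half-integer
    multiple of k - K for odd m. *)
Lemma expi_cell_origin (b : bool) (j : int) k :
  expi (- ((2 * j + b)%:~R * a * cell_origin k)) = real_complex R (eps b k).
Proof.
have -> : (2 * j + b)%:~R * a * cell_origin k = (2 * j%:~R + b%:R) * (k%:R - K%:R) * (a * d).
  by rewrite /cell_origin intrD intrM; ring.
rewrite ad.
have -> : - ((2 * j%:~R + b%:R) * (k%:R - K%:R) / 2) =
    (- (j * (k%:Z - K%:Z)))%:~R + - (b%:R * (k%:R - K%:R) / 2) :> R.
  by rewrite intrN intrM intrB; field.
rewrite expiD expi_int mul1r /eps; case: b; last by rewrite mul0r mul0r oppr0 expi0.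
have -> : - (1 * (k%:R - K%:R) / 2) = (- k%:Z)%:~R + (k + K)%:Z%:~R / 2 :> R.
  by rewrite intrN PoszD intrD; field.
rewrite expiD expi_int mul1r expi_half_int absz_nat rmorphXn/=; congr (_ ^+ _).
by apply: complexP; rewrite !ReImE ?oppr0.
Qed.

(** Cutting the integral into cells collects the signs [eps] into the fold. Since 2 a = 1 / d, what
    remains are the Fourier coefficients on [0, d[ of the fold times e(- b a s). *)
Lemma fold_parseval (b : bool) H M : L2 H -> csupp M H -> M < K%:R * d ->
  (\esum_(j in [set: int])
     (sqmod (cint setT (fun s => H s * expi (- ((2 * j + b)%R%:~R * a * s)))%R))%:E
   = (d * nrm (fold b H))%:E)%E.
Proof.
move=> LH HM MK; have dn : d != 0 by rewrite gt_eqF.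
have aE : a = (2 * d)^-1 by rewrite invfM -ad mulfK.
(* This unimodular factor absorbs the parity offset [b] of the frequency and leaves the norm
   unchanged. *)
pose f s := expi (- (b%:R * a * s)) * fold b H s.
have mb : measurable_fun setT (fun s : R => - (b%:R * a * s)).
  rewrite (_ : (fun x => _) = (fun x => (- (b%:R * a)) * x + 0)); first exact: measurable_affine.
  by apply/funext => x; ring.
have Lf : L2 f by apply: L2_expi => //; exact: L2_fold.
have := parseval_co Lf.
have -> : nrm f = nrm (fold b H).
  by apply: eq_Rintegral => x _; rewrite sqmodM sqmod_expi mul1r.
move=> <-; last by move=> x Dx; rewrite /f fold_out// mulr0.
apply: eq_esum => j _; congr (_%:E); congr sqmod.
set m := (2 * j + b)%:~R * a.
have mm : measurable_fun setT (fun s : R => - (m * s)).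
  rewrite (_ : (fun x => _) = (fun x => (- m) * x + 0)); first exact: measurable_affine.
  by apply/funext => x; ring.
have iQ : cintegrable (fun s => H s * expi (- (m * s))).
  apply: (cintegrable_csupp LH HM (B := 1)); last by move=> x; rewrite sqmod_expi.
  exact: cmeasurable_expi.
have QM : csupp M (fun s => H s * expi (- (m * s))) by move=> x hx; rewrite HM// mul0r.
rewrite (cint_tile iQ QM MK).
have pd k : csupp d (piece k H).
  move=> x hx; rewrite /piece cut_out//= in_itv/= => /andP[x0 xd].
  by move: hx; rewrite ger0_norm// ltNge (ltW xd).
rewrite -cint_sum; last first.
  move=> k; have := cintegrableZ (real_complex R (eps b k))
    (cintegrable_csupp (L2_piece k LH) (pd k) (cmeasurable_expi mm) (B := 1) _).
  rewrite (_ : (fun x => _) = cut D (fun s => H (s + cell_origin k) * expi (- (m * (s + cell_origin k))))).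
    by apply => x; rewrite sqmod_expi.
  apply/funext => s; rewrite /piece /cut -(expi_cell_origin b j k) -/m.
  by rewrite mulrDr opprD expiD; ring.
apply: eq_cint => s; rewrite /f /fold mulr_sumr mulr_suml; apply: eq_bigr => k _.
rewrite /piece /cut -(expi_cell_origin b j k) -/m mulrDr opprD expiD.
have -> : - (m * s) = - (b%:R * a * s) + - (j%:~R * s / d).
  by rewrite /m intrD intrM aE; field.
by rewrite expiD; ring.
Qed.

End Folding.

(** * The cross terms *)

Section Cancellation.
Variable R : realType.

Lemma signz_opp (n : int) : (-1 : R) ^ (- n) = (-1) ^ n.
Proof. by rewrite -exprz_inv invrN1. Qed.

Lemma signz_sqr (n : int) : (-1 : R) ^ n * (-1) ^ n = 1.
Proof. by rewrite -[X in X * _]signz_opp -expfzDr ?oppr_eq0 ?oner_eq0// addNr. Qed.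

(** The reflection exchanges the positive and negative parts, so a signed sum vanishes without being
    written as a difference of possibly infinite quantities. *)
Lemma esum_antisym (z : int -> R) (q : int) : (forall n, z (q - n) = - z n) ->
  (\esum_(n in [set: int]) (Num.max (z n) 0)%:E =
   \esum_(n in [set: int]) (Num.max (- z n) 0)%:E)%E.
Proof.
move=> zq; rewrite (@reindex_esumT _ _ _ (fun n => q - n)).
  by apply: eq_esum => n _; rewrite zq.
by exists (fun n => q - n) => n; rewrite opprB addrCA subrr addr0.
Qed.

(* If [A = B + sum_i z_i] with each [z_i] summable and odd under the reflection [n -> q_i - n],
   then [A] and [B] have the same sum. *)
Lemma esum_cancel (I : choiceType) (s : seq I) (z : I -> int -> R) (q : I -> int) (A B : int -> R) :
  (forall n, 0 <= A n) -> (forall n, 0 <= B n) ->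
  (forall n, A n = B n + \sum_(i <- s) z i n) ->
  (forall i n, z i (q i - n) = - z i n) ->
  (forall i, (\esum_(n in [set: int]) `|z i n|%:E < +oo)%E) ->
  (\esum_(n in [set: int]) (A n)%:E = \esum_(n in [set: int]) (B n)%:E)%E.
Proof.
move=> A0 B0 AB zq zs.
pose zp i n : R := Num.max (z i n) 0; pose zn i n : R := Num.max (- z i n) 0.
have zp0 i n : 0 <= zp i n by rewrite le_max lexx orbT.
have zn0 i n : 0 <= zn i n by rewrite le_max lexx orbT.
have zE i n : z i n = zp i n - zn i n.
  rewrite /zp /zn; case: (leP (z i n) 0) => h.
    by rewrite max_l ?oppr_ge0// sub0r opprK.
  by rewrite max_r ?subr0// oppr_le0 ltW.
have fin : (\sum_(i <- s) \esum_(n in [set: int]) (zn i n)%:E)%E \is a fin_num.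
  rewrite ge0_fin_numE; last by apply: sume_ge0 => i _; apply: esum_ge0 => n _; rewrite lee_fin.
  elim: s {AB} => [|i s IH]; first by rewrite big_nil ltry.
  rewrite big_cons lte_add_pinfty//.
  apply: le_lt_trans (zs i); apply: le_esum => n _; rewrite lee_fin /zn ge_max normr_ge0.
  by rewrite -normrN ler_norm.
(* Adding the negative parts to both sides keeps every term nonnegative; they have finite sum and
   can be subtracted at the end. *)
have E : (\esum_(n in [set: int]) ((A n)%:E + \sum_(i <- s) (zn i n)%:E) =
          \esum_(n in [set: int]) ((B n)%:E + \sum_(i <- s) (zp i n)%:E))%E.
  apply: eq_esum => n _; rewrite !sumEFin -!EFinD; congr EFin.
  rewrite AB -addrA -big_split/=; congr (_ + _); apply: eq_bigr => i _.
  by rewrite zE subrK.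
move: E; rewrite !esumD; try by move=> n _; rewrite ?lee_fin//; apply: sume_ge0 => i _; rewrite lee_fin.
rewrite !esum_sum//; try by move=> n i _ _; rewrite lee_fin.
have -> : (\sum_(i <- s) \esum_(n in [set: int]) (zp i n)%:E =
           \sum_(i <- s) \esum_(n in [set: int]) (zn i n)%:E)%E.
  by apply: eq_bigr => i _; exact: (esum_antisym (zq i)).
move=> h; have := congr1 (fun x => x - (\sum_(i <- s) \esum_(n in [set: int]) (zn i n)%:E))%E h.
by rewrite !addeK.
Qed.

Lemma esum_natS (a : nat -> \bar R) : (forall n, (0 <= a n)%E) ->
  (\esum_(n in [set: nat]) a n = a 0%N + \esum_(n in [set: nat]) a n.+1)%E.
Proof.
move=> a0; rewrite (esumID [set 0%N])// setTI esum_set1//; congr (_ + _)%E.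
apply: reindex_esum; split.
- by move=> n _; split.
- by move=> i j _ _ [].
- by move=> [[_ []//]|n _]; exists n.
Qed.

End Cancellation.

(** * Gabor and Wilson sums over m for a fixed n *)

Section FrequencySide.
Variable R : realType.
Local Notation C := (complex R).
Local Notation Re := complex.Re.
Local Notation Im := complex.Im.
Local Notation mu := (@lebesgue_measure R).
Implicit Types f g h F H : R -> C.
Variables (a d : R) (ga : R -> R).
Hypothesis d0 : 0 < d.
Hypothesis ad : a * d = 2^-1.
Local Notation D := (`[0, d[%classic : set R).

Definition cwindow : R -> C := fun x => real_complex R (ga x).
Hypothesis LG : L2 cwindow.

Definition cwindow_shift (n : int) : R -> C := fun x => cwindow (x + n%:~R * d).
Definition freq_gabor (mn : int * int) : R -> C := fun s => expi (mn.1%:~R * a * s) * cwindow_shift mn.2 s.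

Lemma L2_cwindow_shift n : L2 (cwindow_shift n). Proof. exact: L2_shift. Qed.

Lemma L2_freq_gabor mn : L2 (freq_gabor mn).
Proof.
apply: (@L2_expi _ (fun s => mn.1%:~R * a * s)); last exact: L2_cwindow_shift.
have -> : (fun s : R => mn.1%:~R * a * s) = (fun s => mn.1%:~R * a * s + 0).
  by apply/funext => x; rewrite addr0.
exact: measurable_affine.
Qed.

Lemma cwindow_shift_conj n s : conjc (cwindow_shift n s) = cwindow_shift n s. Proof. exact: conjcC. Qed.

Lemma nrm_tile H : L2 H ->
  (\esum_(n in [set: int]) (nrm (cut D (fun x => H (x + n%:~R * d)%R)))%:E = (nrm H)%:E)%E.
Proof.
move=> LH; rewrite -l2sqE// /l2sq (ge0_integral_tile d0); last 2 first.
- by apply/measurable_EFinP; apply: measurable_sqmod; exact: L2_measurable.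
- by move=> x; rewrite lee_fin sqmod_ge0.
apply: eq_esum => n _.
rewrite -l2sqE; last by apply: L2_cut => //; exact: L2_shift.
rewrite /l2sq [RHS]integral_mkcond; apply: eq_integral => x _.
by rewrite patchE sqmod_cut indicE; case: (x \in D); rewrite ?mul1r ?mul0r.
Qed.

Section OneFunction.
Variables (F : R -> C) (M B : R) (K : nat).
Hypothesis mF : cmeasurable F.
Hypothesis FM : csupp M F.
Hypothesis FB : forall x, sqmod (F x) <= B.
Hypothesis MK : M < K%:R * d.

Definition window_prod (n : int) : R -> C := fun s => F s * cwindow_shift n s.

Lemma L2_F : L2 F. Proof. exact: (L2_csupp_bdd mF FM FB). Qed.

Lemma L2_window_prod n : L2 (window_prod n).
Proof. by apply: (L2_bdd_mul mF FB); exact: L2_cwindow_shift. Qed.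

Lemma csupp_window_prod n : csupp M (window_prod n).
Proof. by move=> x hx; rewrite /window_prod FM// mul0r. Qed.

Definition coef (m : int) H : C := cint setT (fun s => H s * expi (- (m%:~R * a * s))).

Lemma ip_freq_gabor m n : ip F (freq_gabor (m, n)) = coef m (window_prod n).
Proof. by apply: eq_cint => s; rewrite conjcM expiJ cwindow_shift_conj /window_prod/=; ring. Qed.

Local Notation fo b n := (fold d K b (window_prod n)).

Lemma L2_fo b n : L2 (fo b n). Proof. exact: L2_fold (L2_window_prod n). Qed.

(** The sum over m of |<F, freq_gabor (m, n)>|^2, even m giving the plain fold and odd m the
    alternating one. *)
Definition gabor_energy (n : int) : R := d * (nrm (fo false n) + nrm (fo true n)).

Lemma esum_coef_even H : L2 H -> csupp M H ->
  (\esum_(j in [set: int]) (sqmod (coef (2 * j)%R H))%:E = (d * nrm (fold d K false H))%:E)%E.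
Proof.
move=> LH HM; rewrite -(fold_parseval d0 ad false LH HM MK).
by apply: eq_esum => j _; rewrite /coef addr0.
Qed.

Lemma esum_coef_odd H : L2 H -> csupp M H ->
  (\esum_(j in [set: int]) (sqmod (coef (2 * j + 1)%R H))%:E = (d * nrm (fold d K true H))%:E)%E.
Proof. by move=> LH HM; rewrite -(fold_parseval d0 ad true LH HM MK). Qed.

Lemma esum_gabor n :
  (\esum_(m in [set: int]) (sqmod (ip F (freq_gabor (m, n))))%:E = (gabor_energy n)%:E)%E.
Proof.
under eq_esum do rewrite ip_freq_gabor.
rewrite esum_int_parity; last by move=> m; rewrite lee_fin sqmod_ge0.
rewrite esum_coef_even ?esum_coef_odd; try exact: L2_window_prod; try exact: csupp_window_prod.
by rewrite -EFinD -mulrDr.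
Qed.

(** The Wilson elements in the frequency domain without chirp and constant phases, which
    [ftpair_wilson] restores. *)
Definition freq_wilson (mn : int * nat) : R -> C :=
  if mn.2 == 0%N then freq_gabor (2 * mn.1, 0)
  else if ~~ odd (`|mn.1|%N + mn.2)%N then
    fun s => real_complex R (Num.sqrt 2)^-1 * (freq_gabor (mn.1, mn.2%:Z) s + freq_gabor (mn.1, - mn.2%:Z) s)
  else
    fun s => imagi * real_complex R (Num.sqrt 2)^-1 *
      (freq_gabor (mn.1, mn.2%:Z) s - freq_gabor (mn.1, - mn.2%:Z) s).

Lemma sqmod_half : sqmod (real_complex R (Num.sqrt 2)^-1) = 2^-1.
Proof. by rewrite sqmodC exprVn sqr_sqrtr// ler0n. Qed.

Lemma sqmod_imagi : sqmod (imagi : C) = 1.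
Proof. by rewrite /sqmod Re_imagi Im_imagi; ring. Qed.

Lemma coefD m H H' : L2 H -> csupp M H -> L2 H' -> csupp M H' ->
  coef m (fun s => H s + H' s) = coef m H + coef m H'.
Proof.
move=> LH HM LH' HM'; rewrite /coef -cintD.
- by apply: eq_cint => s; rewrite mulrDl.
- have := cintegrable_ft (- (m%:~R * a)) 1 LH HM; congr cintegrable; apply/funext => s.
  by rewrite mulr1 mulNr.
- have := cintegrable_ft (- (m%:~R * a)) 1 LH' HM'; congr cintegrable; apply/funext => s.
  by rewrite mulr1 mulNr.
Qed.

Definition window_prod_pm (e : R) (n : nat) : R -> C :=
  fun s => window_prod n%:Z s + real_complex R e * window_prod (- n%:Z) s.

Lemma L2_window_prod_pm e n : L2 (window_prod_pm e n).
Proof. by apply: L2D; [exact: L2_window_prod|apply: L2Z; exact: L2_window_prod]. Qed.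

Lemma csupp_window_prod_pm e n : csupp M (window_prod_pm e n).
Proof. by apply: csuppD; [exact: csupp_window_prod|apply: csuppZ; exact: csupp_window_prod]. Qed.

(** The sign (-1)^(m+n) merges the sum and difference cases; the factor i in the odd case disappears
    in the modulus. *)
Lemma sqmod_ip_freq_wilson m n : (0 < n)%N ->
  sqmod (ip F (freq_wilson (m, n))) = 2^-1 * sqmod (coef m (window_prod_pm ((-1) ^+ (`|m| + n)) n)).
Proof.
move=> n0; have LF := L2_F.
have cE e : coef m (window_prod_pm e n) = ip F (freq_gabor (m, n%:Z)) + real_complex R e * ip F (freq_gabor (m, - n%:Z)).
  rewrite coefD; [|exact: L2_window_prod|exact: csupp_window_prod|by apply: L2Z; exact: L2_window_prod|
    by apply: csuppZ; exact: csupp_window_prod].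
  rewrite !ip_freq_gabor; congr (_ + _); rewrite /coef -cintZ.
    by apply: eq_cint => s; rewrite mulrA.
  have := cintegrable_ft (- (m%:~R * a)) 1 (L2_window_prod (- n%:Z)) (@csupp_window_prod (- n%:Z)).
  by congr cintegrable; apply/funext => s; rewrite mulr1 mulNr.
have L1 := L2_freq_gabor (m, n%:Z); have L2' := L2_freq_gabor (m, - n%:Z).
rewrite /freq_wilson /= -[n == 0%N]/(n == 0%N) (gtn_eqF n0) cE.
case: ifPn => ho.
- rewrite ipZr//; last exact: L2D.
  rewrite sqmodM sqmodJ sqmod_half ipDr//; congr (_ * sqmod (_ + _)).
  by rewrite -signr_odd (negbTE ho) expr0 mul1r.
- rewrite ipZr//; last exact: L2B.
  rewrite sqmodM sqmodJ sqmodM sqmod_imagi mul1r sqmod_half ipBr//; congr (_ * sqmod (_ + _)).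
  rewrite negbK in ho; rewrite -signr_odd ho expr1.
  by apply: complexP; rewrite !ReImE; ring.
Qed.

(** For fixed n >= 1 the sign in [window_prod_pm] is (-1)^n for even m and the opposite for odd m.
    At n = 0 only even translates occur. *)
Definition wilson_energy (n : nat) : R :=
  if n == 0%N then d * nrm (fo false 0)
  else 2^-1 * (d * nrm (fold d K false (window_prod_pm ((-1) ^+ n) n))
             + d * nrm (fold d K true (window_prod_pm (- (-1) ^+ n) n))).

Lemma odd_abs2 (j : int) : odd `|(2 * j)%R|%N = false /\ odd `|(2 * j + 1)%R|%N = true.
Proof.
split; first by rewrite abszM oddM.
case: j => k; first by rewrite -PoszM -PoszD absz_nat oddD oddM.
have -> : Negz k = - (k%:Z + 1) by rewrite NegzE -[k.+1]addn1 PoszD.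
have -> : 2 * - (k%:Z + 1) + 1 = - (2 * k + 1)%N%:Z by rewrite PoszD PoszM; ring.
by rewrite abszN absz_nat oddD oddM.
Qed.

Lemma esum_wilson n :
  (\esum_(m in [set: int]) (sqmod (ip F (freq_wilson (m, n))))%:E = (wilson_energy n)%:E)%E.
Proof.
have [->|n0] := posnP n.
  rewrite /wilson_energy/= -esum_coef_even; [|exact: L2_window_prod|exact: csupp_window_prod].
  by apply: eq_esum => m _; rewrite /freq_wilson/= ip_freq_gabor.
rewrite /wilson_energy gtn_eqF// esum_int_parity; last by move=> m; rewrite lee_fin sqmod_ge0.
have h2 : 0 < (2^-1 : R) by rewrite invr_gt0.
have E1 : (\esum_(j in [set: int]) (sqmod (ip F (freq_wilson ((2 * j)%R, n))))%:E =
    2^-1%:E * (d * nrm (fold d K false (window_prod_pm ((-1) ^+ n) n)))%:E)%E.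
  rewrite -esum_coef_even; [|exact: L2_window_prod_pm|exact: csupp_window_prod_pm].
  rewrite -esumZ//; last by move=> j; rewrite lee_fin sqmod_ge0.
  apply: eq_esum => j _; rewrite sqmod_ip_freq_wilson// EFinM.
  by rewrite -signr_odd oddD (odd_abs2 j).1 signr_odd.
have E2 : (\esum_(j in [set: int]) (sqmod (ip F (freq_wilson ((2 * j + 1)%R, n))))%:E =
    2^-1%:E * (d * nrm (fold d K true (window_prod_pm (- (-1) ^+ n) n)))%:E)%E.
  rewrite -esum_coef_odd; [|exact: L2_window_prod_pm|exact: csupp_window_prod_pm].
  rewrite -esumZ//; last by move=> j; rewrite lee_fin sqmod_ge0.
  apply: eq_esum => j _; rewrite sqmod_ip_freq_wilson// EFinM.
  by rewrite -signr_odd oddD (odd_abs2 j).2 signrN signr_odd.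
by rewrite E1 E2 -!EFinM -EFinD mulrDr.
Qed.

(** The mixed terms from expanding the squared norms in [wilson_energy]; the two foldings enter with
    opposite signs because the sign of [window_prod_pm] depends on the parity of m. *)
Definition cross_energy (n : int) : R := (-1) ^ n * d *
  (Re (ip (fo false n) (fo false (- n))) - Re (ip (fo true n) (fo true (- n)))).

Lemma nrm_fold_window_prod_pm b (e : R) n : e ^+ 2 = 1 -> nrm (fold d K b (window_prod_pm e n)) =
  nrm (fo b n%:Z) + nrm (fo b (- n%:Z)) + 2 * e * Re (ip (fo b n%:Z) (fo b (- n%:Z))).
Proof.
move=> e1; rewrite /window_prod_pm foldD foldZ nrmD; [|exact: L2_fo|by apply: L2Z; exact: L2_fo].
rewrite nrmZ ?ipZr; try exact: L2_fo.
by rewrite sqmodC e1 mul1r conjcC ReM ReC ImC; ring.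
Qed.

Lemma wilson_energyE n : (0 < n)%N -> wilson_energy n = 2^-1 * (gabor_energy n%:Z + gabor_energy (- n%:Z)) + cross_energy n%:Z.
Proof.
move=> n0; rewrite /wilson_energy gtn_eqF// !nrm_fold_window_prod_pm ?sqrrN ?sqrr_sign// /gabor_energy /cross_energy.
rewrite -[(-1) ^ n%:Z]/((-1) ^+ n); set e := (-1) ^+ n.
by field.
Qed.

End OneFunction.
End FrequencySide.

(** * Cancellation of the cross terms in the sum over n *)

Section WilsonFrequency.
Local Arguments complex.Re : simpl never.
Local Arguments complex.Im : simpl never.
Variable R : realType.
Local Notation C := (complex R).
Local Notation Re := complex.Re.
Local Notation Im := complex.Im.
Local Notation mu := (@lebesgue_measure R).
Implicit Types f g h F H : R -> C.
Variables (a d : R) (ga : R -> R).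
Hypothesis d0 : 0 < d.
Hypothesis ad : a * d = 2^-1.
Local Notation D := (`[0, d[%classic : set R).
Local Notation rcg := (cwindow ga).
Hypothesis LG : L2 rcg.
Local Notation gsg := (cwindow_shift d ga).
Local Notation EEg := (freq_gabor a d ga).
Local Notation psig := (freq_wilson a d ga).

Section Summation.
Variables (F : R -> C) (M B : R) (K : nat).
Hypothesis mF : cmeasurable F.
Hypothesis FM : csupp M F.
Hypothesis FB : forall x, sqmod (F x) <= B.
Hypothesis MK : M < K%:R * d.
Local Notation HnF := (window_prod d ga F).
Local Notation pc k n := (piece d K k (HnF n)).
Local Notation ep k := (eps R K true k).
Local Notation gvF := (gabor_energy d ga F K).
Local Notation xvF := (cross_energy d ga F K).
Local Notation wvF := (wilson_energy d ga F K).

Let L2pc (k : nat) n : L2 (pc k n).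
Proof. by apply: L2_piece; exact: (L2_window_prod d LG mF FB). Qed.

(** The contribution of a pair of cells: the first factor is 0 when k + l is even and 2 when it is
    odd. *)
Definition cross_term (kl : 'I_(2 * K) * 'I_(2 * K)) (n : int) : R :=
  (1 - ep kl.1 * ep kl.2) * ((-1) ^ n * d * Re (ip (pc kl.1 n) (pc kl.2 (- n)))).

Lemma Re_ip_fold b n : Re (ip (fold d K b (HnF n)) (fold d K b (HnF (- n)))) =
  \sum_(kl : 'I_(2 * K) * 'I_(2 * K)) eps R K b kl.1 * eps R K b kl.2 *
    Re (ip (pc kl.1 n) (pc kl.2 (- n))).
Proof.
rewrite ip_suml; [|by move=> k; apply: L2Z|by apply: L2_fold; exact: (L2_window_prod d LG mF FB)].
rewrite Re_sum -(pair_bigA _ (fun k l : 'I_(2 * K) => eps R K b k * eps R K b l *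
  Re (ip (pc k n) (pc l (- n))))); apply: eq_bigr => k _.
rewrite /fold ip_sumr; [|by move=> l; apply: L2Z|by apply: L2Z].
rewrite Re_sum; apply: eq_bigr => l _.
rewrite ipZr ?ipZl//; last exact: L2Z.
by rewrite conjcC !(ReM, ImM, ReC, ImC); ring.
Qed.

Lemma cross_energyE n : xvF n = \sum_kl cross_term kl n.
Proof.
rewrite /xvF !Re_ip_fold -sumrB mulr_sumr; apply: eq_bigr => kl _.
by rewrite /cross_term /eps; ring.
Qed.

(** The substitution exchanges the window at s + o_k + n d with the window at s + o_l - n d, where
    o_k and o_l are the cell origins. The window being real, the inner product is unchanged, and
    (-1)^n is multiplied by (-1)^(k+l). *)
Lemma cross_term_antisym (kl : 'I_(2 * K) * 'I_(2 * K)) n :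
  cross_term kl ((kl.2 : nat)%:Z - (kl.1 : nat)%:Z - n) = - cross_term kl n.
Proof.
case: kl => k l; rewrite /cross_term/=; set n' := _ - _ - n.
have -> : ip (pc k n') (pc l (- n')) = ip (pc k n) (pc l (- n)).
  apply: eq_cint => s; rewrite /piece /cut /window_prod !conjcM !cwindow_shift_conj.
  have -> : gsg n' (s + cell_origin d K k) = gsg (- n) (s + cell_origin d K l).
    by rewrite /cwindow_shift; congr (cwindow _ _); rewrite /cell_origin /n' !intrB intrN; ring.
  have -> : gsg (- n') (s + cell_origin d K l) = gsg n (s + cell_origin d K k).
    by rewrite /cwindow_shift; congr (cwindow _ _); rewrite /cell_origin /n' intrN !intrB; ring.
  by ring.
rewrite /n' !expfzDr ?oppr_eq0 ?oner_eq0// !signz_opp /eps.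
rewrite -[(-1) ^ (l : nat)%:Z]/((-1) ^+ l) -[(-1) ^ (k : nat)%:Z]/((-1) ^+ k) !exprD.
have s1 m : (-1 : R) ^+ m * (-1) ^+ m = 1 by rewrite -expr2 sqrr_sign.
set p := (-1) ^+ k; set q := (-1) ^+ l; set r := (-1) ^+ K.
have -> : p * r * (q * r) = p * q by rewrite mulrACA s1 mulr1.
have pq : (p * q) * (p * q) = 1 by rewrite mulrACA !s1 mulr1.
set X := Re _; set e := (-1) ^ n.
(* Since (p q)^2 = 1, multiplying 1 - p q by p q reverses its sign; this covers both parities of k +
   l. *)
have -> : (1 - p * q) * (q * p * e * d * X) = (p * q - (p * q) * (p * q)) * (e * d * X) by ring.
by rewrite pq; ring.
Qed.

Lemma nrm_piece_le (k : nat) n :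
  nrm (pc k n) <= B * nrm (cut D (fun x => rcg (x + (n + (k%:Z - K%:Z))%:~R * d))).
Proof.
have B0 : 0 <= B := le_trans (sqmod_ge0 (F 0)) (FB 0).
have Lr (m : int) : L2 (cut D (fun x => rcg (x + m%:~R * d))).
  by apply: L2_cut => //; exact: L2_shift.
have BE : B = sqmod (real_complex R (Num.sqrt B)) by rewrite sqmodC sqr_sqrtr.
rewrite {1}BE -nrmZ; last exact: Lr.
apply: le_nrm => //; first by apply: L2Z; exact: Lr.
move=> x; rewrite sqmodM -BE !sqmod_cut mulrCA ler_wpM2l//.
rewrite /window_prod sqmodM /cwindow_shift.
have -> : x + cell_origin d K k + n%:~R * d = x + (n + (k%:Z - K%:Z))%:~R * d.
  by rewrite /cell_origin intrD intrB; ring.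
by rewrite ler_wpM2r ?sqmod_ge0.
Qed.

(** Each inner product is bounded by the window's energy on two cells of length d. As n varies these
    cells tile the line, so the total is a multiple of the finite norm of the window. *)
Lemma cross_term_summable kl : (\esum_(n in [set: int]) `|cross_term kl n|%:E < +oo)%E.
Proof.
case: kl => k l.
have B0 : 0 <= B := le_trans (sqmod_ge0 (F 0)) (FB 0).
pose G (m : int) := nrm (cut D (fun x => rcg (x + m%:~R * d))).
have G0 m : 0 <= G m by exact: nrm_ge0.
pose kk := (k : nat)%:Z - K%:Z; pose ll := (l : nat)%:Z - K%:Z.
have c0 : 0 < 2 * d * (B + 1) by rewrite !mulr_gt0//; lra.
have sgn1 (e : R) : e = 1 \/ e = -1 -> `|e| = 1 by move=> [->|->]; rewrite ?normrN normr1.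
have H n : `|cross_term (k, l) n| <= (2 * d * (B + 1)) * (G (n + kk) + G (- n + ll)).
  rewrite /cross_term/= normrM.
  have h1 : `|1 - ep k * ep l| <= 2.
    apply: (le_trans (ler_normB _ _)); rewrite normr1 normrM /eps !normrX normrN normr1 !expr1n.
    by lra.
  have h2 : `|(-1) ^ n * d * Re (ip (pc k n) (pc l (- n)))|
      <= d * (nrm (pc k n) + nrm (pc l (- n))).
    have s1 : `|(-1 : R) ^ n| = 1.
      by have := congr1 (fun x : R => `|x|) (signz_sqr R n); rewrite normrM normr1 => /eqP;
        rewrite -expr2 sqrf_eq1 => /orP[/eqP//|/eqP h]; have := normr_ge0 ((-1 : R) ^ n);
        rewrite h; lra.
    rewrite !normrM s1 mul1r (gtr0_norm d0) ler_pM2l// ler_norml.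
    have L1 := L2pc k n; have L2' := L2pc l (- n).
    have := nrm_ge0 (fun x => pc k n x + pc l (- n) x); rewrite nrmD//.
    have := nrm_ge0 (fun x => pc k n x - pc l (- n) x); rewrite nrmB//.
    have := nrm_ge0 (pc k n); have := nrm_ge0 (pc l (- n)); lra.
  have n1 := nrm_piece_le k n; have n2 := nrm_piece_le l (- n).
  apply: (le_trans (ler_pM (normr_ge0 _) (normr_ge0 _) h1 h2)).
  rewrite -/kk -/(G _) in n1; rewrite -/ll -/(G _) in n2.
  have g1 := G0 (n + kk); have g2 := G0 (- n + ll).
  rewrite mulrA -[leRHS]mulrA; apply: ler_wpM2l; first by rewrite mulr_ge0// ltW.
  by rewrite mulrDl mul1r [B * _]mulrDr; lra.
apply: (@le_lt_trans _ _ (\esum_(n in [set: int])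
    ((2 * d * (B + 1))%:E * ((G (n + kk))%:E + (G (- n + ll))%:E)))%E).
  by apply: le_esum => n _; rewrite -EFinD -EFinM lee_fin.
rewrite esumZ//; last by move=> n; rewrite -EFinD lee_fin addr_ge0.
rewrite esumD; try by move=> n _; rewrite lee_fin.
have T := nrm_tile d0 LG.
have -> : (\esum_(n in [set: int]) (G (n + kk)%R)%:E = (nrm rcg)%:E)%E.
  rewrite -T [RHS](@reindex_esumT _ _ _ (fun n : int => n + kk))//.
  by exists (fun n : int => n - kk) => n; rewrite ?addrK ?subrK.
have -> : (\esum_(n in [set: int]) (G (- n + ll)%R)%:E = (nrm rcg)%:E)%E.
  rewrite -T [RHS](@reindex_esumT _ _ _ (fun n : int => - n + ll))//.
  by exists (fun n : int => ll - n) => n; ring.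
by rewrite -EFinD -EFinM ltry.
Qed.

Let gv0 n : 0 <= gvF n.
Proof. by rewrite /gabor_energy mulr_ge0 ?(ltW d0)// addr_ge0// nrm_ge0. Qed.

Let wv0 n : 0 <= wvF n.
Proof.
rewrite /wilson_energy; case: ifP => _; first by rewrite mulr_ge0 ?(ltW d0)// nrm_ge0.
rewrite mulr_ge0 ?invr_ge0// addr_ge0// mulr_ge0 ?(ltW d0)//; exact: nrm_ge0.
Qed.

Let xvN n : xvF (- n) = xvF n.
Proof.
rewrite /cross_energy opprK signz_opp; have L b m := L2_fo d LG K mF FB b m.
by rewrite (ipC (L false (- n)) (L false n)) (ipC (L true (- n)) (L true n)) !ReJ.
Qed.

(** The Wilson energies spread over all integers: [av n] is the Wilson energy of |n| for n nonzero,
    and twice that energy at 0. Its total is thus twice the Wilson sum. *)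
Let av (n : int) : R := 2^-1 * (gvF n + gvF (- n)) + xvF n.

Let av_pos (k : nat) : av k.+1%:Z = wvF k.+1.
Proof. by rewrite (wilson_energyE d LG K mF FB (ltn0Sn k)). Qed.

Let av_neg (k : nat) : av (- k.+1%:Z) = wvF k.+1.
Proof. by rewrite -av_pos /av opprK xvN [gvF _ + _]addrC. Qed.

(** At n = 0 the cross term removes the odd-m half of the Gabor energy and doubles the even half, in
    accordance with [psi_{m,0}] using only the translates by 2 m a. *)
Let av_0 : av 0 = 2 * wvF 0.
Proof.
rewrite /av /cross_energy /gabor_energy /wilson_energy oppr0 eqxx !ipff !ReC expr0z.
by field.
Qed.

Lemma sum_wilson_gabor :
  (2%:E * (\esum_(n in [set: nat]) (wvF n)%:E) = \esum_(n in [set: int]) (gvF n)%:E)%E.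
Proof.
have av0 n : 0 <= av n.
  by case: n => [[|k]|k]; [rewrite av_0 mulr_ge0|rewrite av_pos|rewrite NegzE av_neg].
have S0 n : 0 <= 2^-1 * (gvF n + gvF (- n)) by rewrite mulr_ge0 ?invr_ge0// addr_ge0.
have E := @esum_cancel R _ (index_enum ('I_(2 * K) * 'I_(2 * K))%type) cross_term
  (fun kl => (kl.2 : nat)%:Z - (kl.1 : nat)%:Z) av
  (fun n => 2^-1 * (gvF n + gvF (- n))) av0 S0
  (fun n => congr1 (fun x => 2^-1 * (gvF n + gvF (- n)) + x) (cross_energyE n)) cross_term_antisym cross_term_summable.
transitivity (\esum_(n in [set: int]) (av n)%:E)%E.
  rewrite esum_int_nat; last by move=> n; rewrite lee_fin.
  rewrite -esumZ//; try by move=> n; rewrite lee_fin.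
  rewrite [LHS]esum_natS; last by move=> n; rewrite mule_ge0// lee_fin.
  rewrite av_0 EFinM; congr (_ + _)%E; apply: eq_esum => k _.
  by rewrite av_pos av_neg -EFinM -EFinD; congr EFin; ring.
rewrite E; under eq_esum do rewrite EFinM EFinD.
have h2 : 0 < (2^-1 : R) by rewrite invr_gt0.
rewrite esumZ//; last by move=> n; rewrite -EFinD lee_fin addr_ge0.
rewrite esumD; try by move=> n _; rewrite lee_fin.
rewrite -[X in (_ * (_ + X))%E](@reindex_esumT _ _ _ (fun n : int => - n) (fun n => (gvF n)%:E));
  last by exists (fun n : int => - n) => n; rewrite opprK.
set S := (\esum_(n in _) _)%E.
have S00 : (0 <= S)%E by apply: esum_ge0 => n _; rewrite lee_fin.
(* Tightness has not been used yet, so [S] may still be infinite. *)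
case: S S00 => [r _| _|//].
  by rewrite -EFinD -EFinM; congr EFin; field.
by rewrite /= gt0_muley ?lte_fin.
Qed.

End Summation.
End WilsonFrequency.

(** * The Wilson system in the frequency domain *)

Section FrequencyParseval.
Local Arguments complex.Re : simpl never.
Local Arguments complex.Im : simpl never.
Variable R : realType.
Local Notation C := (complex R).
Local Notation mu := (@lebesgue_measure R).
Implicit Types f g h F H : R -> C.
Variables (a d : R) (ga : R -> R).
Hypothesis d0 : 0 < d.
Hypothesis ad : a * d = 2^-1.
Local Notation D := (`[0, d[%classic : set R).
Hypothesis LG : L2 (cwindow ga).
Hypothesis tight : forall F, bcsupp F ->
  (\esum_(mn in [set: int * int]) (sqmod (ip F (freq_gabor a d ga mn)))%:E = (2 * nrm F)%:E)%E.

Lemma tight_gabor_energy F M B K : cmeasurable F -> 0 <= M -> csupp M F -> (forall x, sqmod (F x) <= B) ->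
  M < K%:R * d -> (\esum_(n in [set: int]) (gabor_energy d ga F K n)%:E = (2 * nrm F)%:E)%E.
Proof.
move=> mF M0 FM FB MK.
have bF : bcsupp F by split => //; [exists M|exists B].
rewrite -(tight bF) esum_pair; last by move=> k; rewrite lee_fin sqmod_ge0.
rewrite esum_exchange; last by move=> i j; rewrite lee_fin sqmod_ge0.
by apply: eq_esum => n _; rewrite (esum_gabor d0 ad LG mF FM FB MK n).
Qed.

Lemma parseval_freq_wilson_bcsupp F : bcsupp F -> parseval (freq_wilson a d ga) F.
Proof.
move=> [mF [M M0 FM] [B FB]].
have Md : 0 <= M / d by rewrite divr_ge0// ltW.
pose K := Num.bound (M / d).
have MK : M < K%:R * d by rewrite -ltr_pdivrMr//; exact: archi_boundP.
rewrite /parseval esum_pair; last by move=> k; rewrite lee_fin sqmod_ge0.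
rewrite esum_exchange; last by move=> i j; rewrite lee_fin sqmod_ge0.
under eq_esum do rewrite (esum_wilson d0 ad LG mF FM FB MK).
have := sum_wilson_gabor d0 LG K mF FB.
rewrite (tight_gabor_energy mF M0 FM FB MK).
set S := (\esum_(n in _) _)%E.
case: S => [r|/eqP|/eqP]; last 2 first.
- by rewrite gt0_muley ?lte_fin.
- by rewrite gt0_muleNy ?lte_fin.
rewrite -EFinM => -[] h; congr EFin; lra.
Qed.

Lemma L2_freq_wilson i : L2 (freq_wilson a d ga i).
Proof.
rewrite /freq_wilson; case: ifP => _; first exact: L2_freq_gabor.
by case: ifP => _; apply: L2Z; [apply: L2D|apply: L2B]; exact: L2_freq_gabor.
Qed.

Lemma parseval_freq_wilson F : L2 F -> parseval (freq_wilson a d ga) F.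
Proof. by apply: parseval_L2; [exact: L2_freq_wilson|exact: parseval_freq_wilson_bcsupp]. Qed.

Let one1 : cmeasurable (cut D (fun _ => 1 : C)).
Proof. by apply: cmeasurable_cut => //; exact: cmeasurable_cst. Qed.

Let sq1 x : sqmod (cut D (fun _ => 1 : C) x) <= 1.
Proof.
rewrite (le_trans (sqmod_cut_le _ _ _))//.
by rewrite -[X in sqmod X]/(real_complex R 1) sqmodC expr1n.
Qed.

Let cs1 : csupp d (cut D (fun _ => 1 : C)).
Proof.
move=> x hx; rewrite cut_out//= in_itv/= => /andP[x0 xd].
by move: hx; rewrite ger0_norm// ltNge (ltW xd).
Qed.

Let nrm1 : nrm (cut D (fun _ => 1 : C)) = d.
Proof.
rewrite /nrm (_ : (fun x => _) = (cst 1 : R -> R) \_ D).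
  by rewrite -Rintegral_mkcond Rintegral_cst//= lebesgue_measure_itv/= lte_fin d0 sube0 mul1r.
apply/funext => x; rewrite sqmod_cut patchE indicE.
rewrite -[X in sqmod X]/(real_complex R 1) sqmodC expr1n mulr1.
by case: (x \in D).
Qed.

Let D_shift (s : R) (i : int) : D s -> D (s + i%:~R * d) -> i = 0.
Proof.
rewrite /= !in_itv/= => /andP[s0 sd] /andP[t0 td].
have h1 : i%:~R < 1 :> R by rewrite -(ltr_pM2r d0); lra.
have h2 : -1 < i%:~R :> R by rewrite -(ltr_pM2r d0); lra.
rewrite -[1]/(1%:~R) ltr_int in h1; rewrite -[-1]/((-1)%:~R) ltr_int in h2.
by case: i h1 h2 {t0 td} => [[|]|[|]].
Qed.

(* Testing the tight frame on the sum of [1] on the cell [0, d[ and [t] on the cell at distance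
   [2 n d]: both foldings of [F cwindow_shift_j] are equal, as the two cells have the same parity. *)
Lemma nrm_cwindow_shift (n : nat) (t : R) : (0 < n)%N ->
  nrm (fun x => cwindow ga x + real_complex R t * cwindow ga (x + (2 * n)%:R * d)) = 1 + t ^+ 2.
Proof.
move=> n0; set h := fun x => _.
have Lh : L2 h by apply: L2D => //; apply: L2Z; exact: L2_shift.
pose u : R -> C := cut D (fun _ => 1).
pose F s := u s + real_complex R t * u (s - (2 * n)%:R * d).
have Lu : L2 u by exact: (L2_csupp_bdd one1 cs1 sq1).
have Lu' : L2 (fun s => u (s - (2 * n)%:R * d)) by exact: (L2_shift (- ((2 * n)%:R * d))).
have mF : cmeasurable F by apply: L2_measurable; apply: L2D => //; exact: L2Z.
(* The test function lives on [0, d[ and [2 n d, (2 n + 1) d[; one further cell makes the inequality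
   M < K d strict. *)
pose K := (2 * n + 2)%N; pose M := (2 * n + 1)%:R * d.
have M0 : 0 <= M by rewrite mulr_ge0// ltW.
have MK : M < K%:R * d by rewrite ltr_pM2r// ltr_nat ltn_add2l.
have FM : csupp M F.
  apply: csuppD.
    by apply: csuppW cs1; rewrite -[leLHS]mul1r ler_pM2r// ler1n addn1.
  apply: csuppZ; apply: csuppW (csupp_shift (x := - ((2 * n)%:R * d)) cs1).
  rewrite normrN ger0_norm; last by rewrite mulr_ge0// ltW.
  by rewrite /M natrD mulrDl mul1r addrC.
have FB x : sqmod (F x) <= 2 + 2 * t ^+ 2.
  apply: (le_trans (sqmodD_le2 _ _)); rewrite sqmodM sqmodC.
  have := sq1 x; have := sq1 (x - (2 * n)%:R * d); rewrite -/u.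
  by have := sqr_ge0 t; nra.
have E := tight_gabor_energy mF M0 FM FB MK.
have epsK b (k : nat) : ~~ odd (k + K) -> eps R K b k = 1.
  by rewrite /eps; case: b => // /negbTE ho; rewrite -signr_odd ho.
have K2 : (K < 2 * K)%N by rewrite (mul2n K) -addnn -{1}[K]addn0 ltn_add2l /K addn2.
have Kn : (K + 2 * n < 2 * K)%N by rewrite (mul2n K) -addnn ltn_add2l /K addn2 ltnS leqnSn.
(* Cell [K] starts at 0, so the indicator translated by q d is seen exactly in cell K + q. *)
have uk (s : R) (k q : nat) : D s -> u (s + cell_origin d K k - q%:R * d) = (k == K + q)%N%:R.
  move=> Ds.
  have -> : s + cell_origin d K k - q%:R * d = s + (k%:Z - (K + q)%N%:Z)%:~R * d.
    by rewrite intrB PoszD intrD /cell_origin; ring.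
  have [->|kq] := eqVneq k (K + q)%N; first by rewrite subrr mul0r addr0 /u cut_in.
  rewrite /u cut_out// => /(D_shift Ds)/eqP; rewrite subr_eq0 => /eqP[] /eqP.
  by rewrite (negbTE kq).
have foE b (j : int) : fold d K b (window_prod d ga F j) = cut D (fun s => h (s + j%:~R * d)).
  apply/funext => s; have [Ds|Ds] := pselect (D s); last by rewrite fold_out// cut_out.
  rewrite cut_in// /fold.
  have -> : h (s + j%:~R * d) = \sum_(k < 2 * K) (real_complex R (eps R K b k) *
       ((k == K :> nat)%:R * cwindow_shift d ga j (s + cell_origin d K k)) +
     real_complex R (eps R K b k) *
       (real_complex R t * ((k == K + 2 * n :> nat)%N%:R * cwindow_shift d ga j (s + cell_origin d K k)))).
    rewrite big_split/= (bigD1 (Ordinal K2))//= eqxx mul1r epsK; last by rewrite addnn odd_double.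
    rewrite big1 ?addr0; last first.
      move=> k kK; rewrite (_ : (k == K :> nat) = false) ?mul0r ?mulr0//.
      by apply/negbTE; apply: contra kK => /eqP h'; apply/eqP/val_inj.
    rewrite (bigD1 (Ordinal Kn))//= eqxx mul1r epsK; last first.
      by rewrite addnAC addnn oddD odd_double oddM.
    rewrite big1 ?addr0; last first.
      move=> k kK; rewrite (_ : (k == K + 2 * n :> nat)%N = false) ?mul0r ?mulr0//.
      by apply/negbTE; apply: contra kK => /eqP h'; apply/eqP/val_inj.
    rewrite !mul1r /h /cwindow_shift; congr (cwindow ga _ + _ * cwindow ga _); rewrite /cell_origin ?natrD; ring.
  apply: eq_bigr => k _; rewrite /piece cut_in// /window_prod /F.
  have := uk s k 0%N Ds; rewrite mul0r subr0 addn0 => ->.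
  by rewrite (uk s k (2 * n)%N Ds); ring.
have nF : nrm F = d * (1 + t ^+ 2).
  rewrite /F nrmD//; last exact: L2Z.
  rewrite nrmZ// (nrm_shift (- ((2 * n)%:R * d)) Lu) nrm1 sqmodC ipZr//.
  have -> : ip u (fun s => u (s - (2 * n)%:R * d)) = 0.
    rewrite -cint0; apply: eq_cint => s.
    have [Ds|Ds] := pselect (D s); last by rewrite /u cut_out// mul0r.
    rewrite [X in conjc X](_ : _ = 0) ?conjc0 ?mulr0//.
    rewrite /u cut_out// => h'.
    have : (- (2 * n)%N%:Z : int) = 0.
      by apply: (D_shift Ds); rewrite intrN mulNr.
    by move/eqP; rewrite oppr_eq0 => /eqP[] /eqP; rewrite muln_eq0/= -leqn0 leqNgt n0.
  by rewrite mulr0 /complex.Re/=; ring.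
(* With both foldings equal, the Gabor energy at j is 2 d times the energy of [h] on the j-th cell.
   Summing over j gives 2 d nrm h, which tightness equates with 2 nrm F. *)
have : ((2 * d)%:E * (nrm h)%:E = (2 * (d * (1 + t ^+ 2)))%:E)%E.
  rewrite -nF -E -(nrm_tile d0 Lh) -esumZ; last 2 first.
  - by rewrite mulr_gt0.
  - by move=> m; rewrite lee_fin nrm_ge0.
  apply: eq_esum => m _; rewrite /gabor_energy !foE -EFinM; congr EFin; ring.
rewrite -EFinM => -[] e1.
have d2 : 2 * d != 0 by rewrite mulf_neq0 ?gt_eqF.
by apply: (mulfI d2); rewrite e1; ring.
Qed.

(** After removing a unimodular factor and translating by n d, an element with n >= 1 is a
    normalized ga(x) + t ga(x + 2 n d) with t = 1 or -1, of squared norm 2 before normalization. *)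
Lemma nrm_freq_wilson i : nrm (freq_wilson a d ga i) = 1.
Proof.
have nE m (H : R -> C) : nrm (fun s => expi (m * a * s) * H s) = nrm H.
  by apply: eq_Rintegral => x _; rewrite sqmodM sqmod_expi mul1r.
case: i => m n; have [n0|n0] := posnP n.
  rewrite n0 -[freq_wilson a d ga (m, 0%N)]/(freq_gabor a d ga (2 * m, 0)) /freq_gabor nE.
  (* With t = 0 the identity says that the window itself has norm one. *)
  have := @nrm_cwindow_shift 1 0 (ltn0Sn 0); rewrite expr0n addr0 => <-.
  by apply: eq_Rintegral => x _; rewrite /cwindow_shift rmorph0 !mul0r !addr0.
have -> : freq_wilson a d ga (m, n) = if ~~ odd (`|m|%N + n)%N then
    fun s => real_complex R (Num.sqrt 2)^-1 * (freq_gabor a d ga (m, n%:Z) s + freq_gabor a d ga (m, - n%:Z) s)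
  else
    fun s => imagi * real_complex R (Num.sqrt 2)^-1 *
      (freq_gabor a d ga (m, n%:Z) s - freq_gabor a d ga (m, - n%:Z) s).
  by case: n n0.
have L m' : L2 (freq_gabor a d ga m') by exact: L2_freq_gabor.
have key (t : R) : t ^+ 2 = 1 ->
    nrm (fun s => freq_gabor a d ga (m, - n%:Z) s + real_complex R t * freq_gabor a d ga (m, n%:Z) s) = 2.
  move=> t1; rewrite (_ : (fun s => _) = fun s => expi (m%:~R * a * s) *
      (cwindow_shift d ga (- n%:Z) s + real_complex R t * cwindow_shift d ga n%:Z s)); last first.
    by apply/funext => s; rewrite /freq_gabor/=; ring.
  rewrite nE; have := nrm_cwindow_shift t n0; rewrite t1 => e.
  have Lh : L2 (fun x => cwindow ga x + real_complex R t * cwindow ga (x + (2 * n)%:R * d)).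
    by apply: L2D => //; apply: L2Z; exact: L2_shift.
  rewrite -[2]/(1 + 1) -e -[RHS](nrm_shift (- (n%:R * d)) Lh).
  apply: eq_Rintegral => x _; congr sqmod; rewrite /cwindow_shift intrN mulNr.
  congr (_ + _ * cwindow ga _); rewrite natrM -[n%:Z%:~R]/(n%:R); ring.
case: ifP => _.
- rewrite nrmZ; last exact: L2D.
  rewrite sqmod_half (_ : (fun s => _) = fun s => freq_gabor a d ga (m, - n%:Z) s +
    real_complex R 1 * freq_gabor a d ga (m, n%:Z) s); last first.
    by apply/funext => s; rewrite rmorph1 mul1r addrC.
  by rewrite key ?expr1n// mulVf.
- rewrite nrmZ; last exact: L2B.
  rewrite sqmodM sqmod_imagi sqmod_half mul1r -nrmN (_ : (fun s => _) =
    fun s => freq_gabor a d ga (m, - n%:Z) s + real_complex R (-1) * freq_gabor a d ga (m, n%:Z) s); last first.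
    by apply/funext => s; rewrite opprB rmorphN rmorph1 mulN1r.
  by rewrite key ?sqrrN ?expr1n// mulVf.
Qed.

End FrequencyParseval.

(** * Transfer to the time domain *)

Section WilsonTransfer.
Local Arguments complex.Re : simpl never.
Local Arguments complex.Im : simpl never.
Variable R : realType.
Local Notation C := (complex R).
Local Notation mu := (@lebesgue_measure R).
Variables (a b d : R) (ga : R -> R) (g : R -> C).
Hypothesis d0 : 0 < d.
Hypothesis ad : a * d = 2^-1.
Hypothesis LG : L2 (cwindow ga).

(** The phase that the chirp N_{-b/d} removes from the inverse transform of [g]. *)
Definition quad (w : R) : R := - (b / d * w ^+ 2 / 2).
Hypothesis pg : ftpair 1 g (fun w => expi (quad w) * cwindow ga w).

Let s1 : (1 : R) ^+ 2 = 1. Proof. by rewrite expr1n. Qed.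
Let s1' : (-1 : R) ^+ 2 = 1. Proof. by rewrite sqrrN expr1n. Qed.

Lemma measurable_quad : measurable_fun setT quad.
Proof.
by apply: measurable_funN; apply: measurable_funM => //; apply: measurable_funM.
Qed.

Definition gabor_phase (m n : int) : C := expi (m%:~R * n%:~R / 2 + b * d * n%:~R ^+ 2 / 2).

(** Translating the chirp by n d produces a linear phase - n b w, which cancels the shear n b of the
    lattice. The remaining constants form [gabor_phase], the product m n a d being m n / 2. *)
Lemma ftpair_gabor (m n : int) : ftpair 1 (gabor a b d g (m, n))
  (fun w => gabor_phase m n * (expi (quad w) * freq_gabor a d ga (m, n) w)).
Proof.
have := ftpair_tfs (m%:~R * a + n%:~R * b) (n%:~R * d) pg.
congr ftpair; apply/funext => w; rewrite /freq_gabor /cwindow_shift /= /gabor_phase !mulrA -!expiD.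
congr (expi _ * _); rewrite /quad.
have dn : d != 0 by rewrite gt_eqF.
have -> : m%:~R * n%:~R / 2 = m%:~R * n%:~R * (a * d) by rewrite ad.
by field.
Qed.

Lemma ip_quad (F H : R -> C) : ip F (fun w => expi (quad w) * H w) =
  ip (fun w => expi (- quad w) * F w) H.
Proof. exact: (ip_expir quad F H). Qed.

Lemma bcsupp_quad F : bcsupp F -> bcsupp (fun w => expi (quad w) * F w).
Proof.
move=> [mF [M M0 FM] [B FB]]; split.
- by apply: cmeasurableM => //; apply: cmeasurable_expi; exact: measurable_quad.
- by exists M => // x hx; rewrite FM// mulr0.
- by exists B => x; rewrite sqmodM sqmod_expi mul1r.
Qed.

(** The frame identity is applied to the transform with sign -1 of e(quad) F; [gabor_phase] has
    modulus one and disappears. *)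
Lemma tight_frequency : tight_frame (gabor a b d g) 2 ->
  forall F, bcsupp F ->
  (\esum_(mn in [set: int * int]) (sqmod (ip F (freq_gabor a d ga mn)))%:E = (2 * nrm F)%:E)%E.
Proof.
move=> [_ T] F bF; have LF := L2_bcsupp bF.
have bF' := bcsupp_quad bF; have LF' := L2_bcsupp bF'.
have [_ [M M0 FM] _] := bF'.
set F' := (fun w => _) in bF' LF' FM.
have Lf := L2_ft s1' M0 LF' FM.
have nF' : nrm F' = nrm F.
  by apply: eq_Rintegral => x _; rewrite /F' sqmodM sqmod_expi mul1r.
have := T _ Lf; rewrite l2sqE// (nrm_ft s1' M0 LF' FM) nF' EFinM => <-.
apply: eq_esum => -[m n] _; congr EFin.
have [_ _ _ p2] := ftpair_gabor m n.
rewrite (p2 F' M M0 LF' FM).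
have LE : L2 (freq_gabor a d ga (m, n)) by exact: L2_freq_gabor.
rewrite ipZr//; last by apply: L2_expi => //; exact: measurable_quad.
have EF : (fun w => expi (- quad w) * F' w) = F.
  by apply/funext => w; rewrite /F' mulrA expiNK mul1r.
have c1 : sqmod (gabor_phase m n) = 1 by exact: sqmod_expi.
by rewrite sqmodM sqmodJ c1 mul1r (ip_quad F' (freq_gabor a d ga (m, n))) EF.
Qed.

Lemma ftpair_wilson i : exists2 u : C, sqmod u = 1 &
  ftpair 1 (wilson a b d g i) (fun w => u * (expi (quad w) * freq_wilson a d ga i w)).
Proof.
case: i => m n; have [n0|n0] := posnP n.
  exists (gabor_phase (2 * m) 0); first exact: sqmod_expi.
  have := ftpair_gabor (2 * m) 0; rewrite n0; congr ftpair.
  by apply/funext => t; rewrite /gabor /wilson/= !mul0r addr0 intrM.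
(* The two phases differ by e(- m n) = 1, so the sum and the difference in a Wilson element share
   one constant factor. *)
have cN : gabor_phase m (- n%:Z) = gabor_phase m n%:Z.
  rewrite /gabor_phase intrN sqrrN mulrN mulNr.
  have -> : - (m%:~R * n%:Z%:~R / 2) + b * d * n%:Z%:~R ^+ 2 / 2 =
    (- (m * n%:Z))%:~R + (m%:~R * n%:Z%:~R / 2 + b * d * n%:Z%:~R ^+ 2 / 2) :> R.
    by rewrite intrN intrM; field.
  by rewrite expiD expi_int mul1r.
pose ph : C := expi (- (b * d * n%:R ^+ 2) / 2).
have P1 := ftpair_gabor m n%:Z.
have P2 := ftpair_gabor m (- n%:Z); rewrite cN in P2.
have gN : gabor a b d g (m, - n%:Z) = tfs g (m%:~R * a - n%:R * b) (- (n%:R * d)).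
  by rewrite /gabor/= intrN !mulNr.
exists (ph * gabor_phase m n%:Z); first by rewrite sqmodM !sqmod_expi mulr1.
rewrite /wilson /freq_wilson [(m, n).1]/= [(m, n).2]/= !(gtn_eqF n0).
case: ifP => _.
- have := ftpairZ (real_complex R (Num.sqrt 2)^-1 * ph) s1 (ftpairD s1 P1 P2).
  rewrite gN; congr ftpair; apply/funext => w.
  by rewrite /=; ring.
- have := ftpairZ (imagi * real_complex R (Num.sqrt 2)^-1 * ph) s1
    (ftpairD s1 P1 (ftpairZ (-1) s1 P2)).
  rewrite gN; congr ftpair; apply/funext => w.
    by rewrite mulN1r.
  by rewrite mulN1r; ring.
Qed.

(** Adjunction needs time functions of bounded support, but their transforms are merely in L^2. So
    the density argument is applied twice: once in frequency, through [parseval_freq_wilson], and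
    once here in time. *)
Lemma ONB_wilson : tight_frame (gabor a b d g) 2 -> ONB (wilson a b d g).
Proof.
move=> /tight_frequency T.
have Lw i : L2 (wilson a b d g i) by have [u _ []] := ftpair_wilson i.
apply: ONB_parseval => //.
- move=> i; have [u u1 p] := ftpair_wilson i.
  rewrite (ftpair_nrm s1 p) -(nrm_freq_wilson d0 ad LG T i).
  by apply: eq_Rintegral => x _; rewrite !sqmodM u1 sqmod_expi !mul1r.
apply: parseval_L2 => // f bf; have Lf := L2_bcsupp bf.
have [_ [M M0 fM] _] := bf.
have LF := L2_ft s1 M0 Lf fM.
pose F w := expi (- quad w) * ft 1 f w.
have mq : measurable_fun setT (fun w => - quad w) by apply: measurable_funN; exact: measurable_quad.
have LF' : L2 F by exact: L2_expi.
have nF : nrm F = nrm f.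
  rewrite -(nrm_ft s1 M0 Lf fM).
  by apply: eq_Rintegral => x _; rewrite /F sqmodM sqmod_expi mul1r.
rewrite /parseval -nF -(parseval_freq_wilson d0 ad LG T LF').
apply: eq_esum => i _; congr EFin.
have [u u1 [_ _ p1 _]] := ftpair_wilson i.
have Lp := L2_freq_wilson a d LG i.
rewrite (p1 f M M0 Lf fM) ipZr//; last by apply: L2_expi => //; exact: measurable_quad.
by rewrite sqmodM sqmodJ u1 mul1r ip_quad.
Qed.

End WilsonTransfer.

Theorem theorem2p5 (R : realType) (a b d : R) (g : R -> complex R) :
  0 < a -> 0 < d -> 0 <= b -> b < a -> a * d = 2^-1 ->
  L2 g ->
  (exists u uh : R -> complex R,
      is_U b d g u /\ is_FT u uh /\ {ae @lebesgue_measure R, forall x, complex.Im (uh x) = 0}) ->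
  tight_frame (gabor a b d g) 2 ->
  ONB (wilson a b d g).
Proof.
move=> _ d0 _ _ ad Lg [u [uh [[h1 [h2 [[Lh1 c1] [[Lh2 c2] uE]]]] [[Luh c3] re]]]] T.
have s1 : (1 : R) ^+ 2 = 1 by rewrite expr1n.
have s1' : (-1 : R) ^+ 2 = 1 by rewrite sqrrN expr1n.
have dn : d != 0 by rewrite gt_eqF.
have p1 := ftpair_trunc s1 Lg Lh1 c1.
set chi := chirp (- b / d) h1 in c2.
have chiE t : chi t = expi (- quad b d t) * h1 t.
  by rewrite /chi /chirp; congr (expi _ * _); rewrite /quad; field.
have mq : measurable_fun setT (quad b d) := measurable_quad b d.
have Lchi : L2 chi.
  have : L2 (fun t => expi (- quad b d t) * h1 t) by apply: L2_expi => //; exact: measurable_funN.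
  by congr L2; apply/funext => t; rewrite chiE.
have p2 := ftpair_trunc s1' Lchi Lh2 c2.
have dv : 1 / d != 0 by rewrite div1r invr_eq0.
have Lu : L2 u.
  rewrite uE /dil; apply: L2Z; have := L2_affine 0 dv Lh2; congr L2.
  by apply/funext => t; rewrite addr0.
have p3 := ftpair_trunc s1' Lu Luh c3; rewrite uE in p3.
have r0 := real_after_transforms d0 p2 p3 re.
(* By [r0] the dechirped window differs from its real part by a function of norm 0. *)
pose ga x := complex.Re (chi x).
have [mR mI] := L2_measurable Lchi.
have LG : L2 (cwindow ga).
  apply: (L2_le (cmeasurable_real mR) _ (L2_integrable Lchi)) => x.
  by rewrite sqmodC; exact: Re_le_sqmod.
apply: (@ONB_wilson R a b d ga g d0 ad LG) => //.
(* Replaces [h1] by the chirp times the real window, which is the form that [ONB_wilson] expects. *)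
apply: (ftpair_nrm0 s1 p1); first exact: L2_expi.
rewrite -r0; apply: eq_Rintegral => x _.
have E : h1 x - expi (quad b d x) * cwindow ga x = expi (quad b d x) * (chi x - cwindow ga x).
  by rewrite chiE mulrBr mulrA expiKN mul1r.
rewrite E [LHS]sqmodM sqmod_expi mul1r; congr sqmod.
by apply: complexP; rewrite /cwindow /ga !ReImE; ring.
Qed.
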